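(* (1) For every $n\ge 1$ and every involution $\pi\in\mathcal{I}(n)$, the polynomial $\Upsilon_{\pi;(GL_n,O_n)}$ is independent of the labelled path in weak order on $\mathcal{I}(n)$ from $w_0$ to $\pi$ used to compute it. Likewise, for every $n\ge 1$ and every $\pi\in\mathcal{I}_{\mathrm{fpf}}(2n)$, the polynomial $\Upsilon_{\pi;(GL_{2n},Sp_{2n})}$ is independent of the labelled path in weak order on $\mathcal{I}_{\mathrm{fpf}}(2n)$ from $w_0$ to $\pi$ used to compute it. (2) Each $\Upsilon_{\pi;(GL_n,O_n)}$ is a linear combination with nonnegative integer coefficients of the single Schubert polynomials $\mathfrak{S}_w(x_1,\ldots,x_n)$, $w\in S_n$, and therefore lies in $\mathbb{Z}_{\ge 0}[x_1,\ldots,x_n]$. Each $\Upsilon_{\pi;(GL_{2n},Sp_{2n})}$ is a linear combination with nonnegative integer coefficients of the single Schubert polynomials $\mathfrak{S}_w(x_1,\ldots,x_{2n})$, $w\in S_{2n}$, and therefore lies in $\mathbb{Z}_{\ge 0}[x_1,\ldots,x_{2n}]$.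
   Context: Divided differences: $\partial_i(f)=\dfrac{f-s_i(f)}{x_i-x_{i+1}}$, where $s_i$ acts on polynomials by swapping $x_i$ and $x_{i+1}$. Also $s_i=(i,i+1)$ denotes the simple transposition in a symmetric group, $\ell$ is Coxeter length, and $w_0$ is the longest element of the symmetric group in question ($w_0(i)=m+1-i$ in $S_m$). Schubert polynomials: for $w\in S_m$, $\mathfrak{S}_{w_0}=x_1^{m-1}x_2^{m-2}\cdots x_{m-1}$ and $\mathfrak{S}_w=\partial_{w^{-1}w_0}\mathfrak{S}_{w_0}$, where $\partial_v=\partial_{i_1}\cdots\partial_{i_l}$ for a reduced word $v=s_{i_1}\cdots s_{i_l}$. Case $(GL_n,O_n)$: $\mathcal{I}(n)=\{\pi\in S_n:\pi^2=\mathrm{id}\}$ (this indexes the $O_n$-orbits on the flag variety $GL_n/B$). For $\pi\in\mathcal{I}(n)$ and $1\le i\le n-1$ define $s_i\cdot\pi$ by: (a) if $\ell(s_i\pi)>\ell(\pi)$, then $s_i\cdot\pi=\pi$; (b) otherwise, if $s_i\pi s_i\ne\pi$, then $s_i\cdot\pi=s_i\pi s_i$, and the edge from $\pi$ to $s_i\cdot\pi$ labelled $i$ is called solid; (c) otherwise $s_i\cdot\pi=s_i\pi$, and the edge from $\pi$ to $s_i\cdot\pi$ labelled $i$ is called dashed. The weak order on $\mathcal{I}(n)$ is generated by the relations $\pi\prec s_i\cdot\pi$ whenever $s_i\cdot\pi\neq\pi$; its minimum is $w_0$ and every $\pi\in\mathcal{I}(n)$ is reachable from $w_0$. Case $(GL_{2n},Sp_{2n})$: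 $\mathcal{I}_{\mathrm{fpf}}(2n)$ is the set of fixed-point-free involutions in $S_{2n}$. For $\pi\in\mathcal{I}_{\mathrm{fpf}}(2n)$ and $1\le i\le 2n-1$: (a') if $\ell(s_i\pi)>\ell(\pi)$ or $s_i\pi s_i=\pi$, then $s_i\cdot\pi=\pi$; (b') otherwise $s_i\cdot\pi=s_i\pi s_i$ (all edges are solid). The weak order is generated by $\pi\prec s_i\cdot\pi$ whenever $s_i\cdot\pi\ne\pi$; its minimum is $w_0$ and every element is reachable from $w_0$. A labelled path from $w_0$ to $\pi$ is an expression $\pi=s_{i_1}\cdot(s_{i_2}\cdot\,\cdots\,(s_{i_l}\cdot w_0)\cdots)$ in which each successive application of an $s_{i_k}$ changes the element. $\Upsilon$-polynomials: $\Upsilon_{w_0;(GL_n,O_n)}=\prod_{1\le i\le j\le n-i}(x_i+x_j)$ and $\Upsilon_{w_0;(GL_{2n},Sp_{2n})}=\prod_{1\le i<j\le 2n-i}(x_i+x_j)$. For a labelled path $\pi=s_{i_1}\cdot(\cdots(s_{i_l}\cdot w_0)\cdots)$ one defines $\Upsilon_{\pi}:=\widetilde\partial_{i_1}\widetilde\partial_{i_2}\cdots\widetilde\partial_{i_l}\Upsilon_{w_0}$ for the respective pair, where $\widetilde\partial_{i}=\partial_{i}$ if the corresponding edge of the path is solid and $\widetilde\partial_{i}=\tfrac12\partial_{i}$ if it is dashed. *)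

(* Defs.v *)
From mathcomp Require Import all_boot all_order all_fingroup all_algebra zify.
From mathcomp Require Import mpoly.

Set Implicit Arguments.
Unset Strict Implicit.
Unset Printing Implicit Defensive.

Import Order.TTheory GRing.Theory Num.Theory.
Local Open Scope ring_scope.

(* Product of permutations in the convention (u *o v)(x) = u (v x);            *)
(* MathComp's own product on 'S_m applies the left factor first.              *)
Notation "u *o v" := (v * u)%g (at level 40, left associativity, only parsing).

(* The simple transpositions s_1, ..., s_(m-1) are indexed from 0 by 'I_m.-1: *)
(* index i stands for the transposition of positions i and i+1 of 'I_m, that  *)
(* is, for s_(i+1); similarly the variable 'X_k stands for x_(k+1).           *)

Lemma ordS_subproof m (i : 'I_m.-1) : (i.+1 < m)%N.
Proof. by case: m i => [|m] []. Qed.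

Definition lo m (i : 'I_m.-1) : 'I_m := Ordinal (ltnW (ordS_subproof i)).
Definition hi m (i : 'I_m.-1) : 'I_m := Ordinal (ordS_subproof i).

Definition simple m (i : 'I_m.-1) : 'S_m := tperm (lo i) (hi i).

Definition word_perm m (w : seq 'I_m.-1) : 'S_m :=
  foldr (fun i v => simple i *o v) 1%g w.

Definition w0 m : 'S_m := perm (@rev_ord_inj m).

Definition inv m (v : 'S_m) : {set 'I_m * 'I_m} :=
  [set p : 'I_m * 'I_m | (p.1 < p.2)%N && (v p.2 < v p.1)%N].

Section Words.
Variable m : nat.
Implicit Types (v : 'S_m) (i : 'I_m.-1).

Lemma lo_neq_hi i : lo i != hi i.
Proof. by rewrite -val_eqE /= neq_ltn ltnSn. Qed.

Lemma simpleK i : (simple i * simple i)%g = 1%g.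
Proof. exact: tperm2. Qed.

Lemma simple_mulgK v i : (v * simple i * simple i)%g = v.
Proof. by rewrite -mulgA simpleK mulg1. Qed.

Lemma word_perm_cat (w1 w2 : seq 'I_m.-1) :
  word_perm (w1 ++ w2) = word_perm w1 *o word_perm w2.
Proof. by elim: w1 => [|i w1 IH] /=; rewrite ?mulg1 // IH mulgA. Qed.

Lemma word_perm_rev (w : seq 'I_m.-1) : word_perm (rev w) = ((word_perm w)^-1)%g.
Proof.
elim: w => [|i w IH] /=; first by rewrite invg1.
by rewrite rev_cons -cats1 word_perm_cat IH /= mul1g invMg tpermV.
Qed.

Lemma simple_lt i (a b : 'I_m) : (a, b) != (lo i, hi i) ->
  (a < b)%N -> (simple i a < simple i b)%N.
Proof.
rewrite xpair_eqE -!val_eqE /= => ne ab.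
have val_s (c : 'I_m) : val (simple i c) =
    if val c == i then i.+1 else if val c == i.+1 then val i else val c.
  rewrite /simple; case: tpermP => [->|->|].
  - by rewrite /= eqxx.
  - by rewrite /= eqxx gtn_eqF.
  by move=> /eqP; rewrite -val_eqE /= => /negPf-> /eqP; rewrite -val_eqE /= => /negPf->.
by move: (val_s a) (val_s b) ne ab => /= -> ->; do !case: ifP; lia.
Qed.

Lemma card_inv_ascent v i : (v (lo i) < v (hi i))%N ->
  #|inv (v *o simple i)| = #|inv v|.+1.
Proof.
move=> asc; pose f (p : 'I_m * 'I_m) := (simple i p.1, simple i p.2).
have fK : involutive f by case=> a b; rewrite /f /= !tpermK.
have in_lohi : (lo i, hi i) \in inv (v *o simple i).
  by rewrite inE /= !permM tpermL tpermR ltnSn asc.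
rewrite (cardsD1 (lo i, hi i)) in_lohi add1n; congr _.+1.
rewrite -(card_imset _ (can_inj fK)); apply: eq_card => p.
rewrite -[in LHS](fK p) mem_imset; last exact: can_inj fK.
rewrite !inE /f /= !permM !tpermK.
case: p => a b /=; apply/idP/idP.
  case/and3P=> ne ltab ltv; rewrite ltv andbT.
  by have := simple_lt ne ltab; rewrite !tpermK.
case/andP=> ltab ltv; rewrite ltv andbT.
have ne : (a, b) != (lo i, hi i).
  apply: contraTneq ltv => -[-> ->]; rewrite -leqNgt; exact: ltnW.
rewrite (simple_lt ne ltab) andbT; apply: contraTneq ltab => -[ea eb].
rewrite -[a](tpermK (lo i) (hi i)) -[b](tpermK (lo i) (hi i)).
rewrite -/(simple i) ea eb /simple tpermL tpermR -leqNgt; exact: leqnSn.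
Qed.

Lemma card_inv_descent v i : (v (hi i) < v (lo i))%N ->
  #|inv v| = #|inv (v *o simple i)|.+1.
Proof.
move=> des; rewrite -(@card_inv_ascent _ i); last by rewrite !permM tpermL tpermR.
by rewrite mulgA simpleK mul1g.
Qed.

Lemma ascent_or_descent v i : (v (lo i) < v (hi i))%N || (v (hi i) < v (lo i))%N.
Proof.
rewrite -neq_ltn; apply: contra_neq (lo_neq_hi i); by move/val_inj/perm_inj.
Qed.

Lemma increasing_id v : (forall i, v (lo i) < v (hi i))%N -> v = 1%g.
Proof.
move=> asc.
have step (k : nat) (k1 : (k < m)%N) (k2 : (k.+1 < m)%N) :
    (v (Ordinal k1) < v (Ordinal k2))%N.
  have ki : (k < m.-1)%N by lia.
  by have := asc (Ordinal ki); congr (v _ < v _)%N; apply: val_inj.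
have ge (k : nat) (hk : (k < m)%N) : (k <= v (Ordinal hk))%N.
  elim: k hk => [//|k IH] hk; have hk' := ltnW hk.
  exact: leq_ltn_trans (IH hk') (step _ _ _).
have le (d k : nat) (hk : (k < m)%N) : d = (m - k.+1)%N -> (v (Ordinal hk) <= k)%N.
  elim: d k hk => [|d IH] k hk hd; first by have := ltn_ord (v (Ordinal hk)); lia.
  have hk1 : (k.+1 < m)%N by lia.
  have hd1 : d = (m - k.+2)%N by lia.
  by have := IH _ hk1 hd1; have := step _ hk hk1; lia.
apply/permP=> -[k hk]; rewrite perm1; apply/val_inj/eqP; rewrite /= eqn_leq.
by rewrite (le _ _ _ erefl) ge.
Qed.

Lemma decreasing_w0 v : (forall i, v (hi i) < v (lo i))%N -> v = w0 m.
Proof.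
move=> des; have w0K : (w0 m * w0 m = 1)%g.
  by apply/permP=> x; rewrite permM !permE rev_ordK.
suff e : (v * w0 m = 1)%g by apply: (mulIg (w0 m)); rewrite e w0K.
apply: increasing_id => i; rewrite !permM !permE /=.
by have := des i; have := ltn_ord (v (lo i)); lia.
Qed.

Lemma word_of v : exists w : seq 'I_m.-1, size w = #|inv v| /\ word_perm w = v.
Proof.
have [k] := ubnP #|inv v|; elim: k v => // k IH v lek.
have [/existsP[i des]|/existsPn asc] := boolP [exists i, v (hi i) < v (lo i)]%N.
  have e := card_inv_descent des; case: (IH (v *o simple i)).
    by rewrite e ltnS in lek.
  move=> w [sw ww]; exists (w ++ [:: i]).
  rewrite size_cat sw addn1 -e; split=> //.
  by rewrite word_perm_cat ww /= mul1g mulgA simpleK mul1g.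
have -> : v = 1%g.
  by apply: increasing_id => i; have := ascent_or_descent v i; rewrite (negPf (asc i)) orbF.
exists [::]; split=> //=; apply/esym/eqP; rewrite cards_eq0; apply/eqP/setP=> p.
by rewrite !inE !perm1; case: ltngtP.
Qed.

Lemma word_exists v : exists k, [exists w : k.-tuple 'I_m.-1, word_perm w == v].
Proof.
case: (word_of v) => w [_ <-]; exists (size w).
by apply/existsP; exists (in_tuple w).
Qed.

End Words.

(* Coxeter length: the least length of a word in the simple transpositions.   *)
Definition len m (v : 'S_m) : nat := ex_minn (word_exists v).

Lemma reduced_word_exists m (v : 'S_m) :
  exists w : (len v).-tuple 'I_m.-1, word_perm w == v.
Proof. by rewrite /len; case: ex_minnP => k /existsP. Qed.

Definition reduced_word m (v : 'S_m) : seq 'I_m.-1 :=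
  xchoose (reduced_word_exists v).

Lemma lenE m (v : 'S_m) : len v = #|inv v|.
Proof.
rewrite /len; case: ex_minnP => k /existsP[w /eqP <-] mink.
apply/eqP; rewrite eqn_leq; apply/andP; split.
  have [w' [sw' ww']] := word_of (word_perm w).
  by rewrite -sw'; apply: mink; apply/existsP; exists (in_tuple w'); rewrite ww'.
rewrite -[leqRHS](size_tuple w) -size_rev -[word_perm w]invgK -word_perm_rev.
have invV (u : 'S_m) : #|inv u^-1| = #|inv u|.
  pose f (p : 'I_m * 'I_m) := (u p.2, u p.1).
  have fI : injective f by move=> [a b] [c d] [/perm_inj-> /perm_inj->].
  rewrite -(card_imset (mem (inv u)) fI); apply: eq_card => -[a b].
  rewrite -[a](permKV u) -[b](permKV u).
  have -> : (u (u^-1 a), u (u^-1 b))%g = f ((u^-1 b), (u^-1 a))%g by [].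
  by rewrite mem_imset // !inE /f /= !permK andbC.
rewrite invV; elim: (rev w) => [|i s IH] /=.
  rewrite leqn0 cards_eq0; apply/eqP/setP=> p.
  by rewrite !inE !perm1; case: ltngtP.
rewrite -invV invMg tpermV -/(simple i).
set u := word_perm s in IH *.
have [asc|des] := orP (ascent_or_descent (u^-1)%g i).
  by rewrite (card_inv_ascent asc) invV ltnS.
have := card_inv_descent des; rewrite invV => e.
by apply/leqW/(leq_trans _ IH); rewrite e.
Qed.

Lemma ddiff_exists m (i : 'I_m.-1) (f : {mpoly rat[m]}) :
  exists g, f - msym (simple i) f == ('X_(lo i) - 'X_(hi i)) * g.
Proof.
set s := simple i; pose d : {mpoly rat[m]} := 'X_(lo i) - 'X_(hi i).
pose P (p : {mpoly rat[m]}) := exists g : {mpoly rat[m]}, p - msym s p == d * g.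
have PM p q : P p -> P q -> P (p * q).
  move=> [g /eqP eg] [h /eqP eh]; exists (g * q + msym s p * h); apply/eqP.
  rewrite mulrDr mulrA -eg mulrCA -eh msymM mulrBl mulrBr addrA.
  by rewrite subrK.
have PC c : P c%:MP by exists 0; rewrite mulr0 -[c%:MP]mulr1 mul_mpolyC msymZ msym1 subrr.
have PX k : P 'X_k.
  have eX : msym s 'X_k = 'X_(s k) :> {mpoly rat[m]}.
    rewrite msymX; congr 'X_[_]; apply/mnmP=> j.
    by rewrite mnmE !mnm1E tpermV -(inj_eq (@perm_inj _ s)) tpermK.
  rewrite /P eX.
  rewrite /s /simple; case: tpermP => [->|->|_ _].
  - by exists 1; rewrite mulr1.
  - by exists (-1); rewrite mulrN mulr1 /d opprB.
  by exists 0; rewrite mulr0 subrr.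
change (P f); elim/mpolyind: f => [|c mm p _ _ [g /eqP eg]].
  by exists 0; rewrite mulr0 raddf0 subrr.
have [h /eqP eh] : P (c *: 'X_[mm]).
  rewrite -mul_mpolyC; apply: (PM) => //; rewrite mpolyXE_id.
  elim/big_rec: _ => [|k x _ Px]; first exact: PC 1.
  apply: (PM) => //; elim: (mm k) => [|e IH]; first exact: PC 1.
  by rewrite exprS; apply: (PM).
by exists (h + g); apply/eqP; rewrite mulrDr -eg -eh msymD opprD addrACA.
Qed.

(* (f - s_i f) / (x_i - x_(i+1)); the quotient is unique since {mpoly rat[m]} *)
(* is an integral domain.                                                     *)
Definition ddiff m (i : 'I_m.-1) (f : {mpoly rat[m]}) : {mpoly rat[m]} :=
  xchoose (ddiff_exists i f).

Lemma ddiffE m (i : 'I_m.-1) (f : {mpoly rat[m]}) :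
  ('X_(lo i) - 'X_(hi i)) * ddiff i f = f - msym (simple i) f.
Proof. by rewrite (eqP (xchooseP (ddiff_exists i f))). Qed.

Definition ddiff_word m (w : seq 'I_m.-1) (f : {mpoly rat[m]}) : {mpoly rat[m]} :=
  foldr (fun i g => ddiff i g) f w.

(* The operator of v does not depend on the reduced word of v.                *)
Definition ddiff_perm m (v : 'S_m) (f : {mpoly rat[m]}) : {mpoly rat[m]} :=
  ddiff_word (reduced_word v) f.

Definition schubert m (w : 'S_m) : {mpoly rat[m]} :=
  ddiff_perm (w^-1 *o w0 m)%g (\prod_(k < m) 'X_k ^+ (m - k.+1)).

(* A path w0 -> ... -> pi is encoded by its word [:: i_1; ...; i_l] of labels, *)
(* with pi = i_1 . (i_2 . ... (i_l . w0)); act is the monoid action, and      *)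
(* edge i u is the operator attached to the edge labelled i starting at u.    *)
Section LabelledPaths.
Variables (m : nat) (act : 'I_m.-1 -> 'S_m -> 'S_m).
Variables (edge : 'I_m.-1 -> 'S_m -> {mpoly rat[m]} -> {mpoly rat[m]}).
Variable top : {mpoly rat[m]}.

Definition path_end (w : seq 'I_m.-1) : 'S_m := foldr act (w0 m) w.

Fixpoint is_path (w : seq 'I_m.-1) : bool :=
  if w is i :: w' then is_path w' && (act i (path_end w') != path_end w')
  else true.

Definition labelled_path (w : seq 'I_m.-1) (pi : 'S_m) : bool :=
  is_path w && (path_end w == pi).

Fixpoint path_poly (w : seq 'I_m.-1) : {mpoly rat[m]} :=
  if w is i :: w' then edge i (path_end w') (path_poly w') else top.

End LabelledPaths.

Definition invol n : {set 'S_n} := [set pi : 'S_n | pi *o pi == 1%g].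

Definition actO n (i : 'I_n.-1) (pi : 'S_n) : 'S_n :=
  if (len pi < len (simple i *o pi))%N then pi
  else if simple i *o pi *o simple i != pi then simple i *o pi *o simple i
  else simple i *o pi.

(* Meaningful when actO i pi != pi: the edge is then solid in the first case  *)
(* and dashed in the second.                                                  *)
Definition edgeO n (i : 'I_n.-1) (pi : 'S_n) (f : {mpoly rat[n]}) :=
  if simple i *o pi *o simple i != pi then ddiff i f else 2^-1 *: ddiff i f.

Definition labelled_pathO n := labelled_path (@actO n).

(* With 0-based indices, j <= n - i becomes j.+1 <= n - i.+1.                 *)
Definition upsilonO_w0 n : {mpoly rat[n]} :=
  \prod_(i < n) \prod_(j < n | (i <= j)%N && (j.+1 <= n - i.+1)%N) ('X_i + 'X_j).

Definition upsilonO_path n (w : seq 'I_n.-1) : {mpoly rat[n]} :=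
  path_poly (@actO n) (@edgeO n) (upsilonO_w0 n) w.

Definition fpf_invol m : {set 'S_m} :=
  [set pi : 'S_m | (pi *o pi == 1%g) && [forall x, pi x != x]].

Definition actSp m (i : 'I_m.-1) (pi : 'S_m) : 'S_m :=
  if (len pi < len (simple i *o pi))%N || (simple i *o pi *o simple i == pi)
  then pi else simple i *o pi *o simple i.

Definition edgeSp m (i : 'I_m.-1) (pi : 'S_m) (f : {mpoly rat[m]}) := ddiff i f.

Definition labelled_pathSp m := labelled_path (@actSp m).

Definition upsilonSp_w0 m : {mpoly rat[m]} :=
  \prod_(i < m) \prod_(j < m | (i < j)%N && (j.+1 <= m - i.+1)%N) ('X_i + 'X_j).

Definition upsilonSp_path m (w : seq 'I_m.-1) : {mpoly rat[m]} :=
  path_poly (@actSp m) (@edgeSp m) (upsilonSp_w0 m) w.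

Section Reachability.
Variable m : nat.
Implicit Types (pi : 'S_m) (i : 'I_m.-1).

Lemma len_invg pi : len (pi^-1)%g = len pi.
Proof.
suff le (u : 'S_m) : (len (u^-1)%g <= len u)%N.
  by apply/eqP; rewrite eqn_leq le -{1}[pi]invgK le.
rewrite [leqLHS]/len; case: ex_minnP => k _; apply.
have [w /eqP ww] := reduced_word_exists u.
apply/existsP; have sw : size (rev w) == len u by rewrite size_rev size_tuple.
by exists (Tuple sw); rewrite /= word_perm_rev ww.
Qed.

Lemma involV pi : pi \in invol m -> (pi^-1)%g = pi.
Proof. by rewrite inE -eq_invg_mul => /eqP. Qed.

Lemma len_simple_ascent pi i : pi \in invol m -> (pi (lo i) < pi (hi i))%N ->
  len (simple i *o pi) = (len pi).+1.
Proof.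
move=> /involV Vpi asc.
by rewrite -len_invg invMg tpermV Vpi -/(simple i) !lenE card_inv_ascent.
Qed.

Lemma commute_simple pi i : pi (lo i) = lo i -> pi (hi i) = hi i ->
  (simple i * pi = pi * simple i)%g.
Proof. by move=> e1 e2; rewrite conjgC /simple tpermJ e1 e2. Qed.

Lemma conj_simple_invol pi i :
  pi \in invol m -> simple i *o pi *o simple i \in invol m.
Proof.
rewrite !inE => /eqP e; apply/eqP.
rewrite !mulgA simple_mulgK.
by rewrite -[(_ * pi * pi)%g]mulgA e mulg1 simpleK.
Qed.

Lemma conj_simpleK pi i :
  simple i *o (simple i *o pi *o simple i) *o simple i = pi.
Proof. by rewrite !mulgA simpleK mul1g simple_mulgK. Qed.

Lemma conj_cover pi i : pi \in invol m -> (pi (lo i) < pi (hi i))%N ->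
    simple i *o pi *o simple i != pi ->
  len (simple i *o (simple i *o pi *o simple i)) = (len pi).+1 /\
  len (simple i *o pi *o simple i) = (len pi).+2.
Proof.
move=> hpi asc ne; have e := len_simple_ascent hpi asc; split.
  rewrite !mulgA simple_mulgK !lenE; exact: card_inv_ascent.
rewrite -e !lenE card_inv_ascent // !permM; apply: (@simple_lt _ i) => //.
apply: contra ne; rewrite xpair_eqE => /andP[/eqP e1 /eqP e2].
by rewrite mulgA commute_simple // simple_mulgK.
Qed.

Lemma conj_eq_ascent pi i : pi \in invol m -> (pi (lo i) < pi (hi i))%N ->
  simple i *o pi *o simple i = pi -> pi (lo i) = lo i /\ pi (hi i) = hi i.
Proof.
move=> /involV Vpi asc e.
have ec : (simple i * pi = pi * simple i)%g by rewrite -[in RHS]e !mulgA simple_mulgK.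
have : tperm (pi (lo i)) (pi (hi i)) = simple i.
  by rewrite -tpermJ -/(simple i) /conjg ec mulKg.
move/permP/(_ (pi (lo i))); rewrite tpermL /simple.
case: tpermP => [e1 e2|e1 e2|_ _ /perm_inj/eqP].
- by [].
- by move: asc; rewrite e1 e2 /= ltnNge leqnSn.
by rewrite eq_sym (negPf (lo_neq_hi i)).
Qed.

Lemma ascent_exists pi : pi != w0 m -> exists i, (pi (lo i) < pi (hi i))%N.
Proof.
move=> ne; apply/existsP; apply: contraNT ne => /existsPn noasc.
apply/eqP/decreasing_w0 => i.
by have := ascent_or_descent pi i; rewrite (negPf (noasc i)).
Qed.

Lemma actO_cover pi : pi \in invol m -> pi != w0 m ->
  exists i, exists2 pi', pi' \in invol m &
    [&& (len pi < len pi')%N, actO i pi' == pi & pi' != pi].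
Proof.
move=> hpi /ascent_exists[i asc]; exists i.
have [e|ne] := eqVneq (simple i *o pi *o simple i) pi.
  have ec : (simple i * pi = pi * simple i)%g.
    by rewrite -[in RHS]e !mulgA simple_mulgK.
  have el := len_simple_ascent hpi asc.
  exists (simple i *o pi).
    move: hpi; rewrite !inE => /eqP hpi.
    by rewrite -{2}ec !mulgA simple_mulgK hpi.
  rewrite el ltnSn /actO simple_mulgK el.
  rewrite ltnNge leqnSn /= -ec eqxx /= eqxx /=.
  by apply: contra_eq_neq el => /= h; rewrite -ec h neq_ltn ltnSn.
have [l1 l2] := conj_cover hpi asc ne.
exists (simple i *o pi *o simple i); first exact: conj_simple_invol.
rewrite l2 ltnS leqnSn /actO l1 l2 ltnNge leqnSn /= conj_simpleK.
by rewrite [pi == _]eq_sym ne eqxx.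
Qed.

Lemma actSp_cover pi : pi \in fpf_invol m -> pi != w0 m ->
  exists i, exists2 pi', pi' \in fpf_invol m &
    [&& (len pi < len pi')%N, actSp i pi' == pi & pi' != pi].
Proof.
rewrite inE => /andP[hpi /forallP fpf] /ascent_exists[i asc]; exists i.
have {}hpi : pi \in invol m by rewrite inE.
have ne : simple i *o pi *o simple i != pi.
  by apply/eqP=> /(conj_eq_ascent hpi asc)[e _]; have := fpf (lo i); rewrite e eqxx.
have [l1 l2] := conj_cover hpi asc ne.
exists (simple i *o pi *o simple i).
  rewrite inE; have := conj_simple_invol i hpi; rewrite inE => -> /=.
  apply/forallP=> x; rewrite !permM (canF_eq (tpermK _ _)); exact: fpf.
rewrite l2 ltnS leqnSn /actSp l1 l2 ltnNge leqnSn /= conj_simpleK.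
by rewrite [pi == _]eq_sym (negPf ne) eqxx.
Qed.

Lemma reachable (act : 'I_m.-1 -> 'S_m -> 'S_m) (A : {set 'S_m}) :
    (forall pi, pi \in A -> pi != w0 m -> exists i, exists2 pi', pi' \in A &
      [&& (len pi < len pi')%N, act i pi' == pi & pi' != pi]) ->
  forall pi, pi \in A -> exists w, labelled_path act w pi.
Proof.
move=> cover pi; have [k] := ubnP (#|[set: 'I_m * 'I_m]| - len pi)%N.
elim: k pi => // k IH pi lek hpi.
have [->|ne] := eqVneq pi (w0 m); first by exists [::]; rewrite /labelled_path /=.
have [i [pi' hpi' /and3P[ltl /eqP ea ne']]] := cover _ hpi ne.
have bnd : (len pi' <= #|[set: 'I_m * 'I_m]|)%N by rewrite lenE subset_leq_card ?subsetT.
have [|w /andP[pw /eqP ew]] := IH pi' _ hpi'; first by lia.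
by exists (i :: w); rewrite /labelled_path /= pw ew ea eqxx eq_sym ne'.
Qed.

Lemma pathO_exists pi : pi \in invol m -> exists w, labelled_pathO w pi.
Proof. exact: reachable actO_cover _. Qed.

Lemma pathSp_exists pi : pi \in fpf_invol m -> exists w, labelled_pathSp w pi.
Proof. exact: reachable actSp_cover _. Qed.

End Reachability.

(* The value along one chosen labelled path from w0 to pi.                      *)
Definition upsilonO n (pi : 'S_n) (pi_inv : pi \in invol n) : {mpoly rat[n]} :=
  upsilonO_path (xchoose (pathO_exists pi_inv)).

Definition upsilonSp m (pi : 'S_m) (pi_fpf : pi \in fpf_invol m) : {mpoly rat[m]} :=
  upsilonSp_path (xchoose (pathSp_exists pi_fpf)).

(* Main.v *)
Require Import Defs.
From mathcomp Require Import all_boot all_order all_fingroup all_algebra.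
From mathcomp Require Import mpoly zify ring.

(** The value of a path from [w0] to [pi] is a word of divided differences applied
    to the polynomial of [w0], multiplied by 1/2 for each dashed edge. The number of
    dashed edges depends only on [pi], since each of them creates two fixed points
    and solid edges create none. So both parts of the theorem concern the words.

    Path independence is proved by induction from [w0] downwards. Two paths whose
    last edges [i] and [j] are different are compared with paths through a common
    earlier element, continued by the two sides of the commutation or braid relation
    of the divided differences. There are two exceptions. If [pi] maps [i, i+1] to
    [j, j+1], both edges come from the same element, and the two divided differences
    have to agree on its polynomial ([crossing_at]). If [i], [i+1], [i+2] are all
    fixed, two divided differences have to commute on the polynomial of an element
    with the arc [(i, i+2)] ([hook_at]). These relations can be checked at [w0],
    whose polynomial is a product with few factors that are not symmetric in the
    variables involved, and they are carried down from there: an edge that changes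
    something next to the positions concerned can be continued backwards to an
    element where the same relation holds one position further, and braid relations
    translate it back. The procedure closes up only together with a third relation,
    on four reversed positions ([nest_at]), into which [hook_at] turns next to a
    fixed point. All this is [attached_relations].

    For positivity, the theorem of Fomin and Stanley is used: Schubert polynomials
    are the coefficients of a product of factors [1 + x_k u_l] in the nilCoxeter
    algebra, hence have nonnegative coefficients, and [ddiff i] maps them to Schubert
    polynomials or 0 ([ddiff_schubert]). So only the polynomial of [w0] has to be
    expanded. It is a combination of Schubert polynomials because its exponents lie
    below the staircase ([schubert_expansion]), and the coefficient at [w] is the
    constant term left by a reduced word of [w]. By path independence a divided
    difference annihilates the polynomial of any element at which it has no downward
    edge, so this word either annihilates or follows a path down from [w0]. If it
    leaves a nonzero constant, its length is the degree, and counting inversions and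
    fixed points shows that it ends at the unique lowest element. Hence all nonzero
    coefficients are equal ([top_coefficients]); they are positive, as evaluation at
    [(1, ..., 1)] shows. They are divisible by as large a power of two as a path can
    have dashed edges, because of the factors [x_i + x_i] ([top_expansion]). *)

Set Implicit Arguments.
Unset Strict Implicit.
Unset Printing Implicit Defensive.

Import Order.TTheory GRing.Theory Num.Theory.
Local Open Scope ring_scope.

(** * Divided differences *)

(** The commutation and braid relations of divided differences are proved by
    clearing the denominators. The letters of the next two lemmas stand for
    a polynomial [f], for its images under the transpositions [s] and [t],
    and for the divided differences of these; [a], [b] and [c] are the
    differences of variables. *)
Section Cancellation.
Variable R : idomainType.

Lemma comm_cancel (a b f sf tf stf C tC B sB P : R) : b != 0 ->
    a * C = f - sf -> a * tC = tf - stf ->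
    b * B = f - tf -> b * sB = sf - stf -> b * P = C - tC ->
  a * P = B - sB.
Proof.
move=> nz h1 h2 h3 h4 h5; apply: (mulfI nz).
rewrite mulrCA h5 !mulrBr h1 h2 h3 h4; ring.
Qed.

Lemma braid_cancel (a b c f sf tf tsf stf stsf A tA stA B sB P : R) :
    c = a + b -> a * P = B - sB -> b * B = A - tA -> c * sB = A - stA ->
    a * A = f - sf -> c * tA = tf - tsf -> b * stA = stf - stsf ->
  a * b * c * P = f - sf - tf + tsf + stf - stsf.
Proof.
move=> ec hP hB hsB hA htA hstA.
transitivity (c * (b * (a * P))); first by ring.
rewrite hP mulrBr mulrBr hB [b * sB]mulrC mulrA.
transitivity (c * A - c * tA - b * (c * sB)); first by ring.
rewrite hsB htA mulrBr hstA {1}ec mulrDl hA; ring.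
Qed.

End Cancellation.

Section DividedDifferences.
Variable m : nat.
Implicit Types (i j : 'I_m.-1) (f g : {mpoly rat[m]}).
Local Notation x_ k := ('X_k : {mpoly rat[m]}).

Lemma msym_mpolyXU (s : 'S_m) k : msym s 'X_k = 'X_(s k) :> {mpoly rat[m]}.
Proof.
rewrite msymX; congr 'X_[_]; apply/mnmP=> j.
by rewrite mnmE !mnm1E -(inj_eq (@perm_inj _ s)) permKV.
Qed.

Lemma mpolyXU_eq (a b : 'I_m) : ('X_a == 'X_b :> {mpoly rat[m]}) = (a == b).
Proof.
apply/eqP/eqP=> [/(congr1 (mcoeff U_(b)))|->] //.
by rewrite !mcoeffXU eqxx; case: eqP => // _ /eqP; rewrite eq_sym oner_eq0.
Qed.

Lemma subX_neq0 (a b : 'I_m) : a != b -> 'X_a - 'X_b != 0 :> {mpoly rat[m]}.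
Proof. by rewrite subr_eq0 mpolyXU_eq. Qed.

Lemma msym_simpleK i f : msym (simple i) (msym (simple i) f) = f.
Proof. by rewrite -msymMm simpleK msym1m. Qed.

Lemma simple_lo i : simple i (lo i) = hi i. Proof. exact: tpermL. Qed.
Lemma simple_hi i : simple i (hi i) = lo i. Proof. exact: tpermR. Qed.
Lemma simple_far i (k : 'I_m) : k != i :> nat -> k != i.+1 :> nat -> simple i k = k.
Proof. by move=> n1 n2; rewrite /simple tpermD // -val_eqE /= eq_sym. Qed.

Lemma simple_commute i j : (i.+1 < j)%N || (j.+1 < i)%N ->
  (simple i * simple j = simple j * simple i)%g.
Proof. by move=> far; rewrite conjgC {2}/simple tpermJ !simple_far //=; lia. Qed.

Lemma simple_braid i j : i.+1 = j :> nat ->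
  (simple i * simple j * simple i = simple j * simple i * simple j)%g.
Proof.
move=> ij; have hl : lo j = hi i by apply: val_inj.
have -> : (simple i * simple j * simple i = simple j ^ simple i)%g.
  by rewrite /conjg tpermV mulgA.
have -> : (simple j * simple i * simple j = simple i ^ simple j)%g.
  by rewrite /conjg tpermV mulgA.
rewrite {1}/simple tpermJ hl simple_hi simple_far //=; try lia.
rewrite {2}/simple tpermJ -hl simple_lo simple_far //=; lia.
Qed.

(** Division by a difference of variables is cancellable, so the defining
    equation of the divided difference determines it. *)
Lemma ddiff_unique i f g :
  ('X_(lo i) - 'X_(hi i)) * g = f - msym (simple i) f -> ddiff i f = g.
Proof. by move=> e; apply: (mulfI (subX_neq0 (lo_neq_hi i))); rewrite ddiffE e. Qed.

Lemma ddiffD i f g : ddiff i (f + g) = ddiff i f + ddiff i g.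
Proof.
by apply: ddiff_unique; rewrite mulrDr [in RHS]msymD opprD [RHS]addrACA -!ddiffE.
Qed.

Lemma ddiffZ i c f : ddiff i (c *: f) = c *: ddiff i f.
Proof. by apply: ddiff_unique; rewrite -scalerAr ddiffE msymZ scalerBr. Qed.

Lemma ddiff_symmetric i f : msym (simple i) f = f -> ddiff i f = 0.
Proof. by move=> sf; apply: ddiff_unique; rewrite sf subrr mulr0. Qed.

Lemma ddiff0 i : ddiff i 0 = 0.
Proof. by apply: ddiff_symmetric; rewrite msym0. Qed.

Lemma ddiff_sum i I (r : seq I) (F : I -> {mpoly rat[m]}) :
  ddiff i (\sum_(x <- r) F x) = \sum_(x <- r) ddiff i (F x).
Proof. exact: (big_morph _ (ddiffD i) (ddiff0 i)). Qed.

(** Exchanging the two variables changes the sign of both the numerator and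
    the denominator. *)
Lemma msym_ddiff i f : msym (simple i) (ddiff i f) = ddiff i f.
Proof.
apply/esym/ddiff_unique.
have := congr1 (msym (simple i)) (ddiffE i f).
rewrite msymM !msymB !msym_mpolyXU simple_lo simple_hi msym_simpleK.
rewrite -[_ - f]opprB -[_ - 'X_(lo i)]opprB mulNr.
exact: oppr_inj.
Qed.

Lemma ddiffK i f : ddiff i (ddiff i f) = 0.
Proof. exact/ddiff_symmetric/msym_ddiff. Qed.

Lemma ddiffM i f g :
  ddiff i (f * g) = ddiff i f * g + msym (simple i) f * ddiff i g.
Proof.
apply: ddiff_unique; rewrite mulrDr mulrA ddiffE mulrCA ddiffE msymM; ring.
Qed.

Lemma ddiffMl i f g : msym (simple i) f = f -> ddiff i (f * g) = f * ddiff i g.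
Proof. by move=> sf; rewrite ddiffM (ddiff_symmetric sf) mul0r add0r sf. Qed.

Lemma ddiff_comm i j f : (i.+1 < j)%N || (j.+1 < i)%N ->
  ddiff i (ddiff j f) = ddiff j (ddiff i f).
Proof.
move=> far.
have st := simple_commute far.
have di : msym (simple j) (x_ (lo i) - x_ (hi i)) = x_ (lo i) - x_ (hi i).
  by rewrite msymB !msym_mpolyXU !simple_far //=; lia.
have dj : msym (simple i) (x_ (lo j) - x_ (hi j)) = x_ (lo j) - x_ (hi j).
  by rewrite msymB !msym_mpolyXU !simple_far //=; lia.
apply: ddiff_unique.
apply: (comm_cancel (stf := msym (simple j) (msym (simple i) f))
  (subX_neq0 (lo_neq_hi j)) (ddiffE i f) _ (ddiffE j f) _ (ddiffE j _)).
  by rewrite -{1}di -msymM ddiffE msymB.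
by rewrite -{1}dj -msymM ddiffE msymB -!msymMm st.
Qed.

(** Both sides, multiplied by the discriminant of the three variables involved,
    give the alternating sum of the six permuted copies of [f]. *)
Lemma ddiff_braid i j f : i.+1 = j :> nat ->
  ddiff i (ddiff j (ddiff i f)) = ddiff j (ddiff i (ddiff j f)).
Proof.
move=> ij.
have hl : lo j = hi i by apply: val_inj.
pose x := x_ (lo i); pose y := x_ (hi i); pose z := x_ (hi j).
have sx : msym (simple i) x = y by rewrite msym_mpolyXU simple_lo.
have sy : msym (simple i) y = x by rewrite msym_mpolyXU simple_hi.
have sz : msym (simple i) z = z by rewrite msym_mpolyXU simple_far //=; lia.
have tx : msym (simple j) x = x by rewrite msym_mpolyXU simple_far //=; lia.
have ty : msym (simple j) y = z by rewrite /y -hl msym_mpolyXU simple_lo.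
have tz : msym (simple j) z = y by rewrite msym_mpolyXU simple_hi hl.
have Di g : (x - y) * ddiff i g = g - msym (simple i) g := ddiffE i g.
have Dj g : (y - z) * ddiff j g = g - msym (simple j) g.
  by rewrite /y -hl; exact: ddiffE.
have sts := simple_braid ij.
have nz : (x - y) * (y - z) * (x - z) != 0.
  by rewrite !mulf_neq0 // subX_neq0 // -val_eqE /=; lia.
have ec : x - z = (x - y) + (y - z) by rewrite addrA subrK.
have D1t g : (x - z) * msym (simple j) (ddiff i g) =
    msym (simple j) g - msym (simple j) (msym (simple i) g).
  by rewrite -msymB -Di msymM msymB tx ty.
have D2s g : (x - z) * msym (simple i) (ddiff j g) =
    msym (simple i) g - msym (simple i) (msym (simple j) g).
  by rewrite -msymB -Dj msymM msymB sy sz.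
have D1st g : (y - z) * msym (simple i) (msym (simple j) (ddiff i g)) =
    msym (simple i) (msym (simple j) g)
    - msym (simple i) (msym (simple j) (msym (simple i) g)).
  by rewrite -msymB -D1t msymM msymB sx sz.
have D2ts g : (x - y) * msym (simple j) (msym (simple i) (ddiff j g)) =
    msym (simple j) (msym (simple i) g)
    - msym (simple j) (msym (simple i) (msym (simple j) g)).
  by rewrite -msymB -D2s msymM msymB tx tz.
have D2si g : (x - z) * msym (simple i) (ddiff j (ddiff i g)) =
    ddiff i g - msym (simple i) (msym (simple j) (ddiff i g)).
  by rewrite D2s msym_ddiff.
have D1tj g : (x - z) * msym (simple j) (ddiff i (ddiff j g)) =
    ddiff j g - msym (simple j) (msym (simple i) (ddiff j g)).
  by rewrite D1t msym_ddiff.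
have E1 := braid_cancel ec (Di (ddiff j (ddiff i f))) (Dj (ddiff i f)) (D2si f)
  (Di f) (D1t f) (D1st f).
have ec' : x - z = (y - z) + (x - y) by rewrite ec addrC.
have E2 := braid_cancel ec' (Dj (ddiff i (ddiff j f))) (Di (ddiff j f)) (D1tj f)
  (Dj f) (D2s f) (D2ts f).
rewrite [(y - z) * (x - y)]mulrC in E2.
apply: (mulfI nz); apply: (etrans E1); apply: (etrans _ (esym E2)).
have -> : msym (simple i) (msym (simple j) (msym (simple i) f)) =
    msym (simple j) (msym (simple i) (msym (simple j) f)).
  by rewrite -!(msymMm f) sts.
move: (msym (simple j) (msym (simple i) (msym (simple j) f))) => a.
move: (msym (simple j) (msym (simple i) f)) (msym (simple i) (msym (simple j) f)).
move: (msym (simple i) f) (msym (simple j) f) => b c d e.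
by rewrite -!addrA; congr (_ + _); rewrite addrCA [d + _]addrCA.
Qed.

End DividedDifferences.

(** * Monomials under divided differences *)

(** Bundled forms of the two predicates, which the closure lemmas for
    polynomials over a predicate require. *)
Definition ints : subringClosed rat :=
  GRing.SubringClosed.clone rat Num.int_num_subdef _.
Definition nats : semiringClosed rat :=
  GRing.SemiringClosed.clone rat Num.nat_num_subdef _.

Section Monomials.
Variable m : nat.
Implicit Types (i : 'I_m.-1) (f g : {mpoly rat[m]}) (e : 'X_{1..m}).

(** What is needed about the monomials that occur in the divided difference
    of [e]: the total degree drops by one, and the two exponents involved
    become less than the larger of the old ones, which keeps the exponents
    below a staircase. *)
Definition lowered i e e' : Prop :=
  [/\ forall k, k != lo i -> k != hi i -> e' k = e k,
      ((e' (lo i) + e' (hi i)).+1 = e (lo i) + e (hi i))%N,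
      (e' (lo i) < maxn (e (lo i)) (e (hi i)))%N &
      (e' (hi i) < maxn (e (lo i)) (e (hi i)))%N].

Definition with_exponents i e (p q : nat) : 'X_{1..m} :=
  [multinom if k == lo i then p else if k == hi i then q else e k | k < m].

Lemma with_exponents_lo i e p q : with_exponents i e p q (lo i) = p.
Proof. by rewrite mnmE eqxx. Qed.

Lemma with_exponents_hi i e p q : with_exponents i e p q (hi i) = q.
Proof. by rewrite mnmE eqxx eq_sym (negPf (lo_neq_hi i)). Qed.

Lemma with_exponents_far i e p q k :
  k != lo i -> k != hi i -> with_exponents i e p q k = e k.
Proof. by move=> h1 h2; rewrite mnmE (negPf h1) (negPf h2). Qed.

(** The factorization of [(xy)^b (x^c - y^c)] by [x - y], with the other
    variables carried along. *)
Lemma telescoping_monomials i e b c :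
  ('X_(lo i) - 'X_(hi i)) *
    \sum_(t < c) 'X_[rat, with_exponents i e (b + t) (b + (c - t.+1))] =
  'X_[with_exponents i e (b + c) b] - 'X_[with_exponents i e b (b + c)].
Proof.
rewrite mulr_sumr.
pose F t := 'X_[rat, with_exponents i e (b + t) (b + (c - t))].
transitivity (\sum_(0 <= t < c) (F t.+1 - F t)); last first.
  by rewrite telescope_sumr // /F subnn subn0 addn0.
rewrite big_mkord; apply: eq_bigr => t _.
have tc := ltn_ord t.
have nlh := negPf (lo_neq_hi i).
rewrite mulrBl -!mpolyXD; congr ('X_[_] - 'X_[_]); apply/mnmP=> k;
  rewrite mnmDE mnm1E !mnmE ![_ == k]eq_sym.
  case: (k =P lo i) => [_|_]; first by lia.
  by case: eqP; lia.
case: (k =P lo i) => [->|_]; first by rewrite nlh; lia.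
case: eqP => _; lia.
Qed.

Lemma ddiff_monomial i e : exists (b : bool) (r : seq 'X_{1..m}),
  ddiff i 'X_[e] = (-1) ^+ b *: \sum_(e' <- r) 'X_[e'] /\
  forall e', e' \in r -> lowered i e e'.
Proof.
set s := simple i.
have se : msym s 'X_[rat, e] = 'X_[with_exponents i e (e (hi i)) (e (lo i))].
  rewrite msymX tpermV; congr 'X_[_]; apply/mnmP=> k; rewrite !mnmE.
  rewrite /s /simple; case: tpermP => [->|->|/eqP h1 /eqP h2]; rewrite ?eqxx //.
    by rewrite eq_sym (negPf (lo_neq_hi i)).
  by rewrite (negPf h1) (negPf h2).
have ee : e = with_exponents i e (e (lo i)) (e (hi i)).
  by apply/mnmP=> k; rewrite !mnmE; do 2!case: eqP => [->//|_].
pose r c b := [seq with_exponents i e (b + t) (b + (c - t.+1)) | t : 'I_c].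
have low c b e' : (maxn (e (lo i)) (e (hi i)) = b + c)%N ->
    (e (lo i) + e (hi i) = b + b + c)%N -> e' \in r c b -> lowered i e e'.
  move=> hm hs /mapP[t _ ->]; have tc := ltn_ord t.
  split; rewrite ?hm ?hs ?with_exponents_lo ?with_exponents_hi; try lia.
  exact: with_exponents_far.
have sumr c b : \sum_(e' <- r c b) 'X_[rat, e'] =
    \sum_(t < c) 'X_[with_exponents i e (b + t) (b + (c - t.+1))].
  by rewrite /r big_map big_enum.
have [le|lt] := leqP (e (hi i)) (e (lo i)).
  pose c := (e (lo i) - e (hi i))%N; exists false, (r c (e (hi i))).
  split; last by move=> e'; apply: low; rewrite /c; lia.
  apply: ddiff_unique; rewrite scale1r sumr telescoping_monomials -/s se.
  by rewrite (_ : e (hi i) + c = e (lo i))%N ?subnKC // -ee.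
pose c := (e (hi i) - e (lo i))%N; exists true, (r c (e (lo i))).
split; last by move=> e'; apply: low; rewrite /c; lia.
apply: ddiff_unique; rewrite scaleN1r sumr mulrN telescoping_monomials -/s se.
by rewrite opprB (_ : e (lo i) + c = e (hi i))%N ?subnKC ?(ltnW lt) // -ee.
Qed.

Lemma mdeg_lowered i e e' : lowered i e e' -> (mdeg e').+1 = mdeg e.
Proof.
have split_sum (e0 : 'X_{1..m}) : (\sum_k e0 k =
    e0 (lo i) + e0 (hi i) + \sum_(k | (k != lo i) && (k != hi i)) e0 k)%N.
  by rewrite (bigD1 (lo i)) //= (bigD1 (hi i)) /= ?addnA // eq_sym lo_neq_hi.
case=> h1 h2 _ _; rewrite !mdegE !split_sum -h2 !addSn; congr (_ + _).+1.
by apply: eq_bigr => k /andP[k1 k2]; exact: h1.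
Qed.

(** Divided differences act monomial by monomial, so a constraint on monomials
    that passes from [e] to the monomials lowered from it passes from a
    polynomial to its divided difference. *)
Lemma ddiff_supported i f (Q Q' : pred 'X_{1..m}) :
  (forall e e', lowered i e e' -> Q e -> Q' e') ->
  all Q (msupp f) -> all Q' (msupp (ddiff i f)).
Proof.
move=> low /allP hQ.
have cl : forall g h, all Q' (msupp g) -> all Q' (msupp h) -> all Q' (msupp (g + h)).
  move=> g h /allP hg /allP hh; apply/allP=> e /msuppD_le.
  by rewrite mem_cat => /orP[/hg|/hh].
have clZ : forall c g, all Q' (msupp g) -> all Q' (msupp (c *: g)).
  by move=> c g /allP hg; apply/allP=> e /msuppZ_le /hg.
rewrite {1}[f]mpolyE ddiff_sum big_seq.
elim/big_rec: _ => [|e g he hg]; first by rewrite msupp0.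
apply: (cl _ _ _ hg); rewrite ddiffZ; apply: (clZ).
have [b [r [-> hr]]] := ddiff_monomial i e; apply: (clZ).
rewrite big_seq; elim/big_rec: _ => [|e' h he' hh]; first by rewrite msupp0.
by apply: (cl _ _ _ hh); rewrite msuppX /= andbT; apply: low (hr _ he') (hQ _ he).
Qed.

Lemma ddiff_homog i f d : f \is d.+1.-homog -> ddiff i f \is d.-homog.
Proof.
rewrite !dhomogE; apply: ddiff_supported => e e' /mdeg_lowered eq_deg.
by rewrite /= -eq_deg eqSS.
Qed.

Lemma ddiff_homog0 i f : f \is 0.-homog -> ddiff i f = 0.
Proof.
rewrite dhomogE => h; apply/msuppnil0/nilP; rewrite /nilp -(all_pred0 (msupp (ddiff i f))).
by apply: ddiff_supported h => e e' /mdeg_lowered eq_deg; rewrite /= -eq_deg.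
Qed.

Lemma ddiff_int i f : f \is a mpolyOver m ints -> ddiff i f \is a mpolyOver m ints.
Proof.
move=> /mpolyOverP hf; rewrite {1}[f]mpolyE ddiff_sum; apply: rpred_sum => e _.
rewrite ddiffZ; apply: mpolyOverZ (hf e) _.
have [b [r [-> _]]] := ddiff_monomial i e; apply: mpolyOverZ.
  by rewrite rpredX // rpredN rpred1.
by apply: rpred_sum => e' _; exact: mpolyOverX.
Qed.

(** The staircase is [(m-1, ..., 1, 0)]. *)
Definition below_staircase f :=
  all [pred e : 'X_{1..m} | [forall k : 'I_m, e k < m - k]%N] (msupp f).

Lemma ddiff_below_staircase i f : below_staircase f -> below_staircase (ddiff i f).
Proof.
apply: ddiff_supported => e e' [far _ h1 h2] /forallP h; apply/forallP=> k.
have hl := h (lo i); have hh := h (hi i); rewrite /= in hl hh.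
have [->|k1] := eqVneq k (lo i); first by rewrite /=; lia.
have [->|k2] := eqVneq k (hi i); first by rewrite /=; lia.
by rewrite far.
Qed.

End Monomials.

(** * The exchange relation in a nilCoxeter algebra *)

(** Following Fomin and Stanley, Schubert polynomials are obtained as the
    coefficients of a product of factors [1 + x_k u_l], where the [u_l]
    satisfy the nilCoxeter relations. The section shows that a divided
    difference of this product is a right multiplication by a generator; the
    variables enter only as central elements. *)
Section FominStanley.
Variables (Rg : pzRingType) (u : nat -> Rg) (M : nat).
Hypothesis u_large : forall k, (M <= k)%N -> u k = 0.
Hypothesis u_sq : forall k, u k * u k = 0.
Hypothesis u_braid : forall k, u k * u k.+1 * u k = u k.+1 * u k * u k.+1.
Hypothesis u_far : forall k l, (k.+1 < l)%N -> u k * u l = u l * u k.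

Definition central (c : Rg) := forall r, c * r = r * c.

(** The product [(1 + c u_(M-1)) ... (1 + c u_i)], with descending indices. *)
Definition column (c : Rg) i := \prod_(j < M - i) (1 + c * u (M - j.+1)).

Lemma columnS c i : column c i = column c i.+1 * (1 + c * u i).
Proof.
have [lt|le] := ltnP i M; last first.
  rewrite u_large // mulr0 addr0 mulr1 /column.
  by have [-> ->] : (M - i = 0 /\ M - i.+1 = 0)%N by lia.
rewrite /column (_ : M - i = (M - i.+1).+1)%N; last lia.
by rewrite big_ord_recr /=; congr (_ * (1 + c * u _)); lia.
Qed.

Lemma column_large c i : (M <= i)%N -> column c i = 1.
Proof. by move=> le; rewrite /column (_ : M - i = 0)%N ?big_ord0; last lia. Qed.

Lemma column_far c i k : central c -> (k.+1 < i)%N ->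
  u k * column c i = column c i * u k.
Proof.
move=> cc; rewrite /column => lt; elim/big_ind: _ => [|x y hx hy|j _].
- by rewrite mulr1 mul1r.
- by rewrite mulrA hx -mulrA hy mulrA.
rewrite mulrDr mulrDl mulr1 mul1r mulrA -cc -!mulrA u_far //.
by have := ltn_ord j; lia.
Qed.

Lemma factorK c i : central c -> (1 + c * u i) * (1 - c * u i) = 1.
Proof.
move=> cc; rewrite mulrDl mul1r mulrBr mulr1 -mulrA [u i * _]mulrA -cc -mulrA u_sq.
by rewrite !mulr0 subr0 subrK.
Qed.

Lemma column_unfold c i : central c ->
  column c i.+1 = column c i * (1 - c * u i).
Proof. by move=> cc; rewrite [column c i]columnS -mulrA factorK // mulr1. Qed.

(** The point is that the right-hand side is symmetric in [a] and [b]: this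
    is the Yang-Baxter relation for the factors [1 + c u_i]. *)
Lemma yang_baxter a b i : central a -> central b ->
  (1 - b * u i.+1) * (1 + a * u i) * ((1 + b * u i.+1) * (1 + b * u i)) =
  (1 + (a + b) * u i) + a * b * (u i * u i.+1 - u i.+1 * u i).
Proof.
move=> ca cb; set x := u i; set y := u i.+1.
have xx : x * x = 0 by exact: u_sq.
have yy : y * y = 0 by exact: u_sq.
have xyx : x * y * x = y * x * y by exact: u_braid.
have yxyx : y * (x * (y * x)) = 0 by rewrite !mulrA -xyx -mulrA xx mulr0.
pose w := (1 - b * y) * (x * (1 + b * y)).
have wE : w = x + b * (x * y - y * x) - b * (b * (y * x * y)).
  rewrite /w mulrDr mulr1 [x * (b * y)]mulrA -(cb x) -mulrA.
  rewrite mulrBl mul1r mulrDr opprD mulrBr -[b * y * (b * _)]mulrA.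
  by rewrite [y * (b * _)]mulrA -(cb y) -!mulrA !addrA.
have wx : w * (b * x) = b * (b * (y * x * y)).
  rewrite [w * (b * x)]mulrA -(cb w) -[b * w * x]mulrA wE; congr (b * _).
  rewrite mulrBl mulrDl xx add0r -!mulrA mulrBl -!mulrA xx mulr0 subr0.
  by rewrite yxyx !mulr0 subr0 [x * _]mulrA [y * (x * y)]mulrA xyx.
have -> : (1 - b * y) * (1 + a * x) * ((1 + b * y) * (1 + b * x)) =
    (1 + a * w) * (1 + b * x).
  rewrite mulrA; congr (_ * _); rewrite [(1 - b * y) * (1 + a * x)]mulrDr mulr1 mulrDl.
  congr (_ + _).
    rewrite mulrDr mulr1 mulrBl mul1r -mulrA [y * (b * y)]mulrA -(cb y) -mulrA yy !mulr0.
    by rewrite subr0 subrK.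
  by rewrite /w !mulrA; congr (_ * _ * _); rewrite -(ca (1 - _)).
rewrite mulrDr mulr1 mulrDl mul1r -mulrA wx {1}wE.
rewrite [(a + b) * x]mulrDl -[a * b * _]mulrA mulrBr [a * (x + _)]mulrDr.
by rewrite [b * x + _]addrC !addrA subrK -!addrA [a * _ + b * x]addrC.
Qed.

(** Descending induction on [i]. Splitting off the last factors of both
    columns writes their product as the product of two shorter columns times
    an expression that is symmetric in [a] and [b] by [yang_baxter]. *)
Lemma column_comm a b i : central a -> central b ->
  column a i * column b i = column b i * column a i.
Proof.
move=> ca cb; have [k] := ubnP (M - i); elim: k i => // k IH i lek.
have [le|lt] := leqP M i; first by rewrite !column_large.
have step c d : central c -> central d -> column c i * column d i =
    column c i.+1 * column d i.+1 *
      (1 + (c + d) * u i + c * d * (u i * u i.+1 - u i.+1 * u i)).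
  move=> cc cd; rewrite -yang_baxter // [column c i]columnS [column d i]columnS.
  rewrite {1}[column d i.+1]columnS -!mulrA; congr (_ * _).
  have uC : (1 + c * u i) * column d i.+2 = column d i.+2 * (1 + c * u i).
    rewrite mulrDl mulrDr mul1r mulr1; congr (_ + _).
    by rewrite -mulrA column_far // mulrA cc -mulrA cc.
  rewrite mulrA uC -!mulrA {1}[column d i.+1]columnS.
  by rewrite -mulrA [_ * ((1 - _) * _)]mulrA factorK // mul1r.
rewrite (step a b) // (step b a) // [b + a]addrC -(ca b) IH //; lia.
Qed.

(** Once the columns commute, the two products differ only in the factor [1
    - b u_i] against [1 - a u_i]. *)
Lemma column_exchange a b i : central a -> central b ->
  column a i * column b i.+1 - column b i * column a i.+1 =
  (a - b) * (column a i * column b i.+1 * u i).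
Proof.
move=> ca cb; set x := u i; set P := column a i * column b i.
have -> : column a i * column b i.+1 = P * (1 - b * x).
  by rewrite column_unfold // mulrA.
have -> : column b i * column a i.+1 = P * (1 - a * x).
  by rewrite column_unfold // mulrA [column b i * _]column_comm.
have -> : P * (1 - b * x) * x = P * x.
  by rewrite -mulrA mulrBl mul1r -[b * x * x]mulrA u_sq mulr0 subr0.
rewrite -mulrBr opprB addrC addrA subrK -mulrBl [RHS]mulrA [LHS]mulrA.
by congr (_ * x); rewrite mulrBl mulrBr ca cb.
Qed.

Definition schubert_product (c : nat -> Rg) n := \prod_(0 <= i < n) column (c i) i.

(** Exchanging the variables [c k] and [c k.+1] affects two neighbouring
    columns, for which [column_exchange] applies; the generator [u_k]
    commutes with all later columns. *)
Lemma schubert_product_ddiff (c c' : nat -> Rg) n k :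
    (forall i, central (c i)) -> (k.+1 < n)%N ->
    c' k = c k.+1 -> c' k.+1 = c k ->
    (forall i, i != k -> i != k.+1 -> c' i = c i) ->
  (c k - c k.+1) * (schubert_product c n * u k) =
  schubert_product c n - schubert_product c' n.
Proof.
move=> cc kn ck ck1 cfar.
have split_at d : schubert_product d n =
    \prod_(0 <= i < k) column (d i) i * (column (d k) k * column (d k.+1) k.+1) *
    \prod_(k.+2 <= i < n) column (d i) i.
  rewrite /schubert_product (big_cat_nat (n := k)) //=; last lia.
  rewrite -!mulrA; congr (_ * _).
  by rewrite big_ltn; [rewrite big_ltn // | lia].
have lowE : \prod_(0 <= i < k) column (c' i) i = \prod_(0 <= i < k) column (c i) i.
  by apply: eq_big_nat => i hi; rewrite cfar //; lia.
have highE : \prod_(k.+2 <= i < n) column (c' i) i = \prod_(k.+2 <= i < n) column (c i) i.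
  by apply: eq_big_nat => i hi; rewrite cfar //; lia.
rewrite !split_at lowE highE ck ck1.
set L := \prod_(0 <= i < k) _; set H := \prod_(k.+2 <= i < n) _.
have uH : u k * H = H * u k.
  rewrite /H big_nat; elim/big_ind: _ => [|x y hx hy|i hi].
  - by rewrite mulr1 mul1r.
  - by rewrite mulrA hx -mulrA hy mulrA.
  by apply: column_far => //; lia.
rewrite -mulrBl -mulrBr column_exchange // -[_ * H * u k]mulrA -uH.
set d := c k - c k.+1; have dc r : d * r = r * d by rewrite mulrBl mulrBr !cc.
by rewrite (mulrA L d) -(dc L) -!mulrA.
Qed.

End FominStanley.

(** * Schubert polynomials as nilCoxeter coefficients *)

Section NilCoxeter.
Variable m : nat.
Local Notation P := {mpoly rat[m]}.
Local Notation N := #|{: 'S_m}|.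
Implicit Types (i j : 'I_m.-1) (w v : 'S_m).

Local Notation inv := Defs.inv.

Definition descent w i := (w (hi i) < w (lo i))%N.

(** The nilCoxeter algebra is represented on the group algebra by right
    multiplication: [v u_k] is [v s_k] if that is longer than [v], else 0.
    In the order of multiplication used for permutations here, [v s_k] is
    [simple k * v]. *)
Definition nilgen (k : nat) : 'M[P]_N :=
  \matrix_(a, b) (if insub k is Some i then
    descent (enum_val b) i && (enum_val a == simple i * enum_val b)%g
    else false)%:R.

Lemma nilgen_large k : (m.-1 <= k)%N -> nilgen k = 0.
Proof. by move=> le; apply/matrixP=> a b; rewrite !mxE insubF // ltnNge le. Qed.

Lemma mul_nilgen (A : 'M[P]_N) i a w :
  (A * nilgen i) a (enum_rank w) =
  if descent w i then A a (enum_rank (simple i * w)%g) else 0.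
Proof.
rewrite [A * _]/(A *m _) mxE (bigD1 (enum_rank (simple i * w)%g)) //= big1 ?addr0.
  by rewrite mxE valK !enum_rankK eqxx andbT; case: ifP; rewrite ?mulr1 ?mulr0.
move=> b nb; rewrite mxE valK enum_rankK; case: eqP => [e|_]; last first.
  by rewrite andbF mulr0.
by case/eqP: nb; rewrite -e enum_valK.
Qed.

(** Matrices are compared entry by entry through [mul_nilgen], which turns
    the nilCoxeter relations into comparisons of at most three values of a
    permutation. *)
Lemma matrix_eq_rank (A B : 'M[P]_N) :
  (forall a w, A a (enum_rank w) = B a (enum_rank w)) -> A = B.
Proof. by move=> e; apply/matrixP=> a b; rewrite -(enum_valK b). Qed.

Lemma nilgen_sq k : nilgen k * nilgen k = 0.
Proof.
have [lt|le] := ltnP k m.-1; last by rewrite nilgen_large // mul0r.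
rewrite -[LHS]mul1r mulrA; move: (1 : 'M[P]_N) => A.
pose i := Ordinal lt; apply: matrix_eq_rank => a w; rewrite !(mul_nilgen _ i) [RHS]mxE.
rewrite /descent !permM simple_lo simple_hi.
by case: ltngtP.
Qed.

Lemma nilgen_far k l : (k.+1 < l)%N -> nilgen k * nilgen l = nilgen l * nilgen k.
Proof.
move=> kl; have [lt|le] := ltnP l m.-1; last by rewrite !(nilgen_large le) mulr0 mul0r.
have ltk : (k < m.-1)%N by lia.
rewrite -[LHS]mul1r -[RHS]mul1r !mulrA; move: (1 : 'M[P]_N) => A.
pose i := Ordinal ltk; pose j := Ordinal lt.
apply: matrix_eq_rank => a w.
rewrite (mul_nilgen _ i) !(mul_nilgen _ j) !(mul_nilgen _ i).
have f1 : simple i (lo j) = lo j by apply: simple_far => /=; lia.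
have f2 : simple i (hi j) = hi j by apply: simple_far => /=; lia.
have f3 : simple j (lo i) = lo i by apply: simple_far => /=; lia.
have f4 : simple j (hi i) = hi i by apply: simple_far => /=; lia.
have -> : (simple i * (simple j * w) = simple j * (simple i * w))%g.
  by rewrite !mulgA simple_commute //= kl.
rewrite /descent !permM f1 f2 f3 f4.
by do 2!case: ifP.
Qed.

Lemma nilgen_braid k :
  nilgen k * nilgen k.+1 * nilgen k = nilgen k.+1 * nilgen k * nilgen k.+1.
Proof.
have [lt|le] := ltnP k.+1 m.-1; last by rewrite (nilgen_large le) !mulr0 !mul0r.
have ltk : (k < m.-1)%N by lia.
rewrite -[LHS]mul1r -[RHS]mul1r !mulrA; move: (1 : 'M[P]_N) => A.
pose i := Ordinal ltk; pose j := Ordinal lt.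
apply: matrix_eq_rank => a w.
rewrite (mul_nilgen _ i) !(mul_nilgen _ j) !(mul_nilgen _ i) !(mul_nilgen _ j).
have hl : lo j = hi i by apply: val_inj.
have e1 : simple i (hi j) = hi j by apply: simple_far => /=; lia.
have e2 : simple j (lo i) = lo i by apply: simple_far => /=; lia.
have sts : (simple i * simple j * simple i = _)%g := simple_braid (erefl : i.+1 = j :> nat).
have -> : (simple i * (simple j * (simple i * w)) = simple j * (simple i * (simple j * w)))%g.
  by rewrite !mulgA sts.
have e3 : simple j (hi i) = hi j by rewrite -hl simple_lo.
have e4 : simple j (hi j) = hi i by rewrite -hl simple_hi.
rewrite /descent !permM hl !(simple_lo i, simple_hi i, e1, e2, e3, e4).
by case: (ltngtP (w (hi i)) (w (lo i))); case: (ltngtP (w (hi j)) (w (hi i)));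
  case: (ltngtP (w (hi j)) (w (lo i))); lia || by [].
Qed.

(** Variables indexed by [nat], as the columns are; 0 out of range. *)
Definition var (k : nat) : P := if insub k is Some x then 'X_x else 0.

Lemma varE (x : 'I_m) : var x = 'X_x. Proof. by rewrite /var valK. Qed.

Definition schubert_matrix (c : nat -> P) : 'M[P]_N :=
  schubert_product nilgen m.-1 (fun k => (c k)%:M) m.

(** The coefficient of [w] in the generating function of Fomin and Stanley;
    [schubertE] identifies it with the Schubert polynomial. *)
Definition schubert_coef w : P :=
  schubert_matrix var (enum_rank 1%g) (enum_rank w).

Lemma scalar_central (c : P) : central (c%:M : 'M[P]_N).
Proof. by move=> A; rewrite -[LHS]/(c%:M *m A) -[RHS]/(A *m c%:M) scalar_mxC. Qed.

Lemma scalar_mulE (c : P) (A : 'M[P]_N) a b : (c%:M * A) a b = c * A a b.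
Proof.
have -> : c%:M * A = c *: A by exact: mul_scalar_mx.
by rewrite mxE.
Qed.

Lemma map_schubert_matrix (s : 'S_m) (c : nat -> P) :
  map_mx (msym s) (schubert_matrix c) = schubert_matrix (msym s \o c).
Proof.
have mapM (A B : 'M[P]_N) : map_mx (msym s) (A * B) = map_mx (msym s) A * map_mx (msym s) B.
  exact: map_mxM.
have map1 : map_mx (msym s) (1 : 'M[P]_N) = 1 by exact: map_mx1.
rewrite /schubert_matrix /schubert_product (big_morph _ mapM map1).
apply: eq_bigr => i _; rewrite /column (big_morph _ mapM map1).
apply: eq_bigr => j _; rewrite raddfD /= map1 mapM; congr (1 + _ * _).
  by rewrite map_scalar_mx.
apply/matrixP=> a b; rewrite !mxE; case: insubP => [k _ _|_]; last exact: msym0.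
by case: (_ && _); rewrite ?msym1 ?msym0.
Qed.

Lemma ddiff_schubert_coef i w : ddiff i (schubert_coef w) =
  if descent w i then schubert_coef (simple i * w)%g else 0.
Proof.
rewrite -mul_nilgen; apply: ddiff_unique.
have im := ltn_ord i.
pose c' := msym (simple i) \o var.
have c'E (x : 'I_m) : c' x = 'X_(simple i x) by rewrite /c' /= varE msym_mpolyXU.
have im1 : (i.+1 < m)%N by lia.
have c'lo : (c' i)%:M = (var i.+1)%:M :> 'M[P]_N.
  by rewrite (c'E (lo i)) simple_lo -varE.
have c'hi : (c' i.+1)%:M = (var i)%:M :> 'M[P]_N.
  by rewrite (c'E (hi i)) simple_hi -varE.
have c'far (k : nat) : k != i -> k != i.+1 -> (c' k)%:M = (var k)%:M :> 'M[P]_N.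
  move=> k1 k2; have [km|km] := ltnP k m.
    by rewrite (c'E (Ordinal km)) simple_far // -varE.
  by rewrite /c' /= /var insubF ?msym0 // ltnNge km.
have := @schubert_product_ddiff _ nilgen m.-1 nilgen_large nilgen_sq nilgen_braid nilgen_far
  _ _ m i (fun k => scalar_central (var k)) im1 c'lo c'hi c'far.
rewrite -(varE (lo i)) -(varE (hi i)) -/(schubert_matrix var) -/(schubert_matrix c').
move/matrixP/(_ (enum_rank 1%g) (enum_rank w)).
have -> : (var (lo i))%:M - (var (hi i))%:M = (var (lo i) - var (hi i))%:M :> 'M[P]_N.
  by rewrite raddfB.
by rewrite scalar_mulE -map_schubert_matrix => ->; rewrite !mxE.
Qed.

Definition factor (p : nat * nat) : 'M[P]_N := 1 + (var p.1)%:M * nilgen p.2.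

(** The coefficient of [w] in a product of factors, listed as pairs of a
    variable and a generator; a list, unlike nested products, can be treated
    by induction from the right. *)
Definition row_coef (L : seq (nat * nat)) w : P :=
  (\prod_(p <- L) factor p) (enum_rank 1%g) (enum_rank w).

Lemma row_coef0 w : row_coef [::] w = (w == 1%g)%:R.
Proof.
by rewrite /row_coef big_nil mxE (inj_eq enum_rank_inj) eq_sym; case: eqP.
Qed.

Lemma row_coefS L p w : row_coef (rcons L p) w = row_coef L w +
  (if insub p.2 is Some i then
     if descent w i then var p.1 * row_coef L (simple i * w)%g else 0 else 0).
Proof.
rewrite /row_coef -cats1 big_cat big_seq1 /= mulrDr mulr1 [LHS]mxE; congr (_ + _).
set A := \prod_(q <- L) factor q.
rewrite mulrA -(scalar_central (var p.1) A) -mulrA.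
rewrite scalar_mulE.
have zeroE a b : (0 : 'M[P]_N) a b = 0 by rewrite mxE.
case: insubP => [i _ <-|]; last first.
  by rewrite -leqNgt => /nilgen_large->; rewrite (mulr0 A) zeroE (mulr0 (var _)).
by rewrite mul_nilgen; case: ifP => _ //; exact: mulr0.
Qed.

Lemma var_nat k : var k \is a mpolyOver m nats.
Proof. by rewrite /var; case: insubP => [x _ _|_]; rewrite ?mpolyOverX ?mpolyOver0. Qed.

Lemma row_coef_nat L w : row_coef L w \is a mpolyOver m nats.
Proof.
elim/last_ind: L w => [|L p IH] w; first by rewrite row_coef0 rpred_nat.
rewrite row_coefS rpredD //; case: insubP => [i _ _|_]; last exact: rpred0.
by case: ifP; rewrite ?rpred0 // rpredM ?var_nat.
Qed.

Lemma row_coef_const L w : (row_coef L w)@_0 = (w == 1%g)%:R.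
Proof.
elim/last_ind: L w => [|L p IH] w.
  by rewrite row_coef0; case: eqP => _; rewrite ?mcoeff1 ?mcoeff0 ?eqxx.
rewrite row_coefS mcoeffD IH; case: insubP => [i _ _|_]; rewrite ?mcoeff0 ?addr0 //.
case: ifP => _; rewrite ?mcoeff0 ?addr0 // rmorphM /= (_ : (var _)@_0 = 0) ?mul0r ?addr0 //.
rewrite /var; case: insubP => [x _ _|_]; rewrite ?mcoeff0 // mcoeffX.
by rewrite mnm1_eq0.
Qed.

Lemma inv_mul_descent w i : descent w i -> #|inv w| = #|inv (simple i * w)%g|.+1.
Proof. exact: card_inv_descent. Qed.

Lemma row_coef_large L w : (size L < #|inv w|)%N -> row_coef L w = 0.
Proof.
elim/last_ind: L w => [|L p IH] w.
  rewrite row_coef0; case: eqP => // ->; rewrite ltnNge leqn0 cards_eq0.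
  case/negP; apply/eqP/setP=> q; rewrite !inE !perm1; by case: ltngtP.
rewrite size_rcons row_coefS => lt; rewrite IH ?add0r; last exact: ltnW.
case: insubP => [i _ _|//]; case: ifP => // d.
by rewrite IH ?mulr0 //; move: lt; rewrite (inv_mul_descent d).
Qed.

(** Only the product of all the second terms of the factors can reach a
    permutation with as many inversions as there are factors. *)
Lemma row_coef_top L w : size L = #|inv w| ->
  row_coef L w = 0 \/ row_coef L w = \prod_(p <- L) var p.1.
Proof.
elim/last_ind: L w => [|L p IH] w.
  by move=> _; rewrite row_coef0 big_nil; case: eqP; [right|left].
rewrite size_rcons row_coefS => sz; rewrite row_coef_large ?add0r; last first.
  by rewrite -sz.
case: insubP => [i _ _|_]; last by left.
case: ifP => [d|_]; last by left.
case: (IH (simple i * w)%g) => [|->|->].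
- by apply: succn_inj; rewrite sz (inv_mul_descent d).
- by left; rewrite mulr0.
by right; rewrite -cats1 big_cat big_seq1 mulrC.
Qed.

Definition factors : seq (nat * nat) :=
  [seq (k, (m.-1 - l.+1)%N) | k <- index_iota 0 m, l <- index_iota 0 (m.-1 - k)].

Lemma schubert_coefE w : schubert_coef w = row_coef factors w.
Proof.
rewrite /schubert_coef /row_coef /factors big_allpairs_dep.
rewrite /schubert_matrix /schubert_product.
congr (fun_of_matrix _ _ _); apply: eq_bigr => i _.
by rewrite /column big_mkord.
Qed.

Definition staircase : P := \prod_(k < m) 'X_k ^+ (m - k.+1).

Lemma prod_factors : \prod_(p <- factors) var p.1 = staircase.
Proof.
rewrite /factors big_allpairs_dep big_mkord; apply: eq_bigr => i _ /=.
rewrite varE big_const_seq count_predT size_iota -Monoid.iteropE /=.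
by rewrite subn0 -subn1 -subnDA add1n.
Qed.

Lemma inv_w0E : inv (w0 m) = [set p : 'I_m * 'I_m | (p.1 < p.2)%N].
Proof.
apply/setP=> -[x y]; rewrite !inE !permE /=; apply: andb_idr => lt.
by have := ltn_ord y; lia.
Qed.

Lemma card_pairs_sum (R : rel 'I_m) :
  #|[set p : 'I_m * 'I_m | R p.1 p.2]| = (\sum_(i < m) \sum_(j < m) R i j)%N.
Proof.
rewrite pair_big /= -sum1_card [RHS]big_mkcond /= [LHS]big_mkcond /=.
by apply: eq_bigr => -[i j] _; rewrite inE /=; case: (R i j).
Qed.

Lemma size_factors : size factors = #|inv (w0 m)|.
Proof.
rewrite inv_w0E (card_pairs_sum (fun x y : 'I_m => x < y)%N).
rewrite size_allpairs_dep sumnE big_map big_mkord; apply: eq_bigr => i _.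
rewrite size_iota !subn0 -(big_mkord xpredT (fun l : nat => (i < l)%N : nat)).
rewrite (big_cat_nat (n := i.+1)) //= big_nat big1 ?add0n => [|j hj]; last by lia.
rewrite big_nat (eq_bigr (fun=> 1%N)) => [|j hj]; last by lia.
by rewrite -big_nat sum_nat_const_nat muln1; lia.
Qed.

Lemma inv1 : #|inv (1%g : 'S_m)| = 0%N.
Proof. by apply: eq_card0 => q; rewrite !inE !perm1; case: ltngtP. Qed.

(** Each letter that is a descent multiplies the permutation by a
    transposition and removes one inversion; any other letter annihilates.
    So the word acts without annihilating exactly when it removes as many
    inversions as it has letters. *)
Lemma ddiff_word_schubert (u : seq 'I_m.-1) w :
  (#|inv w| <= #|inv ((word_perm u)^-1 * w)%g| + size u)%N /\
  ddiff_word u (schubert_coef w) =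
    if #|inv w| == (#|inv ((word_perm u)^-1 * w)%g| + size u)%N
    then schubert_coef ((word_perm u)^-1 * w)%g else 0.
Proof.
elim: u => [|i u [IHle IHe]] /=; first by rewrite invg1 mul1g addn0 eqxx.
rewrite IHe invMg tpermV -/(simple i) -mulgA.
set z := ((word_perm u)^-1 * w)%g in IHle IHe *.
rewrite [ddiff i _]fun_if ddiff0 ddiff_schubert_coef.
have [d|nd] := boolP (descent z i).
  have e := inv_mul_descent d; rewrite e in IHle *.
  by rewrite addnS -addSn; split=> //; case: eqP.
have a : (z (lo i) < z (hi i))%N.
  by have := ascent_or_descent z i; rewrite -/(descent z i) (negPf nd) orbF.
have -> : #|inv (simple i * z)%g| = #|inv z|.+1 := card_inv_ascent a.
rewrite if_same; clear - IHle.
move: #|inv w| #|inv z| (size u) IHle => x y k le.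
by split; [|case: eqP => //]; lia.
Qed.

(** The inversions of [w0 w] are the pairs that [w] leaves in order. *)
Lemma card_inv_w0 w : (#|inv (w * w0 m)%g| + #|inv w|)%N = #|inv (w0 m)|.
Proof.
rewrite inv_w0E.
rewrite -(cardsID (inv w) [set p : 'I_m * 'I_m | (p.1 < p.2)%N]) addnC; congr (_ + _)%N.
  by apply: eq_card => p; rewrite !inE; case: ltnP.
apply: eq_card => -[x y]; rewrite !inE /= !permM !permE /=.
have [lt|] := ltnP x y => //=; rewrite -leqNgt.
have := ltn_ord (w x); have := ltn_ord (w y).
have : w x != w y :> nat by rewrite (inj_eq val_inj) (inj_eq perm_inj) -val_eqE /=; lia.
by lia.
Qed.

Lemma schubert_coef_const w : (schubert_coef w)@_0 = (w == 1%g)%:R.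
Proof. by rewrite schubert_coefE row_coef_const. Qed.

(** As there are as many factors as inversions of [w0], the coefficient is 0
    or the staircase monomial. It is not 0, because a reduced word of [w0]
    takes it to 1. *)
Lemma schubert_coef_w0 : schubert_coef (w0 m) = staircase.
Proof.
have [z|e] := row_coef_top size_factors; last by rewrite schubert_coefE e prod_factors.
have [u [su uw]] := word_of (w0 m).
have [_] := ddiff_word_schubert u (w0 m).
rewrite uw mulVg inv1 add0n su eqxx [schubert_coef (w0 m)]schubert_coefE z.
have -> : ddiff_word u 0 = 0 :> P by elim: (u) => //= i u' ->; rewrite ddiff0.
by move/(congr1 (mcoeff 0%MM)); rewrite schubert_coef_const mcoeff0 eqxx => /eqP; rewrite eq_sym oner_eq0.
Qed.

Lemma size_reduced_word w : size (reduced_word w) = #|inv w|.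
Proof. by rewrite size_tuple lenE. Qed.

Lemma reduced_wordK w : word_perm (reduced_word w) = w.
Proof. by apply/eqP; exact: (xchooseP (reduced_word_exists w)). Qed.

(** The divided differences that define the Schubert polynomial strip [w0]
    down to [w]. *)
Lemma schubertE w : schubert w = schubert_coef w.
Proof.
rewrite /schubert /ddiff_perm -/staircase -schubert_coef_w0.
set v := (w0 m * w^-1)%g.
have [_ ->] := ddiff_word_schubert (reduced_word v) (w0 m).
rewrite reduced_wordK size_reduced_word /v invMg invgK mulgKV.
rewrite -(lenE (w0 m * w^-1)%g) -len_invg invMg invgK lenE.
have w0V : (w0 m)^-1%g = w0 m.
  by apply/eqP; rewrite eq_invg_mul; apply/eqP/permP=> x; rewrite permM !permE rev_ordK.
by rewrite w0V addnC card_inv_w0 eqxx.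
Qed.

(** Because of this recursion, divided differences preserve nonnegative
    combinations of Schubert polynomials. *)
Lemma ddiff_schubert i w : ddiff i (schubert w) =
  if descent w i then schubert (simple i * w)%g else 0.
Proof. by rewrite !schubertE ddiff_schubert_coef; case: ifP; rewrite ?schubertE. Qed.

Lemma schubert_nat w : schubert w \is a mpolyOver m nats.
Proof. by rewrite schubertE schubert_coefE row_coef_nat. Qed.

(** Only the identity permutation has a Schubert polynomial with a constant
    term. *)
Lemma schubert_dual v w :
  (ddiff_word (reduced_word v) (schubert w))@_0 = (w == v)%:R.
Proof.
rewrite schubertE; have [_ ->] := ddiff_word_schubert (reduced_word v) w.
rewrite reduced_wordK size_reduced_word; have [->|ne] := eqVneq w v.
  by rewrite mulVg inv1 add0n eqxx schubert_coef_const eqxx.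
case: ifP => _; rewrite ?mcoeff0 // schubert_coef_const.
case: eqP => // e; case/eqP: ne; apply: (mulgI (v^-1)%g).
by rewrite e mulVg.
Qed.

End NilCoxeter.

(** * Schubert polynomials as a basis below the staircase *)

(** A one-sided inverse of a square matrix is two-sided; here the rows and
    the columns are indexed by different types of the same cardinal. *)
Lemma dual_families (R : fieldType) (S T : finType) (A : S -> T -> R) (B : T -> S -> R) :
    #|S| = #|T| ->
    (forall x y, \sum_t A x t * B t y = (x == y)%:R) ->
  forall t t', \sum_x B t x * A x t' = (t == t')%:R.
Proof.
move=> eqST AB t t'.
have swap n1 n2 (C : 'M[R]_(n1, n2)) (D : 'M[R]_(n2, n1)) :
    n1 = n2 -> C *m D = 1%:M -> D *m C = 1%:M.
  by move=> e; case: n2 / e C D => C D; exact: mulmx1C.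
pose C := \matrix_(i < #|S|, j < #|T|) A (enum_val i) (enum_val j).
pose D := \matrix_(j < #|T|, i < #|S|) B (enum_val j) (enum_val i).
have CD : C *m D = 1%:M.
  apply/matrixP=> i j; rewrite !mxE -(inj_eq enum_val_inj) -AB.
  rewrite (reindex enum_rank) /=; last exact/onW_bij/enum_rank_bij.
  by apply: eq_bigr => x _; rewrite !mxE enum_rankK.
have /matrixP/(_ (enum_rank t) (enum_rank t')) := swap _ _ _ _ eqST CD.
rewrite !mxE (inj_eq enum_rank_inj) => <-.
rewrite [RHS](reindex enum_rank) /=; last exact/onW_bij/enum_rank_bij.
by apply: eq_bigr => x _; rewrite !mxE !enum_rankK.
Qed.

Section SchubertBasis.
Variable m : nat.
Implicit Types (f g : {mpoly rat[m]}) (w v : 'S_m).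

(** The linear form dual to the Schubert polynomial of [w]. *)
Definition schubert_form w f : rat := (ddiff_word (reduced_word w) f)@_0.

Lemma ddiff_wordZ (u : seq 'I_m.-1) c f : ddiff_word u (c *: f) = c *: ddiff_word u f.
Proof. by elim: u => //= i u ->; exact: ddiffZ. Qed.

Lemma ddiff_word_sum (u : seq 'I_m.-1) I (r : seq I) (F : I -> {mpoly rat[m]}) :
  ddiff_word u (\sum_(x <- r) F x) = \sum_(x <- r) ddiff_word u (F x).
Proof. by elim: u => //= i u ->; exact: ddiff_sum. Qed.

Lemma schubert_form_comb w I (r : seq I) (c : I -> rat) (F : I -> {mpoly rat[m]}) :
  schubert_form w (\sum_(x <- r) c x *: F x) = \sum_(x <- r) c x * schubert_form w (F x).
Proof.
rewrite /schubert_form ddiff_word_sum raddf_sum /=; apply: eq_bigr => x _.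
by rewrite ddiff_wordZ mcoeffZ.
Qed.

Lemma below_staircaseP f : reflect (forall e : 'X_{1..m}, f@_e != 0 ->
  forall k : 'I_m, (e k < m - k)%N) (below_staircase f).
Proof.
apply: (iffP allP) => h e; first by rewrite -mcoeff_msupp => /h/forallP.
by rewrite mcoeff_msupp => /h {}h; apply/forallP.
Qed.

Lemma below_staircase_schubert w : below_staircase (schubert w).
Proof.
rewrite /schubert /ddiff_perm; elim: (reduced_word _) => [|i u IH] /=; last first.
  exact: ddiff_below_staircase.
apply/below_staircaseP=> e; have -> : \prod_(k < m) 'X_k ^+ (m - k.+1) =
    'X_[rat, [multinom (m - k.+1)%N | k < m]].
  by rewrite mpolyXE_id; apply: eq_bigr => k _; rewrite mnmE.
rewrite mcoeffX pnatr_eq0 eqb0 negbK => /eqP <- k.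
by rewrite mnmE; have := ltn_ord k; lia.
Qed.

(** The exponent vectors below the staircase. Like Lehmer codes, there are
    [m!] of them. *)
Definition code := {a : {ffun 'I_m -> 'I_m} | [forall k : 'I_m, a k < m - k]%N}.

Lemma card_code : #|{: 'S_m}| = #|{: code}|.
Proof.
rewrite card_sig card_Sn.
have -> : #|[pred a : {ffun 'I_m -> 'I_m} | [forall k : 'I_m, a k < m - k]%N]| =
    #|family (fun k : 'I_m => [pred a : 'I_m | a < m - k]%N)|.
  by apply: eq_card => a; rewrite !inE; apply: eq_forallb.
rewrite card_family foldrE big_map big_enum /= fact_prod big_add1 /= big_mkord.
rewrite (reindex_inj rev_ord_inj) /=; apply: eq_bigr => k _.
rewrite -sum1_card -(big_ord_widen m (fun=> 1%N)) ?leq_subr //.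
by rewrite sum_nat_const card_ord muln1 subnSK.
Qed.

Definition code_mnm (a : code) : 'X_{1..m} := [multinom (val a k : nat) | k < m].

Lemma code_mnm_inj : injective code_mnm.
Proof.
move=> a b /mnmP e; apply/val_inj/ffunP=> k; apply: val_inj.
by have := e k; rewrite !mnmE.
Qed.

Lemma below_staircaseE f : below_staircase f ->
  f = \sum_(a : code) f@_(code_mnm a) *: 'X_[code_mnm a].
Proof.
move=> /below_staircaseP h; apply/mpolyP=> e; rewrite raddf_sum /=.
have [z|nz] := eqVneq f@_e 0.
  rewrite z big1 // => a _; rewrite mcoeffZ mcoeffX.
  by case: eqP => [->|_]; rewrite ?z ?mul0r ?mulr0.
have ek (k : 'I_m) : (e k < m)%N by have := h e nz k; lia.
have eP : [forall k : 'I_m, [ffun k => Ordinal (ek k)] k < m - k]%N.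
  by apply/forallP=> k; rewrite ffunE; exact: h.
pose d : code := exist _ [ffun k => Ordinal (ek k)] eP.
have ee : code_mnm d = e by apply/mnmP=> k; rewrite mnmE /= ffunE.
rewrite (bigD1 d) //= ee mcoeffZ mcoeffX eqxx mulr1 big1 ?addr0 //.
move=> a na; rewrite mcoeffZ mcoeffX -ee (inj_eq code_mnm_inj) (negPf na).
by rewrite mulr0.
Qed.

(** The Schubert polynomials are as many as the monomials below the
    staircase, and the dual forms show that their expansion matrix is
    invertible. *)
Theorem schubert_expansion f : below_staircase f ->
  f = \sum_w schubert_form w f *: schubert w.
Proof.
move=> hf.
pose A w (a : code) := (schubert w)@_(code_mnm a).
pose B (a : code) w := schubert_form w 'X_[code_mnm a].
have AB w v : \sum_a A w a * B a v = (w == v)%:R.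
  rewrite /B -schubert_form_comb -(below_staircaseE (below_staircase_schubert w)).
  exact: schubert_dual.
have BA := dual_families card_code AB.
rewrite {1}(below_staircaseE hf).
transitivity (\sum_a \sum_w (f@_(code_mnm a) * B a w) *: schubert w); last first.
  rewrite exchange_big /=; apply: eq_bigr => w _; rewrite -scaler_suml; congr (_ *: _).
  by rewrite {2}(below_staircaseE hf) schubert_form_comb.
apply: eq_bigr => a _.
under eq_bigr => w _ do rewrite -scalerA.
rewrite -scaler_sumr; congr (_ *: _).
under eq_bigr => w _.
  rewrite {1}(below_staircaseE (below_staircase_schubert w)) scaler_sumr.
  under eq_bigr => b _ do rewrite scalerA.
  over.
rewrite exchange_big /= (bigD1 a) //= -scaler_suml BA eqxx scale1r big1 ?addr0 //.
by move=> b nb; rewrite -scaler_suml BA eq_sym (negPf nb) scale0r.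
Qed.

End SchubertBasis.

(** * Involutions and their weak order *)

(** Permutations as functions on [nat], so that positions and values are
    compared and computed without ordinals; locked, so that conversion does not
    try to evaluate them. *)
Fact ev_key : unit. Proof. exact: tt. Qed.
Definition ev m (w : 'S_m) (x : nat) : nat :=
  locked_with ev_key (if insub x is Some y then nat_of_ord (w y) else x).

Lemma evE m (w : 'S_m) x : ev w x = if insub x is Some y then nat_of_ord (w y) else x.
Proof. by rewrite /ev; case: ev_key. Qed.

Definition sw (k x : nat) : nat :=
  if x == k then k.+1 else if x == k.+1 then k else x.

Lemma sw_lo k x : x = k -> sw k x = k.+1.
Proof. by move=> ->; rewrite /sw eqxx. Qed.

Lemma sw_hi k x : x = k.+1 -> sw k x = k.
Proof. by move=> ->; rewrite /sw gtn_eqF ?eqxx. Qed.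

Lemma sw_far k x : x <> k -> x <> k.+1 -> sw k x = x.
Proof. by rewrite /sw => /eqP/negPf-> /eqP/negPf->. Qed.

Section Evaluation.
Variable m : nat.
Implicit Types (i j : 'I_m.-1) (u v w : 'S_m).

Lemma ev_ord w (x : 'I_m) : ev w x = w x. Proof. by rewrite evE valK. Qed.

Lemma ev_lo w i : w (lo i) = ev w i :> nat. Proof. by rewrite -ev_ord. Qed.
Lemma ev_hi w i : w (hi i) = ev w i.+1 :> nat. Proof. by rewrite -ev_ord. Qed.

Lemma ev_out w x : (m <= x)%N -> ev w x = x.
Proof. by move=> le; rewrite evE insubF // ltnNge le. Qed.

Lemma evM u v x : ev (u * v)%g x = ev v (ev u x).
Proof.
have [lt|le] := ltnP x m; last by rewrite !ev_out // ev_out.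
by rewrite -[x]/(val (Ordinal lt)) !ev_ord permM.
Qed.

Lemma ev1 x : ev (1%g : 'S_m) x = x.
Proof. by rewrite evE; case: insubP => // y _ <-; rewrite perm1. Qed.

Lemma ev_ext u v : (forall x, ev u x = ev v x) -> u = v.
Proof. by move=> e; apply/permP=> x; apply: val_inj; have := e x; rewrite !ev_ord. Qed.

Lemma ev_simple i x : ev (simple i) x = sw i x.
Proof.
have im := ltn_ord i.
have [lt|le] := ltnP x m; last by rewrite ev_out // sw_far //; lia.
rewrite -[x]/(val (Ordinal lt)) ev_ord.
have [e|n1] := eqVneq x i.
  by rewrite (_ : Ordinal lt = lo i) ?simple_lo ?sw_lo //; apply: val_inj.
have [e|n2] := eqVneq x i.+1.
  by rewrite (_ : Ordinal lt = hi i) ?simple_hi ?sw_hi //; apply: val_inj.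
by rewrite simple_far // sw_far //=; apply/eqP.
Qed.

Definition conj i w : 'S_m := (simple i * w * simple i)%g.

Lemma ev_conj i w x : ev (conj i w) x = sw i (ev w (sw i x)).
Proof. by rewrite !evM !ev_simple. Qed.

Lemma ev_left i w x : ev (simple i * w)%g x = ev w (sw i x).
Proof. by rewrite evM ev_simple. Qed.

Lemma ev_w0 x : (x < m)%N -> ev (w0 m) x = (m - x.+1)%N.
Proof. by move=> lt; rewrite -[x]/(val (Ordinal lt)) ev_ord permE. Qed.

End Evaluation.

Lemma sw_spec k x : x = k /\ sw k x = k.+1 \/ x = k.+1 /\ sw k x = k \/
  x <> k /\ x <> k.+1 /\ sw k x = x.
Proof.
have [->|/eqP n1] := eqVneq x k; first by left; rewrite sw_lo.
have [->|/eqP n2] := eqVneq x k.+1; first by right; left; rewrite sw_hi.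
by do 2!right; rewrite sw_far.
Qed.

Lemma sw_near k : ((sw k k = k.+1) * (sw k k.+1 = k) * (sw k k.+2 = k.+2) *
  (sw k k.+3 = k.+3) * (sw k k.+4 = k.+4) * (sw k.+1 k = k) * (sw k.+2 k = k) *
  (sw k.+3 k = k))%type.
Proof. by rewrite (sw_lo erefl) (sw_hi erefl) !sw_far //; lia. Qed.

(** [ev_lia] proves arithmetical facts about the values of conjugated
    permutations: it discards the hypotheses that are not about numbers, applies
    the transpositions whose arguments are decided, distinguishes cases for the
    others and leaves the rest to linear arithmetic. *)
Ltac keep_arith := repeat match goal with H : ?T |- _ =>
  lazymatch T with
  | @eq ?A _ _ => tryif unify A nat then fail else clear H
  | is_true (leq _ _) => fail
  | ~ _ => fail
  | @eq _ _ _ -> _ => fail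
  | _ => clear H
  end end.
Ltac sw_step := match goal with |- context [sw ?k ?x] =>
  first [ rewrite (@sw_lo k x ltac:(lia)) | rewrite (@sw_hi k x ltac:(lia))
        | rewrite (@sw_far k x ltac:(lia) ltac:(lia)) ] end.
Ltac ev_step := match goal with
  | H : ev ?t ?y = ?v |- context [ev ?t ?y] => rewrite H
  | H : ev ?t ?y = ?v |- context [ev ?t ?x] =>
    replace (ev t x) with v by (symmetry; replace x with y by lia; exact H) end.
Ltac sw_split := repeat match goal with |- context [sw ?k ?x] =>
  generalize (sw_spec k x); generalize (sw k x);
  let y := fresh "y" in intros y end.
Ltac evs := rewrite ?(ev_conj, ev_left);
  repeat first [ progress rewrite ?sw_near | ev_step | sw_step ].
Ltac ev_lia := keep_arith; evs; first [ done | lia | by sw_split; lia ].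

Ltac ev_lia_with eqs := rewrite ?(ev_conj, ev_left) -?eqs; ev_lia.

(** Path independence depends on the divided differences only through their
    commutation and braid relations, so here they are arbitrary operators on
    a type. The element [w0] is pictured at the top: [up] steps lead towards
    it and add inversions. *)
Section WeakOrder.
Variables (m : nat) (dashes : bool) (T : Type).
Variables (D : 'I_m.-1 -> T -> T) (top : T).
Implicit Types (i j k : 'I_m.-1) (w pi tau : 'S_m) (f g : T).
Local Notation inv := Defs.inv.

(** The involutions when [dashes] holds, as in the orthogonal case, and
    those without fixed points otherwise, as in the symplectic case. *)
Definition orbit_index pi : Prop := (forall x, ev pi (ev pi x) = x) /\
  (dashes \/ forall x, (x < m)%N -> ev pi x <> x).

Definition fixes i pi := (ev pi i == i) && (ev pi i.+1 == i.+1).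

(** The inverse of the downward step labelled [i]; it is dashed when [i] and
    [i+1] are fixed points. *)
Definition up i pi : 'S_m := if fixes i pi then (simple i * pi)%g else conj i pi.

(** The values at a permutation of all paths from [w0], without the factors
    1/2 of dashed edges. The last edge of a path is the outermost
    constructor, so inverting two derivations presents the two last edges to
    be compared. *)
Inductive attached : 'S_m -> T -> Prop :=
| attached_top : attached (w0 m) top
| attached_step i pi f : orbit_index pi -> (ev pi i < ev pi i.+1)%N ->
    attached (up i pi) f -> attached pi (D i f).

Lemma orbit_invol pi : orbit_index pi -> pi \in invol m.
Proof. by case=> h _; rewrite inE; apply/eqP/ev_ext=> x; rewrite evM h ev1. Qed.

Lemma ev_inj pi x y : orbit_index pi -> ev pi x = ev pi y -> x = y.
Proof. by case=> h _ e; rewrite -(h x) e h. Qed.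

Lemma orbit_conj i pi : orbit_index pi -> orbit_index (conj i pi).
Proof.
have swK k x : sw k (sw k x) = x by rewrite /sw; do !case: eqP; lia.
have swm (k : 'I_m.-1) x : (x < m)%N -> (sw k x < m)%N.
  by have := ltn_ord k; rewrite /sw; do !case: eqP; lia.
case=> h1 h2; split=> [x|]; first by rewrite !ev_conj swK h1 swK.
case: h2 => [h2|h2]; [by left | right=> x lt; rewrite ev_conj => e].
by apply: (h2 (sw i x)); [exact: swm | rewrite -{2}e swK].
Qed.

Lemma conj_up i pi : ~~ fixes i pi -> up i pi = conj i pi.
Proof. by rewrite /up => /negPf->. Qed.

Lemma dash_up i pi : fixes i pi -> up i pi = (simple i * pi)%g.
Proof. by rewrite /up => ->. Qed.

Lemma fixes_commute i pi : fixes i pi -> (simple i * pi = pi * simple i)%g.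
Proof.
by case/andP=> /eqP e1 /eqP e2; apply: commute_simple; apply: val_inj;
  rewrite /= -ev_ord.
Qed.

Lemma orbit_dash i pi : orbit_index pi -> fixes i pi -> orbit_index (simple i * pi)%g.
Proof.
move=> hpi fx; have [h1 h2] := hpi; split=> [x|].
  rewrite -evM {1}(fixes_commute fx) -mulgA [(simple i * (simple i * pi))%g]mulgA.
  by rewrite simpleK mul1g evM.
case: h2 => [h2|h2]; [by left | case/andP: fx => /eqP fx _].
by case: (h2 i) => //; have := ltn_ord i; lia.
Qed.

Lemma orbit_up i pi : orbit_index pi -> orbit_index (up i pi).
Proof.
move=> hpi; rewrite /up; case: ifP => fx; [exact: orbit_dash | exact: orbit_conj].
Qed.

Lemma inv_up i pi : orbit_index pi -> (ev pi i < ev pi i.+1)%N ->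
  (#|inv pi| < #|inv (up i pi)|)%N.
Proof.
move=> hpi; rewrite -ev_lo -ev_hi => asc; have hi := orbit_invol hpi.
have [fx|nfx] := boolP (fixes i pi).
  have := len_simple_ascent hi asc; rewrite !lenE dash_up // fixes_commute //.
  by move=> ->.
rewrite conj_up //; have ne : simple i *o pi *o simple i != pi.
  apply: contra nfx => /eqP e; have [e1 e2] := conj_eq_ascent hi asc e.
  by rewrite /fixes -ev_lo -ev_hi e1 e2 !eqxx.
by have [_] := conj_cover hi asc ne; rewrite !lenE mulgA => ->; exact: ltnW.
Qed.

Lemma inv_bound pi : (#|inv pi| <= m * m)%N.
Proof. by apply: leq_trans (max_card _) _; rewrite card_prod card_ord. Qed.

Lemma ascent_existsE pi : pi != w0 m -> exists i : 'I_m.-1, (ev pi i < ev pi i.+1)%N.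
Proof. by case/ascent_exists=> i; rewrite ev_lo ev_hi; exists i. Qed.

(** Induction from [w0] downwards. *)
Lemma orbit_ind (Q : 'S_m -> Prop) :
  (forall pi, orbit_index pi ->
     (forall tau, orbit_index tau -> (#|inv pi| < #|inv tau|)%N -> Q tau) -> Q pi) ->
  forall pi, orbit_index pi -> Q pi.
Proof.
move=> IH pi; have [k] := ubnP (m * m - #|inv pi|)%N.
elim: k pi => // k IHk pi lek hpi; apply: IH => // tau htau lt.
by apply: IHk => //; have := inv_bound tau; lia.
Qed.

(** An involution other than [w0] has an ascent, hence a step towards [w0]. *)
Lemma attached_exists pi : orbit_index pi -> exists f, attached pi f.
Proof.
elim/orbit_ind => {}pi hpi IH; have [->|ne] := eqVneq pi (w0 m).
  by exists top; exact: attached_top.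
have [i asc] := ascent_existsE ne.
have [f hf] := IH _ (orbit_up i hpi) (inv_up hpi asc).
by exists (D i f); exact: attached_step.
Qed.

Lemma w0_descends i : (ev (w0 m) i < ev (w0 m) i.+1)%N = false.
Proof. by have := ltn_ord i => im; rewrite !ev_w0; lia. Qed.

Lemma attached_inv pi f : attached pi f -> pi = w0 m /\ f = top \/
  exists i f', [/\ orbit_index pi, (ev pi i < ev pi i.+1)%N, attached (up i pi) f' & f = D i f'].
Proof.
by case=> [|i {}pi g h1 h2 h3]; [left | right; exists i, g].
Qed.

Lemma attached_w0 f : attached (w0 m) f -> f = top.
Proof.
by case/attached_inv=> [[]//|[i [g []]]]; rewrite w0_descends.
Qed.

(** There is an edge labelled [i] from [rho] down to [pi]. *)
Definition lifts i pi rho := [/\ orbit_index rho, (#|inv pi| < #|inv rho|)%N &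
  forall f, attached rho f -> attached pi (D i f)].

Lemma lift_up i pi : orbit_index pi -> (ev pi i < ev pi i.+1)%N -> lifts i pi (up i pi).
Proof.
by move=> hpi asc; split=> [||f]; [exact: orbit_up | exact: inv_up | exact: attached_step].
Qed.

Lemma lift_conj i pi : orbit_index pi -> (ev pi i < ev pi i.+1)%N ->
  ~ (ev pi i = i /\ ev pi i.+1 = i.+1) -> lifts i pi (conj i pi).
Proof.
move=> hpi asc ne; rewrite -conj_up; first exact: lift_up.
by apply/negP=> /andP[/eqP e1 /eqP e2]; case: ne.
Qed.

Lemma lift_dash i pi : orbit_index pi -> ev pi i = i -> ev pi i.+1 = i.+1 ->
  lifts i pi (simple i * pi)%g.
Proof.
move=> hpi e1 e2; have fx : fixes i pi by rewrite /fixes e1 e2 !eqxx.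
by rewrite -dash_up //; apply: lift_up => //; rewrite e1 e2.
Qed.

(** A step at a distance from [x] moves the values at [x] by the same
    transposition, be it solid or dashed. *)
Lemma ev_up_far i pi (x : nat) : orbit_index pi -> x <> i -> x <> i.+1 ->
  ev (up i pi) x = sw i (ev pi x).
Proof.
move=> hpi n1 n2; rewrite /up; case: ifP => [/andP[/eqP e1 /eqP e2]|_]; last first.
  by rewrite ev_conj (sw_far n1 n2).
rewrite ev_left (sw_far n1 n2) sw_far // => e.
  by apply: n1; apply: (ev_inj hpi); rewrite e.
by apply: n2; apply: (ev_inj hpi); rewrite e.
Qed.

End WeakOrder.

(** * Local confluence of the weak order *)

(** Consequences of the braid relations for operators [a], [b], [c], [d]
    belonging to consecutive generators, except that in [crossing_word] the
    generator of [d] is far from the other two. They serve to carry the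
    relations [crossing_at], [hook_at] and [nest_at], defined below, from a
    polynomial [F] to the polynomial that the last few edges of a path make
    of it. A name in [_fixed] refers to the case in which the path moves the
    block past a fixed point. *)
Section BraidWords.
Variables (T : Type) (a b c d : T -> T).
Hypothesis acC : forall x, a (c x) = c (a x).
Hypothesis abB : forall x, a (b (a x)) = b (a (b x)).
Hypothesis bcB : forall x, b (c (b x)) = c (b (c x)).

Lemma crossing_word F : (forall x, d (a x) = a (d x)) -> (forall x, d (b x) = b (d x)) ->
  a F = d F -> b (a (b F)) = d (a (b F)).
Proof. by move=> daC dbC cross; rewrite -abB cross -dbC -daC. Qed.

Lemma hook_word F : a (b F) = b (a F) -> b (c (a (b (c F)))) = c (b (a (b (c F)))).
Proof.
move=> hook.
have -> : b (c (a (b (c F)))) = a (b (c (a (b F)))).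
  by rewrite -(acC (b (c F))) -(bcB F) -(abB (c (b F))) (acC (b F)).
have -> : c (b (a (b (c F)))) = a (b (c (b (a F)))).
  by rewrite -(abB (c F)) -(acC (b (a (c F)))) (acC F) -(bcB (a F)).
by rewrite hook.
Qed.

(** If the outer two operators agree on [F], reversing the order of the
    three generators makes no difference to the words of [nest_at]. *)
Lemma flip_word F : a F = c F -> a (b (c (b F))) = c (b (a (b F))).
Proof. by move=> cross; rewrite bcB acC -cross abB. Qed.

Lemma hook_word_fixed F : a F = c F -> b (a (c (b F))) = a (b (c (b F))) ->
  b (c (a (b F))) = c (b (a (b F))).
Proof. by move=> cross nest; rewrite -acC nest flip_word. Qed.

Hypothesis adC : forall x, a (d x) = d (a x).
Hypothesis bdC : forall x, b (d x) = d (b x).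
Hypothesis cdB : forall x, c (d (c x)) = d (c (d x)).

(** Each generator moves past the word [a b c d] by turning into its
    neighbour. *)
Lemma shift_word x :
  (b (a (b (c (d x)))) = a (b (c (d (a x))))) *
  (c (a (b (c (d x)))) = a (b (c (d (b x))))) *
  (d (a (b (c (d x)))) = a (b (c (d (c x))))).
Proof.
split; [split|].
- by rewrite -abB acC adC.
- by rewrite -acC -bcB bdC.
by rewrite -adC -bdC -cdB.
Qed.

Lemma nest_word F : b (a (c (b F))) = a (b (c (b F))) ->
  let f := a (b (c (d F))) in c (b (d (c f))) = b (c (d (c f))).
Proof. by move=> nest; rewrite /= !shift_word nest. Qed.

(** A reverse block of four meets a fixed point: the relations of two
    smaller blocks inside the resulting block of five have to be combined. *)
Lemma nest_word_fixed F : a F = d F -> b (c F) = c (b F) ->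
  let f := a (b F) in c (b (d (c f))) = d (c (b (c f))).
Proof.
(* The right-hand side is named so that the walk below through the braid
   class, with its uses of [cross] and [hook], rewrites the left-hand side
   alone. *)
move=> cross hook /=; have [y ey] : exists y, d (c (b (c (a (b F))))) = y by eexists.
rewrite ey.
rewrite (bdC (c (a (b F)))) -(acC (b F)) -hook -(abB (c F)) -(adC (b (a (c F)))).
rewrite -(acC (d (b (a (c F))))) -(bdC (a (c F))) (acC F) cross.
rewrite -(cdB F) -(bcB (d (c F))) (bdC (c F)) hook (cdB (b F)).
rewrite (bdC (c (d (b F)))) (adC (b (c (d (b F))))) -(bdC F) (bcB (d F)).
rewrite (acC (b (c (d F)))) -cross -(acC F) (abB (c F)) hook (acC (b F)).
exact: ey.
Qed.

End BraidWords.

(** Two paths that end with different edges into the same [tau] are compared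
    through a common element above, from which both can be continued by the
    two sides of a commutation or braid relation. This fails in two
    situations, where the square or the hexagon collapses. *)
Section PathIndependence.
Variables (m : nat) (dashes : bool) (T : Type).
Variables (D : 'I_m.-1 -> T -> T) (zero top : T).
Hypothesis opC : forall (i j : 'I_m.-1) f, (i.+1 < j)%N \/ (j.+1 < i)%N -> D i (D j f) = D j (D i f).
Hypothesis opB : forall (i j : 'I_m.-1) f, i.+1 = j :> nat \/ j.+1 = i :> nat ->
  D i (D j (D i f)) = D j (D i (D j f)).
Implicit Types (i j k p q r : 'I_m.-1) (w pi tau : 'S_m) (f g : T).
Local Notation inv := Defs.inv.
Local Notation orbit := (@orbit_index m dashes).
Local Notation attached := (@attached m dashes T D top).

Local Notation lifts := (@lifts m dashes T D top).

Definition unique_at tau := forall f g, attached tau f -> attached tau g -> f = g.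

(** The steps [i] and [j] lead from [tau] to the same element, by exchanging
    the ends of the two nested arcs [(i, j+1)] and [(i+1, j)], which then
    cross. *)
Definition crossing_at tau := forall i j f, attached tau f -> (i.+1 < j)%N ->
  ev tau i = j.+1 -> ev tau i.+1 = j -> D i f = D j f.

(** From the arc [(i, i+2)] around the fixed point [i+1], the steps [i],
    [i+1] in either order lead to three fixed points. *)
Definition hook_at tau := forall i j f, attached tau f -> i.+1 = j :> nat ->
  ev tau i = j.+1 -> ev tau j = j -> D i (D j f) = D j (D i f).

(** From the nested arcs [(p, p+3)] and [(p+1, p+2)], both words lead to
    four fixed points. This relation is needed to carry [hook_at] past a
    fixed point. *)
Definition nest_at tau := dashes -> forall p q r f, attached tau f ->
  p.+1 = q :> nat -> q.+1 = r :> nat -> ev tau p = r.+1 -> ev tau q = r ->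
  D q (D p (D r (D q f))) = D p (D q (D r (D q f))).

(** In the symplectic case no edge labelled [i] leaves an element that
    exchanges [i] and [i+1]; correspondingly the divided difference
    vanishes. *)
Definition swap_at tau := ~~ dashes -> forall i f, attached tau f ->
  ev tau i = i.+1 -> D i f = zero.

(** The two steps towards [w0] commute, unless [tau] maps [i, i+1] to [j,
    j+1]; then they coincide and lead to an element to which [crossing_at]
    applies. *)
Lemma unique_far tau i j f g : orbit tau ->
    (forall sigma, orbit sigma -> (#|inv tau| < #|inv sigma|)%N ->
       unique_at sigma /\ crossing_at sigma) ->
    (ev tau i < ev tau i.+1)%N -> (ev tau j < ev tau j.+1)%N -> (i.+1 < j)%N ->
    attached (up i tau) f -> attached (up j tau) g ->
  D i f = D j g.
Proof.
move=> ht IH ai aj ij hf hg.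
have [h1 _] := ht.
have oi := orbit_up i ht; have oj := orbit_up j ht.
have [ui ci] := IH _ oi (inv_up ht ai); have [uj _] := IH _ oj (inv_up ht aj).
have [/andP[/eqP e1 /eqP e2]|gen] := boolP ((ev tau i == j) && (ev tau i.+1 == j.+1)).
  have e3 : ev tau j = i by rewrite -e1 h1.
  have e4 : ev tau j.+1 = i.+1 by rewrite -e2 h1.
  have upi : up i tau = conj i tau.
    by apply: conj_up; rewrite /fixes e1; apply/nandP; left; lia.
  have upj : up j tau = conj j tau.
    by apply: conj_up; rewrite /fixes e3; apply/nandP; left; lia.
  (* An argument [x] not in the two pairs has its value outside them too, so
     both conjugations leave it alone. *)
  have same : conj i tau = conj j tau.
    apply: ev_ext => x; have hx := h1 x.
    have [->|/eqP n1] := eqVneq x i; first by evs.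
    have [->|/eqP n2] := eqVneq x i.+1; first by evs.
    have [->|/eqP n3] := eqVneq x j; first by evs.
    have [->|/eqP n4] := eqVneq x j.+1; first by evs.
    have m1 : ev tau x <> i by move=> e; rewrite e in hx; lia.
    have m2 : ev tau x <> i.+1 by move=> e; rewrite e in hx; lia.
    have m3 : ev tau x <> j by move=> e; rewrite e in hx; lia.
    have m4 : ev tau x <> j.+1 by move=> e; rewrite e in hx; lia.
    by evs.
  rewrite upi in hf ci; rewrite upj -same -upi in hg.
  have fg : f = g by apply: ui => //; rewrite upi.
  rewrite -fg; apply: ci => //; by evs.
have nolink : ~ (ev tau j = i /\ ev tau j.+1 = i.+1).
  case=> e1 e2; case/negP: gen.
  by rewrite -[i.+1]e2 -[X in ev tau X == _]e1 !h1 !eqxx.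
have nolink' : ~ (ev tau i = j /\ ev tau i.+1 = j.+1).
  by case=> e1 e2; case/negP: gen; rewrite e1 e2 !eqxx.
have asc_j : (ev (up i tau) j < ev (up i tau) j.+1)%N.
  rewrite !(ev_up_far ht); try lia.
  by keep_arith; sw_split; lia.
have fix_j : fixes j (up i tau) = fixes j tau.
  rewrite /fixes !(ev_up_far ht); try lia.
  by keep_arith; sw_split; lia.
have asc_i : (ev (up j tau) i < ev (up j tau) i.+1)%N.
  rewrite !(ev_up_far ht); try lia.
  by keep_arith; sw_split; lia.
have fix_i : fixes i (up j tau) = fixes i tau.
  rewrite /fixes !(ev_up_far ht); try lia.
  by keep_arith; sw_split; lia.
have sC : (simple i * simple j = simple j * simple i)%g by apply: simple_commute; rewrite ij.
have upC : up j (up i tau) = up i (up j tau).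
  rewrite {1}/up fix_j [RHS]/up fix_i /up; case: ifP => fj; case: ifP => fi.
  - by rewrite !mulgA sC.
  - by rewrite /conj !mulgA sC.
  - by rewrite /conj !mulgA sC.
  by rewrite /conj !mulgA sC -!mulgA sC.
have [F hF] := attached_exists D top (orbit_up j oi).
have -> : f = D j F by apply: ui hf _; exact: attached_step.
have -> : g = D i F by apply: uj hg _; apply: attached_step => //; rewrite -upC.
by apply: opC; left.
Qed.

(** The cases are according to which of the two steps towards [w0] are
    dashed. If none or only one is, three steps on either side lead to the
    same element and the braid relation applies. If both are, [i], [i+1],
    [i+2] are fixed, two steps on either side suffice, and [hook_at] takes
    the place of the braid relation. *)
Lemma unique_adjacent tau i j f g : orbit tau ->
    (forall sigma, orbit sigma -> (#|inv tau| < #|inv sigma|)%N ->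
       unique_at sigma /\ hook_at sigma) ->
    (ev tau i < ev tau i.+1)%N -> (ev tau j < ev tau j.+1)%N -> i.+1 = j :> nat ->
    attached (up i tau) f -> attached (up j tau) g ->
  D i f = D j g.
Proof.
move=> ht IH ai aj ij hf hg; have [h1 _] := ht.
have oi := orbit_up i ht; have oj := orbit_up j ht.
have [ui _] := IH _ oi (inv_up ht ai); have [uj _] := IH _ oj (inv_up ht aj).
have sts := simple_braid ij.
have a2 : (ev tau i.+1 < ev tau i.+2)%N by rewrite ij.
have [c ec] : exists c, ev tau i = c by eexists.
have [d ed] : exists d, ev tau i.+1 = d by eexists.
have [e ee] : exists e, ev tau i.+2 = e by eexists.
rewrite ec ed in ai; rewrite ed ee in a2.
have link (x y x' y' : nat) : ev tau x = x' -> ev tau y = y' -> x' = y -> y' = x.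
  by move=> e1 e2 e3; rewrite -e2 -e3 -e1 h1.
have l1 := link _ _ _ _ ec ed; have l2 := link _ _ _ _ ec ee.
have l3 := link _ _ _ _ ed ee; have l4 := link _ _ _ _ ed ec.
have l5 := link _ _ _ _ ee ec; have l6 := link _ _ _ _ ee ed.
have [fi|nfi] := boolP (fixes i tau); have [fj|nfj] := boolP (fixes j tau).
- have /andP[/eqP t1 /eqP t2] := fi; have /andP[_ /eqP t3] := fj.
  rewrite -ij in t3; clear c ec d ed e ee ai a2 l1 l2 l3 l4 l5 l6 link.
  have upi := dash_up fi; have upj := dash_up fj.
  have [o1 lt1 _] : lifts i tau (simple i * tau)%g by apply: lift_dash.
  have [o2 lt2 st2] : lifts j (simple i * tau)%g (conj j (simple i * tau)%g).
    by apply: lift_conj => //; ev_lia_with ij.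
  have [_ _ st2'] : lifts i (simple j * tau)%g (conj i (simple j * tau)%g).
    by apply: lift_conj => //; [rewrite -upj | ev_lia_with ij | ev_lia_with ij].
  have [F hF] := attached_exists D top o2.
  have same : conj i (simple j * tau)%g = conj j (simple i * tau)%g.
    by rewrite /conj -!mulgA -(fixes_commute fi) -(fixes_commute fj) !mulgA sts.
  have -> : f = D j F by apply: ui hf _; rewrite upi; exact: st2.
  have -> : g = D i F by apply: uj hg _; rewrite upj; apply: st2'; rewrite same.
  have [_ hook] := IH _ o2 (ltn_trans lt1 lt2).
  by apply: hook => //; ev_lia_with ij.
- have /andP[/eqP t1 /eqP t2] := fi.
  have upi := dash_up fi; have upj := conj_up nfj.
  have he : (i.+2 < e)%N.
    rewrite ltn_neqAle; apply/andP; split; last by rewrite -ed t2 in a2.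
    by apply: contra nfj => /eqP e2; rewrite /fixes -ij t2 ee -e2 !eqxx.
  clear c ec d ed ai a2 l1 l2 l3 l4 l5 l6 link.
  have nj : ~ (ev tau j = j /\ ev tau j.+1 = j.+1).
    by case=> e1 e2; case/negP: nfj; rewrite /fixes e1 e2 !eqxx.
  have [o1 _ _] : lifts i tau (simple i * tau)%g by apply: lift_dash.
  have [o2 _ st2] : lifts j (simple i * tau)%g (conj j (simple i * tau)%g).
    by apply: lift_conj => //; ev_lia_with ij.
  have [o3 _ st3] : lifts i (conj j (simple i * tau)%g) (conj i (conj j (simple i * tau)%g)).
    by apply: lift_conj => //; ev_lia_with ij.
  have [o1' _ _] : lifts j tau (conj j tau) by apply: lift_conj.
  have [o2' _ st2'] : lifts i (conj j tau) (conj i (conj j tau)).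
    by apply: lift_conj => //; ev_lia_with ij.
  have [o3' _ st3'] : lifts j (conj i (conj j tau)) (simple j * conj i (conj j tau))%g.
    by apply: lift_dash => //; ev_lia_with ij.
  have [F hF] := attached_exists D top o3.
  have same : (simple j * conj i (conj j tau))%g = conj i (conj j (simple i * tau)%g).
    by rewrite /conj !mulgA sts.
  have -> : f = D j (D i F) by apply: ui hf _; rewrite upi; exact/st2/st3.
  have -> : g = D i (D j F) by apply: uj hg _; rewrite upj; apply/st2'/st3'; rewrite same.
  by apply: opB; left.
- have /andP[/eqP t1 /eqP t2] := fj; rewrite -ij in t1 t2.
  have upi := conj_up nfi; have upj := dash_up fj.
  have hc : (c < i)%N.
    have : c <> i by move=> e1; case/negP: nfi; rewrite /fixes ec e1 t1 !eqxx.
    by rewrite t1 in ed; rewrite -ed in ai; lia.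
  clear d ed e ee ai a2 l1 l2 l3 l4 l5 l6 link.
  have ni : ~ (ev tau i = i /\ ev tau i.+1 = i.+1).
    by case=> e1 e2; case/negP: nfi; rewrite /fixes e1 e2 !eqxx.
  have [o1 _ _] : lifts i tau (conj i tau).
    by apply: lift_conj => //; ev_lia_with ij.
  have [o2 _ st2] : lifts j (conj i tau) (conj j (conj i tau)).
    by apply: lift_conj => //; ev_lia_with ij.
  have [o3 _ st3] : lifts i (conj j (conj i tau)) (simple i * conj j (conj i tau))%g.
    by apply: lift_dash => //; ev_lia_with ij.
  have [o1' _ _] : lifts j tau (simple j * tau)%g by apply: lift_dash => //; rewrite -ij.
  have [o2' _ st2'] : lifts i (simple j * tau)%g (conj i (simple j * tau)%g).
    by apply: lift_conj => //; ev_lia_with ij.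
  have [o3' _ st3'] : lifts j (conj i (simple j * tau)%g) (conj j (conj i (simple j * tau)%g)).
    by apply: lift_conj => //; ev_lia_with ij.
  have [F hF] := attached_exists D top o3.
  have same : conj j (conj i (simple j * tau)%g) = (simple i * conj j (conj i tau))%g.
    by rewrite /conj !mulgA sts.
  have -> : f = D j (D i F) by apply: ui hf _; rewrite upi; exact/st2/st3.
  have -> : g = D i (D j F) by apply: uj hg _; rewrite upj; apply/st2'/st3'; rewrite same.
  by apply: opB; left.
have upi := conj_up nfi; have upj := conj_up nfj.
have ni : ~ (ev tau i = i /\ ev tau i.+1 = i.+1).
  by case=> e1 e2; case/negP: nfi; rewrite /fixes e1 e2 !eqxx.
have nj : ~ (ev tau j = j /\ ev tau j.+1 = j.+1).
  by case=> e1 e2; case/negP: nfj; rewrite /fixes e1 e2 !eqxx.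
rewrite ec ed in ni; rewrite -ij ed ee in nj.
have c1 : c <> i.+1 by clear - l1 ai; lia.
have c2 : c <> i.+2 by clear - l2 ai a2; lia.
have d1 : d <> i by clear - l4 ai; lia.
have d2 : d <> i.+2 by clear - l3 a2; lia.
have e1 : e <> i by clear - l5 ai a2; lia.
have e2 : e <> i.+1 by clear - l6 a2; lia.
clear l1 l2 l3 l4 l5 l6 link aj.
have [o1 _ _] : lifts i tau (conj i tau) by apply: lift_conj => //; ev_lia_with ij.
have [o2 _ st2] : lifts j (conj i tau) (conj j (conj i tau)).
  by apply: lift_conj => //; ev_lia_with ij.
have [o3 _ st3] : lifts i (conj j (conj i tau)) (conj i (conj j (conj i tau))).
  by apply: lift_conj => //; ev_lia_with ij.
have [o1' _ _] : lifts j tau (conj j tau) by apply: lift_conj => //; ev_lia_with ij.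
have [o2' _ st2'] : lifts i (conj j tau) (conj i (conj j tau)).
  by apply: lift_conj => //; ev_lia_with ij.
have [o3' _ st3'] : lifts j (conj i (conj j tau)) (conj j (conj i (conj j tau))).
  by apply: lift_conj => //; ev_lia_with ij.
have [F hF] := attached_exists D top o3.
have same : conj j (conj i (conj j tau)) = conj i (conj j (conj i tau)).
  have stsr x : (x * simple i * simple j * simple i = x * simple j * simple i * simple j)%g.
    by rewrite -!mulgA [(simple i * _)%g]mulgA sts !mulgA.
  by rewrite /conj !mulgA sts stsr.
have -> : f = D j (D i F) by apply: ui hf _; rewrite upi; exact/st2/st3.
have -> : g = D i (D j F) by apply: uj hg _; rewrite upj; apply/st2'/st3'; rewrite same.
by apply: opB; left.
Qed.

End PathIndependence.

(** * Relations carried along the weak order *)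

(** The four relations hold everywhere because they hold at [w0]. For [tau]
    other than [w0], take an ascent [k]. If [k] is far from the positions
    that the relation mentions, the step [k] commutes with it. Otherwise [k]
    is just before or just after a block of these positions, and a few steps
    towards [w0] move the neighbouring value past the block, to an element
    where the relation is known for the shifted block; the words above bring
    it back. *)
Section Transport.
Variables (m : nat) (dashes : bool) (T : Type).
Variables (D : 'I_m.-1 -> T -> T) (zero top : T).
Hypothesis opC : forall (i j : 'I_m.-1) f, (i.+1 < j)%N \/ (j.+1 < i)%N -> D i (D j f) = D j (D i f).
Hypothesis opB : forall (i j : 'I_m.-1) f, i.+1 = j :> nat \/ j.+1 = i :> nat ->
  D i (D j (D i f)) = D j (D i (D j f)).
Hypothesis op0 : forall i, D i zero = zero.
Implicit Types (i j k p q r : 'I_m.-1) (w pi tau : 'S_m) (f g : T).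
Local Notation inv := Defs.inv.
Local Notation orbit := (@orbit_index m dashes).
Local Notation attached := (@attached m dashes T D top).
Local Notation lifts := (@lifts m dashes T D top).
Local Notation unique_at := (@unique_at m dashes T D top).
Local Notation crossing_at := (@crossing_at m dashes T D top).
Local Notation hook_at := (@hook_at m dashes T D top).
Local Notation nest_at := (@nest_at m dashes T D top).
Local Notation swap_at := (@swap_at m dashes T D zero top).

Definition above tau (Q : 'S_m -> Prop) :=
  forall rho, orbit rho -> (#|inv tau| < #|inv rho|)%N -> Q rho.

Lemma other_value tau x v y : orbit tau -> ev tau v = y -> y <> x -> ev tau x <> v.
Proof. by case=> h _ e ne e'; apply: ne; rewrite -e -e' h. Qed.

Lemma lift_trans k i tau sigma rho : lifts k tau sigma -> lifts i sigma rho ->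
  (#|inv tau| < #|inv rho|)%N /\ forall f, attached rho f -> attached tau (D k (D i f)).
Proof.
by case=> _ lt1 s1 [_ lt2 s2]; split=> [|f hf]; [exact: ltn_trans lt2 | exact/s1/s2].
Qed.

(** There are two blocks, [i, i+1] and [j, j+1], hence four places where [k]
    can be adjacent. *)
Lemma crossing_transport tau : orbit tau -> tau != w0 m -> unique_at tau ->
  above tau crossing_at -> crossing_at tau.
Proof.
move=> ht ne U IH i j f hf ij e1 e2.
have [h1 _] := ht.
have e3 : ev tau j = i.+1 by rewrite -e2 h1.
have e4 : ev tau j.+1 = i by rewrite -e1 h1.
have [k ak] := ascent_existsE ne.
have nki : (k : nat) <> i by move=> e; rewrite e e1 e2 in ak; lia.
have nkj : (k : nat) <> j by move=> e; rewrite e e3 e4 in ak; lia.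
have [eki|/eqP nk1] := eqVneq k.+1 i.
  have [a ea] : exists a, ev tau k = a by eexists.
  rewrite ea eki e1 in ak.
  have na : a <> j by rewrite -ea; apply: other_value e3 _ => //; lia.
  have l1 : lifts k tau (conj k tau) by apply: lift_conj => //; ev_lia_with eki.
  have [o1 _ _] := l1.
  have l2 : lifts i (conj k tau) (conj i (conj k tau)).
    by apply: lift_conj => //; ev_lia_with eki.
  have [o2 _ _] := l2; have [lt st] := lift_trans l1 l2.
  have [F hF] := attached_exists D top o2.
  have -> : f = D k (D i F) by apply: U hf _; exact: st.
  have cross : D k F = D j F by apply: (IH _ o2 lt) => //; ev_lia_with eki.
  apply: (@crossing_word _ (D k) (D i) (D j)) cross => x.
  - by apply: opB; lia.
  - by apply: opC; lia.
  by apply: opC; lia.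
have [eki|/eqP nk2] := eqVneq (k : nat) i.+1.
  have [b eb] : exists b, ev tau k.+1 = b by eexists.
  rewrite eb eki e2 in ak.
  have nb : b <> j.+1 by rewrite -eb; apply: other_value e4 _ => //; lia.
  have lj : (i.+2 < j)%N.
    suff : j <> i.+2 :> nat by lia.
    by move=> e; rewrite eki -e e3 in eb; lia.
  have l1 : lifts k tau (conj k tau) by apply: lift_conj => //; ev_lia.
  have [o1 _ _] := l1.
  have l2 : lifts i (conj k tau) (conj i (conj k tau)).
    by apply: lift_conj => //; ev_lia.
  have [o2 _ _] := l2; have [lt st] := lift_trans l1 l2.
  have [F hF] := attached_exists D top o2.
  have -> : f = D k (D i F) by apply: U hf _; exact: st.
  have cross : D k F = D j F by apply: (IH _ o2 lt) => //; ev_lia.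
  apply: (@crossing_word _ (D k) (D i) (D j)) cross => x.
  - by apply: opB; lia.
  - by apply: opC; lia.
  by apply: opC; lia.
have [ekj|/eqP nk3] := eqVneq k.+1 j.
  have [a ea] : exists a, ev tau k = a by eexists.
  rewrite ea ekj e3 in ak.
  have na : a <> i by rewrite -ea; apply: other_value e1 _ => //; lia.
  have lk : (i.+1 < k)%N.
    suff : k <> i.+1 :> nat by lia.
    by move=> e; rewrite e e2 in ea; lia.
  have l1 : lifts k tau (conj k tau) by apply: lift_conj => //; ev_lia_with ekj.
  have [o1 _ _] := l1.
  have l2 : lifts j (conj k tau) (conj j (conj k tau)).
    by apply: lift_conj => //; ev_lia_with ekj.
  have [o2 _ _] := l2; have [lt st] := lift_trans l1 l2.
  have [F hF] := attached_exists D top o2.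
  have -> : f = D k (D j F) by apply: U hf _; exact: st.
  have cross : D k F = D i F.
    by apply/esym; apply: (IH _ o2 lt) => //; ev_lia_with ekj.
  apply/esym; apply: (@crossing_word _ (D k) (D j) (D i)) cross => x.
  - by apply: opB; lia.
  - by apply: opC; lia.
  by apply: opC; lia.
have [ekj|/eqP nk4] := eqVneq (k : nat) j.+1.
  have [b eb] : exists b, ev tau k.+1 = b by eexists.
  rewrite eb ekj e4 in ak.
  have nb : b <> i.+1 by rewrite -eb; apply: other_value e2 _ => //; lia.
  have nb' : b <> j by rewrite -eb; apply: other_value e3 _ => //; lia.
  have nb'' : b <> k by rewrite -eb ekj; apply: other_value e4 _ => //; lia.
  have l1 : lifts k tau (conj k tau) by apply: lift_conj => //; ev_lia.
  have [o1 _ _] := l1.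
  have l2 : lifts j (conj k tau) (conj j (conj k tau)).
    by apply: lift_conj => //; ev_lia.
  have [o2 _ _] := l2; have [lt st] := lift_trans l1 l2.
  have [F hF] := attached_exists D top o2.
  have -> : f = D k (D j F) by apply: U hf _; exact: st.
  have cross : D k F = D i F by apply/esym; apply: (IH _ o2 lt) => //; ev_lia.
  apply/esym; apply: (@crossing_word _ (D k) (D j) (D i)) cross => x.
  - by apply: opB; lia.
  - by apply: opC; lia.
  by apply: opC; lia.
have [o1 lt st] := lift_up D top ht ak.
have [F hF] := attached_exists D top o1.
have -> : f = D k F by apply: U hf _; exact: st.
have -> : D i (D k F) = D k (D i F) by apply: opC; lia.
have -> : D j (D k F) = D k (D j F) by apply: opC; lia.
congr (D k _); apply: (IH _ o1 lt) => //; rewrite (ev_up_far ht) ?e1 ?e2 ?sw_far; lia.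
Qed.

(** If the value next to the block is a fixed point, it cannot be moved past
    the block by solid steps; the block grows to a reversed block of four,
    where [nest_at] is used. *)
Lemma hook_transport tau : orbit tau -> tau != w0 m -> unique_at tau ->
  above tau (fun rho => [/\ crossing_at rho, hook_at rho & nest_at rho]) -> hook_at tau.
Proof.
move=> ht ne U IH i j f hf ij; rewrite -ij => e1 e2.
have [h1 h2] := ht.
have e3 : ev tau i.+2 = i by rewrite -e1 h1.
have jm := ltn_ord j.
have hd : dashes by case: h2 => // h2; case: (h2 i.+1) => //; lia.
have [k ak] := ascent_existsE ne.
have nki : (k : nat) <> i by move=> e; rewrite e e1 e2 in ak; lia.
have nkj : (k : nat) <> i.+1 by move=> e; rewrite e e3 e2 in ak; lia.
have [eki|/eqP nk1] := eqVneq k.+1 i.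
  have [a ea] : exists a, ev tau k = a by eexists.
  have ni : a <> i by rewrite -ea; apply: other_value e1 _ => //; lia.
  have nj : a <> i.+1 by rewrite -ea; apply: other_value e2 _ => //; lia.
  rewrite ea eki e1 in ak.
  have l1 : lifts k tau (conj k tau) by apply: lift_conj => //; ev_lia_with eki.
  have [o1 _ _] := l1.
  have [eak|/eqP nak] := eqVneq a k.
    have l2 : lifts i (conj k tau) (simple i * conj k tau)%g.
      by apply: lift_dash => //; ev_lia_with eki.
    have [o2 _ _] := l2; have [lt st] := lift_trans l1 l2.
    have [F hF] := attached_exists D top o2.
    have -> : f = D k (D i F) by apply: U hf _; exact: st.
    have [cross _ nest] := IH _ o2 lt.
    have {}cross : D k F = D j F by apply: cross => //; rewrite -ij; ev_lia_with eki.
    have {}nest : D i (D k (D j (D i F))) = D k (D i (D j (D i F))).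
      by apply: nest => //; rewrite -?ij; ev_lia_with eki.
    apply: (@hook_word_fixed _ (D k) (D i) (D j)) => // x.
    - by apply: opC; lia.
    - by apply: opB; lia.
    by apply: opB; lia.
  have l2 : lifts i (conj k tau) (conj i (conj k tau)).
    by apply: lift_conj => //; ev_lia_with eki.
  have [o2 _ _] := l2; have [lt st] := lift_trans l1 l2.
  have [o3 lt3 st3] : lifts j (conj i (conj k tau)) (conj j (conj i (conj k tau))).
    by apply: lift_conj => //; rewrite -?ij; ev_lia_with eki.
  have [F hF] := attached_exists D top o3.
  have -> : f = D k (D i (D j F)) by apply: U hf _; exact/st/st3.
  have [_ hook _] := IH _ o3 (ltn_trans lt lt3).
  have {}hook : D k (D i F) = D i (D k F).
    by apply: hook => //; rewrite ?(ev_conj, ev_left) -?ij; ev_lia_with eki.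
  apply: (@hook_word _ (D k) (D i) (D j)) => // x.
  - by apply: opC; lia.
  - by apply: opB; lia.
  by apply: opB; lia.
have [eki|/eqP nk2] := eqVneq (k : nat) i.+2.
  have [b eb] : exists b, ev tau k.+1 = b by eexists.
  rewrite eki in eb.
  have nj : b <> i.+1 by rewrite -eb; apply: other_value e2 _ => //; lia.
  have nk : b <> i.+2 by rewrite -eb; apply: other_value e3 _ => //; lia.
  rewrite eki eb e3 in ak.
  have l1 : lifts k tau (conj k tau).
    by apply: lift_conj => //; rewrite ?(ev_conj, ev_left) eki; ev_lia.
  have [o1 _ _] := l1.
  have [ebk|/eqP nbk] := eqVneq b i.+3.
    have l2 : lifts j (conj k tau) (simple j * conj k tau)%g.
      by apply: lift_dash => //; rewrite ?(ev_conj, ev_left) eki; ev_lia_with ij.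
    have [o2 _ _] := l2; have [lt st] := lift_trans l1 l2.
    have [F hF] := attached_exists D top o2.
    have -> : f = D k (D j F) by apply: U hf _; exact: st.
    have [_ _ nest] := IH _ o2 lt.
    apply/esym; apply: nest => //; try lia;
      by rewrite ?(ev_conj, ev_left) eki; ev_lia_with ij.
  have l2 : lifts j (conj k tau) (conj j (conj k tau)).
    by apply: lift_conj => //; rewrite ?(ev_conj, ev_left) eki; ev_lia_with ij.
  have [o2 _ _] := l2; have [lt st] := lift_trans l1 l2.
  have [o3 lt3 st3] : lifts i (conj j (conj k tau)) (conj i (conj j (conj k tau))).
    by apply: lift_conj => //; rewrite ?(ev_conj, ev_left) eki; ev_lia_with ij.
  have [F hF] := attached_exists D top o3.
  have -> : f = D k (D j (D i F)) by apply: U hf _; exact/st/st3.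
  have [_ hook _] := IH _ o3 (ltn_trans lt lt3).
  have {}hook : D j (D k F) = D k (D j F).
    by apply: hook => //; try lia; rewrite ?(ev_conj, ev_left) eki; ev_lia_with ij.
  apply/esym; apply: (@hook_word _ (D k) (D j) (D i)) => // x.
  - by apply: opC; lia.
  - by apply: opB; lia.
  by apply: opB; lia.
have [o1 lt st] := lift_up D top ht ak.
have [F hF] := attached_exists D top o1.
have -> : f = D k F by apply: U hf _; exact: st.
have Dik x : D i (D k x) = D k (D i x) by apply: opC; lia.
have Djk x : D j (D k x) = D k (D j x) by apply: opC; lia.
have [_ hook _] := IH _ o1 lt.
rewrite Djk !Dik Djk; congr (D k _); apply: hook => //;
  by rewrite -?ij (ev_up_far ht) ?e1 ?e2 ?sw_far; lia.
Qed.

Lemma swap_transport tau : orbit tau -> tau != w0 m -> unique_at tau ->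
  above tau swap_at -> swap_at tau.
Proof.
move=> ht ne U IH nd i f hf e1.
have [h1 [hd|h2]] := ht; first by rewrite hd in nd.
have e2 : ev tau i.+1 = i by rewrite -e1 h1.
have [k ak] := ascent_existsE ne; have km := ltn_ord k.
have nki : (k : nat) <> i by move=> e; rewrite e e1 e2 in ak; lia.
have [eki|/eqP nk1] := eqVneq k.+1 i.
  have [a ea] : exists a, ev tau k = a by eexists.
  have ni : a <> i by rewrite -ea; apply: other_value e1 _ => //; lia.
  have nk : a <> k by rewrite -ea; apply: h2; lia.
  rewrite ea eki e1 in ak.
  have l1 : lifts k tau (conj k tau) by apply: lift_conj => //; ev_lia_with eki.
  have [o1 _ _] := l1.
  have l2 : lifts i (conj k tau) (conj i (conj k tau)).
    by apply: lift_conj => //; ev_lia_with eki.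
  have [o2 _ _] := l2; have [lt st] := lift_trans l1 l2.
  have [F hF] := attached_exists D top o2.
  have -> : f = D k (D i F) by apply: U hf _; exact: st.
  have DF : D k F = zero by apply: (IH _ o2 lt) => //; ev_lia_with eki.
  by rewrite (opB _ (or_intror eki)) DF !op0.
have [eki|/eqP nk2] := eqVneq (k : nat) i.+1.
  have [b eb] : exists b, ev tau k.+1 = b by eexists.
  rewrite eki in eb.
  have ni : b <> i.+1 by rewrite -eb; apply: other_value e2 _ => //; lia.
  have nk : b <> i.+2 by rewrite -eb; apply: h2; lia.
  rewrite eki eb e2 in ak.
  have l1 : lifts k tau (conj k tau).
    by apply: lift_conj => //; rewrite ?(ev_conj, ev_left) eki; ev_lia.
  have [o1 _ _] := l1.
  have l2 : lifts i (conj k tau) (conj i (conj k tau)).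
    by apply: lift_conj => //; rewrite ?(ev_conj, ev_left) eki; ev_lia.
  have [o2 _ _] := l2; have [lt st] := lift_trans l1 l2.
  have [F hF] := attached_exists D top o2.
  have -> : f = D k (D i F) by apply: U hf _; exact: st.
  have DF : D k F = zero.
    by apply: (IH _ o2 lt) => //; rewrite ?(ev_conj, ev_left) eki; ev_lia.
  by rewrite (opB _ (or_introl (esym eki))) DF !op0.
have [o1 lt st] := lift_up D top ht ak.
have [F hF] := attached_exists D top o1.
have -> : f = D k F by apply: U hf _; exact: st.
have -> : D i (D k F) = D k (D i F) by apply: opC; lia.
have -> : D i F = zero; last exact: op0.
by apply: (IH _ o1 lt) => //; rewrite (ev_up_far ht) ?e1 ?sw_far; lia.
Qed.

(** If the value next to the block is a fixed point, the block grows to a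
    reversed block of five, where [crossing_at] applies to its two arcs and
    [hook_at] to the inner one. The block being symmetric, [flip_word]
    reduces an ascent on the right to one on the left. *)
Lemma nest_transport tau : orbit tau -> tau != w0 m -> unique_at tau ->
  crossing_at tau ->
  above tau (fun rho => [/\ crossing_at rho, hook_at rho & nest_at rho]) -> nest_at tau.
Proof.
move=> ht ne U cross_tau IH hd p q r f hf pq qr.
have pr : r = p.+2 :> nat by lia.
rewrite pr => e1; rewrite -pq => e2.
have [h1 h2] := ht.
have e3 : ev tau p.+2 = p.+1 by rewrite -e2 h1.
have e4 : ev tau p.+3 = p by rewrite -e1 h1.
have [k ak] := ascent_existsE ne.
have nkp : (k : nat) <> p by move=> e; rewrite e e1 e2 in ak; lia.
have nkq : (k : nat) <> p.+1 by move=> e; rewrite e e3 e2 in ak; lia.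
have nkr : (k : nat) <> p.+2 by move=> e; rewrite e e3 e4 in ak; lia.
have prC x : D p (D r x) = D r (D p x) by apply: opC; lia.
have pqB x : D p (D q (D p x)) = D q (D p (D q x)) by apply: opB; lia.
have qrB x : D q (D r (D q x)) = D r (D q (D r x)) by apply: opB; lia.
have flip : D p (D q (D r (D q f))) = D r (D q (D p (D q f))).
  by apply: (@flip_word _ (D p) (D q) (D r)) => //; apply: cross_tau => //; rewrite ?pr -?pq //; lia.
have [eki|/eqP nk1] := eqVneq k.+1 p.
  have [a ea] : exists a, ev tau k = a by eexists.
  have n1 : a <> p by rewrite -ea; apply: other_value e1 _ => //; lia.
  have n2 : a <> p.+1 by rewrite -ea; apply: other_value e2 _ => //; lia.
  have n3 : a <> p.+2 by rewrite -ea; apply: other_value e3 _ => //; lia.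
  rewrite ea eki e1 in ak.
  have kqC x : D k (D q x) = D q (D k x) by apply: opC; lia.
  have krC x : D k (D r x) = D r (D k x) by apply: opC; lia.
  have kpB x : D k (D p (D k x)) = D p (D k (D p x)) by apply: opB; lia.
  have l1 : lifts k tau (conj k tau) by apply: lift_conj => //; ev_lia_with eki.
  have [o1 _ _] := l1.
  have l2 : lifts p (conj k tau) (conj p (conj k tau)).
    by apply: lift_conj => //; ev_lia_with eki.
  have [o2 _ _] := l2; have [lt st] := lift_trans l1 l2.
  have [eak|/eqP nak] := eqVneq a k.
    have [F hF] := attached_exists D top o2.
    have fE : f = D k (D p F) by apply: U hf _; exact: st.
    have [cross hook _] := IH _ o2 lt.
    have {}cross : D k F = D r F.
      by apply: cross => //; [lia | |]; rewrite ?(ev_conj, ev_left) pr; ev_lia_with eki.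
    have {}hook : D p (D q F) = D q (D p F).
      by apply: hook => //; rewrite ?(ev_conj, ev_left) -pq; ev_lia_with eki.
    by rewrite flip fE; apply: (@nest_word_fixed _ (D k) (D p) (D q) (D r)).
  have l3 : lifts q (conj p (conj k tau)) (conj q (conj p (conj k tau))).
    by apply: lift_conj => //; rewrite ?(ev_conj, ev_left) -pq; ev_lia_with eki.
  have [o3 _ _] := l3.
  have l4 : lifts r (conj q (conj p (conj k tau))) (conj r (conj q (conj p (conj k tau)))).
    by apply: lift_conj => //; rewrite ?(ev_conj, ev_left) pr -pq; ev_lia_with eki.
  have [o4 _ _] := l4; have [lt' st'] := lift_trans l3 l4.
  have [F hF] := attached_exists D top o4.
  have fE : f = D k (D p (D q (D r F))) by apply: U hf _; exact/st/st'.
  have [_ _ nest] := IH _ o4 (ltn_trans lt lt').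
  have {}nest : D p (D k (D q (D p F))) = D k (D p (D q (D p F))).
    by apply: nest => //; rewrite ?(ev_conj, ev_left) pr -pq; ev_lia_with eki.
  by rewrite fE; apply: (@nest_word _ (D k) (D p) (D q) (D r)).
have [eki|/eqP nk2] := eqVneq (k : nat) p.+3.
  have [b eb] : exists b, ev tau k.+1 = b by eexists.
  rewrite eki in eb.
  have n1 : b <> p.+1 by rewrite -eb; apply: other_value e2 _ => //; lia.
  have n2 : b <> p.+2 by rewrite -eb; apply: other_value e3 _ => //; lia.
  have n3 : b <> p.+3 by rewrite -eb; apply: other_value e4 _ => //; lia.
  rewrite eki eb e4 in ak.
  have kqC x : D k (D q x) = D q (D k x) by apply: opC; lia.
  have kpC x : D k (D p x) = D p (D k x) by apply: opC; lia.
  have krB x : D k (D r (D k x)) = D r (D k (D r x)) by apply: opB; lia.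
  have l1 : lifts k tau (conj k tau).
    by apply: lift_conj => //; rewrite ?(ev_conj, ev_left) eki; ev_lia.
  have [o1 _ _] := l1.
  have l2 : lifts r (conj k tau) (conj r (conj k tau)).
    by apply: lift_conj => //; rewrite ?(ev_conj, ev_left) eki pr; ev_lia.
  have [o2 _ _] := l2; have [lt st] := lift_trans l1 l2.
  have [ebk|/eqP nbk] := eqVneq b p.+4.
    have [F hF] := attached_exists D top o2.
    have fE : f = D k (D r F) by apply: U hf _; exact: st.
    have [cross hook _] := IH _ o2 lt.
    have {}cross : D k F = D p F.
      by apply/esym; apply: cross => //; [lia | |]; rewrite ?(ev_conj, ev_left) eki pr; ev_lia.
    have {}hook : D r (D q F) = D q (D r F).
      by apply/esym; apply: hook => //; rewrite ?(ev_conj, ev_left) eki pr -?pq; ev_lia.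
    by rewrite prC fE; apply: (@nest_word_fixed _ (D k) (D r) (D q) (D p)).
  have l3 : lifts q (conj r (conj k tau)) (conj q (conj r (conj k tau))).
    by apply: lift_conj => //; rewrite ?(ev_conj, ev_left) eki pr -pq; ev_lia.
  have [o3 _ _] := l3.
  have l4 : lifts p (conj q (conj r (conj k tau))) (conj p (conj q (conj r (conj k tau)))).
    by apply: lift_conj => //; rewrite ?(ev_conj, ev_left) eki pr -pq; ev_lia.
  have [o4 _ _] := l4; have [lt' st'] := lift_trans l3 l4.
  have [F hF] := attached_exists D top o4.
  have fE : f = D k (D r (D q (D p F))) by apply: U hf _; exact/st/st'.
  have [cross _ nest] := IH _ o4 (ltn_trans lt lt').
  have {}cross : D q F = D k F.
    by apply: cross => //; [lia | |]; rewrite ?(ev_conj, ev_left) eki pr -pq; ev_lia.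
  have {}nest : D r (D q (D k (D r F))) = D q (D r (D k (D r F))).
    by apply: nest => //; [lia | |]; rewrite ?(ev_conj, ev_left) eki pr -pq; ev_lia.
  rewrite flip fE prC; apply: (@nest_word _ (D k) (D r) (D q) (D p)) => //.
  by rewrite kqC nest; apply: (@flip_word _ (D q) (D r) (D k)).
have [o1 lt st] := lift_up D top ht ak.
have [F hF] := attached_exists D top o1.
have -> : f = D k F by apply: U hf _; exact: st.
have kpC x : D p (D k x) = D k (D p x) by apply: opC; lia.
have kqC x : D q (D k x) = D k (D q x) by apply: opC; lia.
have krC x : D r (D k x) = D k (D r x) by apply: opC; lia.
have [_ _ nest] := IH _ o1 lt.
rewrite !(kpC, kqC, krC); congr (D k _); apply: nest => //;
  by rewrite ?pr -?pq (ev_up_far ht) ?e1 ?e2 ?sw_far; lia.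
Qed.

Hypothesis crossing_top : crossing_at (w0 m).
Hypothesis hook_top : hook_at (w0 m).
Hypothesis nest_top : nest_at (w0 m).
Hypothesis swap_top : swap_at (w0 m).

(** The simultaneous induction from [w0] downwards: uniqueness at [tau] uses
    the relations at elements above it, and the relations at [tau] use
    uniqueness at [tau]. *)
Lemma attached_relations tau : orbit tau ->
  unique_at tau /\ [/\ crossing_at tau, hook_at tau, nest_at tau & swap_at tau].
Proof.
elim/orbit_ind => {}tau ht IH.
have U : unique_at tau.
  move=> f g hf hg.
  have [e|ne] := eqVneq tau (w0 m).
    by rewrite e in hf hg; rewrite (attached_w0 hf) (attached_w0 hg).
  have [[/eqP e]|[i [f1 [_ ai hf1 ->]]]] := attached_inv hf; first by rewrite e in ne.
  have [[/eqP e]|[j [g1 [_ aj hg1 ->]]]] := attached_inv hg; first by rewrite e in ne.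
  have [lt|] := ltnP i.+1 j.
    apply: (unique_far opC ht _ ai aj lt hf1 hg1) => rho o l.
    by have [? []] := IH _ o l.
  rewrite leq_eqVlt => /orP[/eqP e|ji].
    apply: (unique_adjacent opB ht _ ai aj (esym e) hf1 hg1) => rho o l.
    by have [? []] := IH _ o l.
  have [lt|] := ltnP j.+1 i.
    apply/esym/(unique_far opC ht _ aj ai lt hg1 hf1) => rho o l.
    by have [? []] := IH _ o l.
  rewrite leq_eqVlt => /orP[/eqP e|ij].
    apply/esym/(unique_adjacent opB ht _ aj ai (esym e) hg1 hf1) => rho o l.
    by have [? []] := IH _ o l.
  have e : i = j by apply: val_inj; rewrite /=; lia.
  rewrite -e in hg1 *; congr (D i _).
  by have [u _] := IH _ (orbit_up i ht) (inv_up ht ai); exact: u.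
split=> //.
have [->|ne] := eqVneq tau (w0 m); first by split.
have cross : crossing_at tau.
  by apply: crossing_transport => // rho o l; have [_ []] := IH _ o l.
have IH3 : above tau (fun rho => [/\ crossing_at rho, hook_at rho & nest_at rho]).
  by move=> rho o l; have [_ []] := IH _ o l.
split=> //; [exact: hook_transport | exact: nest_transport |].
by apply: swap_transport => // rho o l; have [_ []] := IH _ o l.
Qed.

Hypothesis opK : forall i f, D i (D i f) = zero.

(** By path independence the polynomial can be computed along a path ending
    with the edge labelled [i], and [D i] has square zero. *)
Lemma attached_ascent tau i f : orbit tau -> attached tau f ->
  (ev tau i < ev tau i.+1)%N -> D i f = zero.
Proof.
move=> ht hf ai; have [o1 _ st] := lift_up D top ht ai.
have [F hF] := attached_exists D top o1.
have [U _] := attached_relations ht.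
by rewrite (U f (D i F) hf (st F hF)) opK.
Qed.

End Transport.

(** * The polynomial of the longest element *)

Section TopPolynomial.
Variables (m : nat) (dashes : bool).
Implicit Types (i j k : 'I_m.-1) (s : 'S_m).
Local Notation P := {mpoly rat[m]}.
Local Notation x_ k := ('X_k : P).
Local Notation pair := ('I_m * 'I_m)%type.

Definition top_pairs : {set pair} :=
  [set p : pair | (if dashes then p.1 <= p.2 else p.1 < p.2)%N &&
                  (p.1 + p.2 + 2 <= m)%N].

Definition pair_sum (p : pair) : P := x_ p.1 + x_ p.2.

Definition top_poly : P := \prod_(p in top_pairs) pair_sum p.

(** A factor [x_a + x_b] belongs to an unordered pair, represented by its
    sorted form. *)
Definition sort_pair (p : pair) : pair := if (p.1 <= p.2)%N then p else (p.2, p.1).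

Lemma pair_sum_sort p : pair_sum (sort_pair p) = pair_sum p.
Proof. by rewrite /sort_pair; case: ifP => // _; rewrite /pair_sum addrC. Qed.

Definition move_pair s (p : pair) := sort_pair (s p.1, s p.2).

Lemma move_pair_inj s (A : {set pair}) : {in A, forall p : pair, (p.1 <= p.2)%N} ->
  {in A &, injective (move_pair s)}.
Proof.
move=> sorted [a b] [c d] /sorted /= ab /sorted /= cd.
rewrite /move_pair /sort_pair /=; do 2!case: ifP => _; case=> /perm_inj e1 /perm_inj e2;
  rewrite ?e1 ?e2 //; congr (_, _); apply: val_inj => /=; move: ab cd; rewrite e1 e2; lia.
Qed.

(** The permutation permutes the factors. *)
Lemma msym_prod_pairs s (A : {set pair}) : {in A, forall p : pair, (p.1 <= p.2)%N} ->
  {in A, forall p, move_pair s p \in A} ->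
  msym s (\prod_(p in A) pair_sum p) = \prod_(p in A) pair_sum p.
Proof.
move=> sorted stable.
have im : move_pair s @: A = A.
  apply/eqP; rewrite eqEcard card_in_imset ?leqnn ?andbT; last exact: move_pair_inj.
  by apply/subsetP=> q /imsetP[p pA ->]; exact: stable.
rewrite -{2}im big_imset /=; last exact: move_pair_inj.
rewrite rmorph_prod /=; apply: eq_bigr => p _.
by rewrite pair_sum_sort /pair_sum msymD !msym_mpolyXU.
Qed.

Lemma simple_sw i (x : 'I_m) : simple i x = sw i x :> nat.
Proof. by rewrite -ev_ord ev_simple. Qed.

(** The family is described by a predicate on numbers, so that its
    invariance becomes linear arithmetic. *)
Lemma msym_prod_pairs_simple i (A : {set pair}) (Q : nat -> nat -> bool) :
    (forall p : pair, (p \in A) = Q p.1 p.2) ->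
    (forall a b, Q a b -> (a <= b)%N) ->
    (forall a b, Q a b -> Q (minn (sw i a) (sw i b)) (maxn (sw i a) (sw i b))) ->
  msym (simple i) (\prod_(p in A) pair_sum p) = \prod_(p in A) pair_sum p.
Proof.
move=> memA sorted stable; apply: msym_prod_pairs => p; rewrite !memA; first exact: sorted.
move/stable; rewrite /move_pair /sort_pair /= !simple_sw /minn /maxn.
by case: ltngtP => /= h; rewrite !simple_sw ?h.
Qed.

Lemma ddiff_lo i : ddiff i (x_ (lo i)) = 1.
Proof. by apply: ddiff_unique; rewrite mulr1 msym_mpolyXU simple_lo. Qed.

Lemma ddiff_lo_add i f : msym (simple i) f = f -> ddiff i (x_ (lo i) + f) = 1.
Proof. by move=> sf; rewrite ddiffD ddiff_lo ddiff_symmetric // addr0. Qed.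

Lemma msym_far i (x : 'I_m) : x <> i :> nat -> x <> i.+1 :> nat ->
  msym (simple i) (x_ x) = x_ x.
Proof. by move=> h1 h2; rewrite msym_mpolyXU simple_far //; apply/eqP. Qed.

Definition is_top a b := (if dashes then a <= b else a < b)%N && (a + b + 2 <= m)%N.

Lemma in_top_pairs p : (p \in top_pairs) = is_top p.1 p.2.
Proof. by rewrite inE. Qed.

Lemma is_top_sorted a b : is_top a b -> (a <= b)%N.
Proof. by rewrite /is_top; case: (dashes); lia. Qed.

Lemma eq_pair_nat (p : pair) (x y : 'I_m) : (p == (x, y)) = (p.1 == x :> nat) && (p.2 == y :> nat).
Proof. by case: p => a b; rewrite xpair_eqE -!val_eqE. Qed.

(** All factors except the one for the pair [(i, j)] are permuted among
    themselves by both transpositions. *)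
Lemma top_crossing i j : (i.+1 < j)%N -> (m = i + j + 2)%N ->
  ddiff i top_poly = ddiff j top_poly.
Proof.
move=> ij em.
have pT : (lo i, lo j) \in top_pairs.
  by rewrite in_top_pairs /is_top /=; case: (dashes); lia.
have e : top_poly = \prod_(p in top_pairs :\ (lo i, lo j)) pair_sum p * (x_ (lo i) + x_ (lo j)).
  by rewrite /top_poly (big_setD1 _ pT) mulrC.
set G := \prod_(p in _ :\ _) _ in e.
pose Q (a b : nat) := ~~ ((a == i) && (b == j)) && is_top a b.
have memQ p : (p \in top_pairs :\ (lo i, lo j)) = Q p.1 p.2.
  by rewrite in_setD1 in_top_pairs eq_pair_nat.
have sorted a b : Q a b -> (a <= b)%N by case/andP=> _; exact: is_top_sorted.
have si : msym (simple i) G = G.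
  apply: msym_prod_pairs_simple memQ sorted _ => a b.
  by rewrite /Q /is_top; case: (dashes); sw_split; lia.
have sj : msym (simple j) G = G.
  apply: msym_prod_pairs_simple memQ sorted _ => a b.
  by rewrite /Q /is_top; case: (dashes); sw_split; lia.
have fj : msym (simple i) (x_ (lo j)) = x_ (lo j) by apply: msym_far => /=; lia.
have fi : msym (simple j) (x_ (lo i)) = x_ (lo i) by apply: msym_far => /=; lia.
rewrite e (ddiffMl _ si) (ddiffMl _ sj) (ddiff_lo_add fj).
by rewrite [X in ddiff j X]addrC (ddiff_lo_add fi).
Qed.

(** The middle transposition permutes the factors. *)
Lemma top_swap i : ~~ dashes -> (m = i + i + 2)%N -> ddiff i top_poly = 0.
Proof.
move=> nd em; apply: ddiff_symmetric.
apply: msym_prod_pairs_simple in_top_pairs is_top_sorted _ => a b.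
by rewrite /is_top (negPf nd); sw_split; lia.
Qed.

(** Two factors involve only the three middle variables, and the product of
    the others is symmetric in these. *)
Lemma top_hook i j : dashes -> i.+1 = j :> nat -> (m = i + i + 3)%N ->
  ddiff i (ddiff j top_poly) = ddiff j (ddiff i top_poly).
Proof.
move=> hd ij em.
have hl : lo j = hi i by apply: val_inj.
pose B := [set (lo i, lo i); (lo i, hi i)].
pose Q (a b : nat) := (a < i)%N && is_top a b.
have memQ p : (p \in top_pairs :\: B) = Q p.1 p.2.
  rewrite in_setD in_top_pairs !inE !eq_pair_nat /Q /is_top hd /=.
  by case: p => a b /=; lia.
have sorted a b : Q a b -> (a <= b)%N by case/andP=> _; exact: is_top_sorted.
set G := \prod_(p in top_pairs :\: B) pair_sum p.
have si : msym (simple i) G = G.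
  apply: msym_prod_pairs_simple memQ sorted _ => a b.
  by rewrite /Q /is_top hd; sw_split; lia.
have sj : msym (simple j) G = G.
  apply: msym_prod_pairs_simple memQ sorted _ => a b.
  by rewrite /Q /is_top hd; sw_split; lia.
pose a := x_ (lo i); pose b := x_ (hi i).
(* The 2 comes from the diagonal factor [a + a]. *)
have e : top_poly = (2%:R * G) * (a * (a + b)).
  have BT : B \subset top_pairs.
    by apply/subsetP=> p; rewrite !inE => /orP[] /eqP->; rewrite /= hd; lia.
  rewrite /top_poly (big_setID B) /= (setIidPr BT) big_setU1 /=; last first.
    by rewrite inE eq_pair_nat /=; lia.
  rewrite big_set1 /pair_sum /= -/a -/b -/G; ring.
have s2 k : msym (simple k) (2%:R * G) = 2%:R * msym (simple k) G.
  by rewrite msymM rmorph_nat.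
have {}si : msym (simple i) (2%:R * G) = 2%:R * G by rewrite s2 si.
have {}sj : msym (simple j) (2%:R * G) = 2%:R * G by rewrite s2 sj.
have ja : msym (simple j) a = a by apply: msym_far => /=; lia.
have Db : ddiff j (a + b) = 1 by rewrite addrC /b -hl; exact: ddiff_lo_add ja.
have sab : msym (simple i) (a + b) = a + b.
  by rewrite msymD !msym_mpolyXU simple_lo simple_hi addrC.
have E1 : ddiff j (a * (a + b)) = a by rewrite (ddiffMl _ ja) Db mulr1.
have E2 : ddiff i (a * (a + b)) = a + b by rewrite mulrC (ddiffMl _ sab) ddiff_lo mulr1.
by rewrite e !(ddiffMl _ si, ddiffMl _ sj) E1 E2 ddiff_lo Db.
Qed.

(** Four factors involve only the four middle variables, and the product of
    the others is symmetric in these. *)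
Lemma top_nest (p q r : 'I_m.-1) : dashes -> p.+1 = q :> nat -> q.+1 = r :> nat -> (m = p + p + 4)%N ->
  ddiff q (ddiff p (ddiff r (ddiff q top_poly))) =
  ddiff p (ddiff q (ddiff r (ddiff q top_poly))).
Proof.
move=> hd pq qr em.
have hq : lo q = hi p by apply: val_inj.
have hr : lo r = hi q by apply: val_inj.
pose B := (lo p, lo p) |: ((lo p, hi p) |: ((lo p, hi q) |: [set (hi p, hi p)])).
pose Q (a b : nat) := (a < p)%N && is_top a b.
have memQ x : (x \in top_pairs :\: B) = Q x.1 x.2.
  rewrite in_setD in_top_pairs !inE !eq_pair_nat /Q /is_top hd /=.
  by case: x => a b /=; lia.
have sorted a b : Q a b -> (a <= b)%N by case/andP=> _; exact: is_top_sorted.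
set G := \prod_(x in top_pairs :\: B) pair_sum x.
have sG k : [\/ k = p, k = q | k = r] -> msym (simple k) G = G.
  move=> kpqr; apply: msym_prod_pairs_simple memQ sorted _ => a b.
  by rewrite /Q /is_top hd; case: kpqr => ->; sw_split; lia.
pose a := x_ (lo p); pose b := x_ (hi p); pose c := x_ (hi q).
(* The 4 comes from the diagonal factors [a + a] and [b + b]. *)
have e : top_poly = (4%:R * G) * (b * (a * (a + b) * (a + c))).
  have BT : B \subset top_pairs.
    by apply/subsetP=> x; rewrite !inE => /or4P[] /eqP->; rewrite /= hd; lia.
  rewrite /top_poly (big_setID B) /= (setIidPr BT) -/G.
  have -> : \prod_(x in B) pair_sum x = (a + a) * (a + b) * (a + c) * (b + b).
    rewrite /B !big_setU1 ?big_set1 /=; try by rewrite !inE !eq_pair_nat /=; lia.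
    by rewrite /pair_sum /= -/a -/b -/c !mulrA.
  ring.
have s4 k : [\/ k = p, k = q | k = r] -> msym (simple k) (4%:R * G) = 4%:R * G.
  by move=> kpqr; rewrite msymM rmorph_nat sG.
have qa : msym (simple q) a = a by apply: msym_far => /=; lia.
have ra : msym (simple r) a = a by apply: msym_far => /=; lia.
have rb : msym (simple r) b = b by apply: msym_far => /=; lia.
have pc : msym (simple p) c = c by apply: msym_far => /=; lia.
have pab : msym (simple p) (a + b) = a + b.
  by rewrite msymD !msym_mpolyXU simple_lo simple_hi addrC.
have qb : msym (simple q) b = c by rewrite /b -hq msym_mpolyXU simple_lo.
have qc : msym (simple q) c = b by rewrite msym_mpolyXU simple_hi hq.
have Dqb : ddiff q (a + b) = 1 by rewrite addrC /b -hq; exact: ddiff_lo_add qa.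
have Drc : ddiff r (a + c) = 1 by rewrite addrC /c -hr; exact: ddiff_lo_add ra.
have E1 : ddiff q (b * (a * (a + b) * (a + c))) = a * (a + b) * (a + c).
  have sf : msym (simple q) (a * (a + b) * (a + c)) = a * (a + b) * (a + c).
    by rewrite !msymM !msymD qa qb qc mulrAC.
  by rewrite mulrC (ddiffMl _ sf) /b -hq ddiff_lo mulr1.
have E2 : ddiff r (a * (a + b) * (a + c)) = a * (a + b).
  have sf : msym (simple r) (a * (a + b)) = a * (a + b) by rewrite msymM msymD ra rb.
  by rewrite (ddiffMl _ sf) Drc mulr1.
have E3 : ddiff p (a * (a + b)) = a + b by rewrite mulrC (ddiffMl _ pab) ddiff_lo mulr1.
have E4 : ddiff q (a * (a + b)) = a by rewrite (ddiffMl _ qa) Dqb mulr1.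
rewrite e (ddiffMl _ (s4 q (Or32 _ _ (erefl _)))) E1.
rewrite !(ddiffMl _ (s4 r (Or33 _ _ (erefl _)))) E2.
rewrite (ddiffMl _ (s4 p (Or31 _ _ (erefl _)))) E3.
rewrite !(ddiffMl _ (s4 q (Or32 _ _ (erefl _)))) E4 Dqb.
by rewrite (ddiffMl _ (s4 p (Or31 _ _ (erefl _)))) ddiff_lo.
Qed.

End TopPolynomial.

Section TopShape.
Variable m : nat.
Local Notation P := {mpoly rat[m]}.
Local Notation pair := ('I_m * 'I_m)%type.
Implicit Types (p : pair) (s : seq pair).
Local Notation inv := Defs.inv.

Lemma upsilonO_topE : upsilonO_w0 m = top_poly m true.
Proof.
rewrite /upsilonO_w0 pair_big_dep /=; apply: eq_big => [[a b]|p _] //.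
by rewrite in_top_pairs /is_top /=; lia.
Qed.

Lemma upsilonSp_topE : upsilonSp_w0 m = top_poly m false.
Proof.
rewrite /upsilonSp_w0 pair_big_dep /=; apply: eq_big => [[a b]|p _] //.
by rewrite in_top_pairs /is_top /=; lia.
Qed.

Lemma homog_prod_pairs s : \prod_(p <- s) pair_sum p \is (size s).-homog.
Proof.
elim: s => [|p s IH]; first by rewrite big_nil dhomog1.
rewrite big_cons /= -add1n dhomogM // /pair_sum.
by apply: dhomogD; rewrite dhomogX /= mdeg1.
Qed.

(** Every factor contributes at most one to the exponent, and only if it
    contains the variable. *)
Lemma exponents_prod_pairs s (k : 'I_m) e :
  e \in msupp (\prod_(p <- s) pair_sum p) ->
  (e k <= count (fun p : pair => (p.1 == k) || (p.2 == k)) s)%N.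
Proof.
elim: s e => [|p s IH] e.
  by rewrite big_nil msupp1 inE => /eqP->; rewrite mnm0E.
rewrite big_cons => /msuppM_le /allpairsP[[e1 e2] /= [h1 /IH h2 ->]].
rewrite mnmDE leq_add //; move: h1 => /msuppD_le.
rewrite mem_cat => /orP[] /mem_msuppXP <-; rewrite mnm1E.
  by case: (p.1 == k).
by case: (p.2 == k); rewrite ?orbT.
Qed.

Lemma card_ltn_ord c : (c <= m)%N -> #|[set x : 'I_m | (x < c)%N]| = c.
Proof.
move=> le; rewrite cardsE -sum1_card.
by rewrite -(big_ord_widen m (fun=> 1%N) le) sum_nat_const card_ord muln1.
Qed.

(** The other entry of such a pair determines it and is less than [m -
    k.+1]. *)
Lemma top_pairs_at dashes (k : 'I_m) :
  (#|[set p in top_pairs m dashes | (p.1 == k) || (p.2 == k)]| <= m - k.+1)%N.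
Proof.
pose other p := if p.1 == k then p.2 else p.1.
rewrite -(card_ltn_ord (leq_subr k.+1 m)).
rewrite -(@card_in_imset _ _ other) => [|[a b] [c d]].
  apply/subset_leq_card/subsetP=> x /imsetP[[a b]]; rewrite !inE -!val_eqE /= => h ->.
  by move: h; rewrite /other /= -val_eqE /=; case: eqP; case: dashes; lia.
rewrite !inE /other /= => h1 h2; move: h1 h2; rewrite -!val_eqE /= => h1 h2.
case: eqP h1 => e1 h1; case: eqP h2 => e2 h2 e3; congr (_, _); apply: val_inj => /=;
  move: h1 h2; rewrite ?e3; move: (congr1 val e3) => /=; case: dashes; lia.
Qed.

Lemma top_poly_enum dashes :
  top_poly m dashes = \prod_(p <- enum (top_pairs m dashes)) pair_sum p.
Proof. by rewrite /top_poly big_enum. Qed.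

Lemma top_homog dashes : top_poly m dashes \is #|top_pairs m dashes|.-homog.
Proof. by rewrite top_poly_enum cardE homog_prod_pairs. Qed.

Lemma top_below_staircase dashes : below_staircase (top_poly m dashes).
Proof.
apply/allP=> e; rewrite top_poly_enum => he; apply/forallP=> k.
have -> : (e k < m - k)%N = (e k <= m - k.+1)%N by have := ltn_ord k; lia.
apply: leq_trans (exponents_prod_pairs k he) _.
rewrite -sum1_count big_enum_cond; apply: leq_trans (top_pairs_at dashes k).
by rewrite -sum1_card leq_eqVlt; apply/orP; left; apply/eqP/eq_bigl => p; rewrite inE.
Qed.

Definition diag_count dashes := #|[set p in top_pairs m dashes | p.1 == p.2]|.

(** A diagonal factor [x_i + x_i] is twice a variable. *)
Lemma top_divisible dashes : exists2 g : P, g \is a mpolyOver m ints &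
  top_poly m dashes = 2 ^+ diag_count dashes *: g.
Proof.
pose F p : P := if p.1 == p.2 then 'X_p.1 else pair_sum p.
exists (\prod_(p in top_pairs m dashes) F p).
  by apply: rpred_prod => p _; rewrite /F /pair_sum; case: ifP => _; rewrite ?rpredD ?mpolyOverX.
rewrite /diag_count; set S := top_pairs m dashes.
rewrite /top_poly (bigID (fun p : pair => p.1 == p.2)) [in RHS](bigID (fun p : pair => p.1 == p.2)) /=.
have -> : \prod_(p in S | p.1 == p.2) pair_sum p =
    2 ^+ #|[set p in S | p.1 == p.2]| *: \prod_(p in S | p.1 == p.2) F p.
  rewrite (eq_bigr (fun p => 2 *: F p)) => [|p /andP[_ /eqP e]].
    by rewrite scaler_prod prodr_const; congr (2 ^+ _ *: _); rewrite cardsE.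
  by rewrite /F e eqxx /pair_sum e scaler_nat mulr2n.
rewrite -scalerAl; congr (_ *: (_ * _)); apply: eq_bigr => p /andP[_ ne].
by rewrite /F (negPf ne).
Qed.

Lemma top_eval1 dashes : (top_poly m dashes).@[fun=> 1] > 0.
Proof.
rewrite /top_poly rmorph_prod /=; apply: prodr_gt0 => p _.
by rewrite /pair_sum mevalD !mevalXU.
Qed.

Definition fixed_count (w : 'S_m) := #|[set x | w x == x]|.

(** With reversed columns, the inversions of [w0] fill the staircase of the
    pairs [(a, b)] with [a + b + 2 <= m], which its diagonal cuts into two
    copies of the strict part. *)
Lemma top_counts :
  [/\ (#|top_pairs m true| = #|top_pairs m false| + diag_count true)%N,
      (#|inv (w0 m)| = 2 * #|top_pairs m false| + diag_count true)%N,
      (m = 2 * diag_count true + fixed_count (w0 m))%N & diag_count false = 0%N].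
Proof.
have swap_inj : injective (fun p : pair => (p.2, p.1)) by move=> [a b] [c d] [-> ->].
have eT : #|top_pairs m true| = (#|top_pairs m false| + diag_count true)%N.
  rewrite -(cardsID (top_pairs m false) (top_pairs m true)); congr (_ + _)%N;
    apply: eq_card => -[a b]; rewrite !inE -?val_eqE /=; lia.
split=> //; last 2 first.
- pose lt := [set x : 'I_m | (x < m - x.+1)%N]; pose gt := [set x : 'I_m | (m - x.+1 < x)%N].
  have e1 : diag_count true = #|lt|.
    rewrite -(card_imset lt (fun x y (e : (x, x) = (y, y)) => congr1 fst e)).
    apply: eq_card => -[a b]; rewrite !inE -?val_eqE /=; apply/idP/imsetP.
      case/andP=> h /eqP e; exists a; first by rewrite inE; lia.
      by congr (_, _); apply: val_inj.
    by case=> x; rewrite inE => h [-> ->]; lia.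
  have e2 : #|gt| = #|lt|.
    rewrite -(card_imset lt (@rev_ord_inj m)); apply: eq_card => x.
    rewrite -[x]rev_ordK mem_imset; last exact: rev_ord_inj.
    by rewrite !inE /=; have := ltn_ord x; lia.
  have e3 : #|~: (lt :|: gt)| = fixed_count (w0 m).
    apply: eq_card => x; rewrite !inE permE -val_eqE /=; have := ltn_ord x; lia.
  have e4 : lt :&: gt = set0 by apply/setP=> x; rewrite !inE; lia.
  have := cardsC (lt :|: gt); rewrite e3 cardsU e4 cards0 e2 -e1 card_ord; lia.
- apply: eq_card0 => -[a b]; rewrite !inE -val_eqE /=; lia.
pose Q := [set p : pair | (p.1 + p.2 + 2 <= m)%N].
have <- : #|Q| = #|inv (w0 m)|.
  have f_inj : injective (fun p : pair => (p.1, rev_ord p.2)).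
    move=> [a b] [c d] e; have := congr1 fst e; have := congr1 snd e.
    by move=> /= /rev_ord_inj-> ->.
  rewrite inv_w0E -(card_imset Q f_inj); apply: eq_card => -[a b].
  have -> : (a, b) = (fun p : pair => (p.1, rev_ord p.2)) (a, rev_ord b).
    by rewrite /= rev_ordK.
  by rewrite mem_imset // !inE /=; have := ltn_ord b; lia.
rewrite -(cardsID (top_pairs m true) Q) (_ : Q :&: _ = top_pairs m true); last first.
  by apply/setP=> -[a b]; rewrite !inE /=; lia.
rewrite eT (_ : #|Q :\: _| = #|top_pairs m false|); first by lia.
rewrite -(card_imset (top_pairs m false) swap_inj); apply: eq_card => -[a b].
have -> : (a, b) = (fun p : pair => (p.2, p.1)) (b, a) by [].
by rewrite mem_imset // !inE /=; lia.
Qed.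

End TopShape.

(** * Steps away from the longest element *)

Section Paths.
Variables (m : nat) (dashes : bool).
Local Notation P := {mpoly rat[m]}.
Local Notation top := (top_poly m dashes).
Local Notation orbit := (@orbit_index m dashes).
Local Notation attached := (@attached m dashes P (@ddiff m) top).
Local Notation inv := Defs.inv.
Implicit Types (i j : 'I_m.-1) (pi tau : 'S_m) (f g : P) (u : seq 'I_m.-1).

Definition down i pi : 'S_m := if ev pi i == i.+1 then (simple i * pi)%g else conj i pi.

Lemma conjK i pi : conj i (conj i pi) = pi.
Proof. by rewrite /conj -!mulgA simpleK mulg1 mulgA simpleK mul1g. Qed.

Lemma fixed_count_conj i pi : fixed_count (conj i pi) = fixed_count pi.
Proof.
rewrite /fixed_count -(card_imset [set x | pi x == x] (@perm_inj _ (simple i))).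
apply: eq_card => x; have e : simple i (simple i x) = x by exact: tpermK.
rewrite -[X in X \in imset _ _]e mem_imset; last exact: perm_inj.
by rewrite !inE /conj !permM -[X in _ == X]e (inj_eq perm_inj).
Qed.

Lemma fixed_count_dash i pi : orbit pi -> fixes i pi ->
  fixed_count pi = (fixed_count (simple i * pi)%g).+2.
Proof.
move=> ho /andP[/eqP e1 /eqP e2].
have el : pi (lo i) = lo i by apply: val_inj; rewrite /= -ev_ord.
have eh : pi (hi i) = hi i by apply: val_inj; rewrite /= -ev_ord.
rewrite /fixed_count (cardsD1 (lo i)) (cardsD1 (hi i)) !inE el eh !eqxx.
rewrite eq_sym lo_neq_hi /= !add1n; congr _.+2; apply: eq_card => x; rewrite !inE permM.
have [->|nh] := eqVneq x (hi i); first by rewrite simple_hi el (negPf (lo_neq_hi i)).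
have [->|nl] := eqVneq x (lo i).
  by rewrite simple_lo eh; apply/esym/negbTE; rewrite -val_eqE /=; lia.
by rewrite /= [simple i x]tpermD // eq_sym.
Qed.

(** A solid step towards [w0] adds two inversions; a dashed one adds one
    inversion and removes two fixed points. So twice the number of
    inversions minus the number of fixed points grows by four in both cases. *)
Lemma rank_up i pi : orbit pi -> (ev pi i < ev pi i.+1)%N ->
  (2 * #|inv (up i pi)| + fixed_count pi = 2 * #|inv pi| + fixed_count (up i pi) + 4)%N.
Proof.
move=> ho; rewrite -ev_lo -ev_hi => asc; have hi := orbit_invol ho.
have [fx|nfx] := boolP (fixes i pi).
  have := len_simple_ascent hi asc; rewrite !lenE dash_up // (fixed_count_dash ho fx).
  by rewrite fixes_commute // => ->; lia.
rewrite conj_up // fixed_count_conj; have ne : simple i *o pi *o simple i != pi.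
  apply: contra nfx => /eqP e; have [e1 e2] := conj_eq_ascent hi asc e.
  by rewrite /fixes -ev_lo -ev_hi e1 e2 !eqxx.
by have [_] := conj_cover hi asc ne; rewrite !lenE mulgA => ->; lia.
Qed.

Lemma swap_commute i pi : ev pi i = i.+1 -> ev pi i.+1 = i ->
  (simple i * pi = pi * simple i)%g.
Proof.
move=> e1 e2; rewrite conjgC /simple tpermJ.
have -> : pi (lo i) = hi i by apply: val_inj; rewrite /= -ev_ord.
have -> : pi (hi i) = lo i by apply: val_inj; rewrite /= -ev_ord.
by rewrite tpermC.
Qed.

(** The excluded case is that of an adjacent exchange in the symplectic
    case, where no edge exists. *)
Lemma down_spec i pi : orbit pi -> (ev pi i.+1 < ev pi i)%N ->
    dashes || (ev pi i != i.+1) ->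
  [/\ orbit (down i pi), (ev (down i pi) i < ev (down i pi) i.+1)%N,
      up i (down i pi) = pi &
      fixed_count (down i pi) = (fixed_count pi + 2 * (ev pi i == i.+1))%N].
Proof.
move=> ho des; have [h1 h2] := ho; rewrite /down; case: eqP => [e1|ne] ok.
  have hd : dashes by rewrite orbF in ok.
  have e2 : ev pi i.+1 = i by rewrite -e1 h1.
  have fx : fixes i (simple i * pi)%g by rewrite /fixes !ev_left !sw_near e1 e2 !eqxx.
  have cm := swap_commute e1 e2.
  have o : orbit (simple i * pi)%g.
    split=> [x|]; last by left.
    rewrite -evM {1}cm -mulgA [(simple i * (simple i * pi))%g]mulgA.
    by rewrite simpleK mul1g evM.
  split=> //; first by rewrite !ev_left !sw_near e1 e2.
    by rewrite dash_up // mulgA simpleK mul1g.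
  by rewrite (fixed_count_dash o fx) mulgA simpleK mul1g muln1 addn2.
have ne2 : ev pi i.+1 <> i by move=> e; apply: ne; rewrite -[X in ev pi X = _]e h1.
have o := orbit_conj i ho.
have nfx : ~~ fixes i (conj i pi).
  rewrite /fixes !ev_conj !sw_near; apply/negP=> /andP[/eqP a1 /eqP a2].
  by keep_arith; move: a1 a2; sw_split; lia.
split=> //; last by rewrite fixed_count_conj muln0 addn0.
  by rewrite !ev_conj !sw_near; keep_arith; sw_split; lia.
by rewrite conj_up // conjK.
Qed.

Lemma attached_down i pi f : orbit pi -> (ev pi i.+1 < ev pi i)%N ->
    dashes || (ev pi i != i.+1) -> attached pi f ->
  attached (down i pi) (ddiff i f).
Proof.
move=> ho des ok hf; have [o asc upd _] := down_spec ho des ok.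
by apply: attached_step; rewrite ?upd.
Qed.

(* For odd [m] the element [w0] has a fixed point, which the symplectic case
   excludes. *)
Hypothesis parity : dashes || ~~ odd m.

Lemma ddiff_opC i j f : (i.+1 < j)%N \/ (j.+1 < i)%N ->
  ddiff i (ddiff j f) = ddiff j (ddiff i f).
Proof. by move/orP; exact: ddiff_comm. Qed.

Lemma ddiff_opB i j f : i.+1 = j :> nat \/ j.+1 = i :> nat ->
  ddiff i (ddiff j (ddiff i f)) = ddiff j (ddiff i (ddiff j f)).
Proof. by case=> e; [exact: ddiff_braid | exact/esym/ddiff_braid]. Qed.

Lemma crossing_w0 : crossing_at dashes (@ddiff m) top (w0 m).
Proof.
move=> i j f hf ij; rewrite (attached_w0 hf); have im := ltn_ord i; have jm := ltn_ord j.
rewrite !ev_w0; try lia; move=> e1 e2; apply: top_crossing => //; lia.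
Qed.

Lemma hook_w0 : hook_at dashes (@ddiff m) top (w0 m).
Proof.
move=> i j f hf ij; rewrite (attached_w0 hf); have im := ltn_ord i; have jm := ltn_ord j.
rewrite !ev_w0; try lia; move=> e1 e2; apply: top_hook => //; try lia.
Qed.

Lemma nest_w0 : nest_at dashes (@ddiff m) top (w0 m).
Proof.
move=> hd p q r f hf pq qr; rewrite (attached_w0 hf); have pm := ltn_ord p; have qm := ltn_ord q.
rewrite !ev_w0; try lia; move=> e1 e2; apply: top_nest => //; lia.
Qed.

Lemma swap_w0 : swap_at dashes (@ddiff m) 0 top (w0 m).
Proof.
move=> nd i f hf; rewrite (attached_w0 hf); have im := ltn_ord i.
rewrite !ev_w0; try lia; move=> e1; apply: top_swap => //; lia.
Qed.

Lemma attached_unique pi f g : orbit pi -> attached pi f -> attached pi g -> f = g.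
Proof.
move=> ho; have [U _] := attached_relations ddiff_opC ddiff_opB (@ddiff0 m)
  crossing_w0 hook_w0 nest_w0 swap_w0 ho.
exact: U.
Qed.

Lemma attached_kills_ascent pi i f : orbit pi -> attached pi f ->
  (ev pi i < ev pi i.+1)%N -> ddiff i f = 0.
Proof.
exact: (attached_ascent ddiff_opC ddiff_opB (@ddiff0 m)
  crossing_w0 hook_w0 nest_w0 swap_w0 (@ddiffK m)).
Qed.

Lemma attached_kills_swap pi i f : ~~ dashes -> orbit pi -> attached pi f ->
  ev pi i = i.+1 -> ddiff i f = 0.
Proof.
move=> nd ho hf; have [_ [_ _ _ sw0]] := attached_relations ddiff_opC ddiff_opB (@ddiff0 m)
  crossing_w0 hook_w0 nest_w0 swap_w0 ho.
exact: sw0.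
Qed.

End Paths.

(** * The Schubert expansion of the top polynomial *)

Section Expansion.
Variables (m : nat) (dashes : bool).
Hypothesis parity : dashes || ~~ odd m.
Local Notation P := {mpoly rat[m]}.
Local Notation top := (top_poly m dashes).
Local Notation orbit := (@orbit_index m dashes).
Local Notation attached := (@attached m dashes P (@ddiff m) top).
Local Notation inv := Defs.inv.
Implicit Types (i j : 'I_m.-1) (pi tau w v : 'S_m) (f g : P) (u : seq 'I_m.-1).

Lemma orbit_w0 : orbit (w0 m).
Proof.
split=> [x|].
  have [lt|le] := ltnP x m; last by rewrite !(ev_out _ le).
  by rewrite !ev_w0; lia.
case/orP: parity => [|ev_m]; [by left | right=> x lt; rewrite ev_w0 //; lia].
Qed.

(** Every letter follows an edge or annihilates, by [attached_kills_ascent]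
    and [attached_kills_swap]. *)
Lemma ddiff_word_attached u : ddiff_word u top = 0 \/
  exists pi, [/\ orbit pi, attached pi (ddiff_word u top) &
    (2 * #|inv pi| + 4 * size u + fixed_count (w0 m) =
     2 * #|inv (w0 m)| + fixed_count pi)%N].
Proof.
elim: u => [|i u [IH|[pi [ho hf rk]]]] /=.
- by right; exists (w0 m); split; [exact: orbit_w0 | exact: attached_top | lia].
- by left; rewrite IH ddiff0.
have [asc|des|e] := ltngtP (ev pi i) (ev pi i.+1); last 1 first.
- by have := ev_inj ho e; lia.
- by left; exact: (attached_kills_ascent parity ho hf).
have [ok|/norP[nd /negPn/eqP e]] := boolP (dashes || (ev pi i != i.+1)); last first.
  by left; exact: (attached_kills_swap parity nd ho hf).
have [o asc upd _] := down_spec ho des ok; have := rank_up o asc; rewrite upd => rk'.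
right; exists (down i pi); split=> //; first exact: attached_down.
by move: rk rk'; move: #|inv pi| #|inv (down i pi)| #|inv (w0 m)| => a b c; lia.
Qed.

Lemma fixed_count_le pi : (fixed_count pi <= m)%N.
Proof. by apply: leq_trans (max_card _) _; rewrite card_ord. Qed.

Lemma inv0_eq1 pi : #|inv pi| = 0%N -> pi = 1%g.
Proof.
move=> z; apply: increasing_id => i; have [//|des] := orP (ascent_or_descent pi i).
by have := card_inv_descent des; rewrite z.
Qed.

Lemma fixed_count_fpf pi : ~~ dashes -> orbit pi -> fixed_count pi = 0%N.
Proof.
move=> nd [_ [hd|h2]]; first by rewrite hd in nd.
apply: eq_card0 => x; rewrite !inE; apply/negbTE/eqP=> e.
by apply: (h2 x (ltn_ord x)); rewrite ev_ord e.
Qed.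

(** The [m/2] cycles [(x, y)] of a fixed-point-free involution are
    inversions, so by assumption they are the only ones. If [x+1] lies
    strictly between [x] and [y], then [(x, x+1)] or [(x+1, y)] is one more. *)
Lemma bottom_adjacent pi : ~~ dashes -> orbit pi -> (2 * #|inv pi| = m)%N ->
  forall x, (x < ev pi x)%N -> ev pi x = x.+1.
Proof.
move=> nd ho hm; have [h1 [hd|h2]] := ho; first by rewrite hd in nd.
pose up_set := [set x : 'I_m | (x < pi x)%N]; pose down_set := [set x : 'I_m | (pi x < x)%N].
have piK x : pi (pi x) = x by apply: val_inj; rewrite /= -!ev_ord h1.
have e1 : #|down_set| = #|up_set|.
  rewrite -(card_imset up_set (@perm_inj _ pi)); apply: eq_card => x.
  by rewrite -[x]piK mem_imset; [rewrite !inE !piK | exact: perm_inj].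
have e2 : #|up_set| + #|down_set| = m.
  rewrite -[RHS]card_ord -(cardsC up_set); congr (_ + _)%N; apply: eq_card => x.
  by rewrite !inE; have := h2 x (ltn_ord x); rewrite ev_ord; lia.
pose cyc (x : 'I_m) := (x, pi x).
have cyc_inj : injective cyc by move=> x y [].
have sub : cyc @: up_set \subset inv pi.
  by apply/subsetP=> p /imsetP[x]; rewrite inE => lt ->; rewrite inE /= piK lt.
have eq_inv : cyc @: up_set = inv pi.
  apply/eqP; rewrite eqEcard sub card_imset //=.
  by move: hm e2; rewrite e1; move: #|inv pi| #|up_set| => a b; lia.
have inv_cyc (a b : 'I_m) : (a < b)%N -> (pi b < pi a)%N -> b = pi a.
  move=> ab ba; have : (a, b) \in inv pi by rewrite inE /= ab.
  by rewrite -eq_inv => /imsetP[x _ [-> ->]].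
move=> x; have [lt|le] := ltnP x m; last by rewrite (ev_out _ le) ltnn.
pose X : 'I_m := Ordinal lt; rewrite -[x]/(val X) ev_ord => ltx.
have ltx1 : (x.+1 < m)%N by apply: leq_ltn_trans (ltn_ord (pi X)).
pose Y : 'I_m := Ordinal ltx1.
have [eY|neY] := eqVneq Y (pi X); first by rewrite -eY.
have ltY : (Y < pi X)%N.
  by rewrite ltn_neqAle ltx andbT; apply: contra neY => /eqP e; apply/eqP/val_inj.
have [lt1|le1] := ltnP (pi Y) (pi X).
  by rewrite -(inv_cyc X Y) ?ltnSn // eqxx in neY.
have lt2 : (pi (pi X) < pi Y)%N.
  by rewrite piK; apply: leq_trans le1; exact: ltnW.
have e := inv_cyc _ _ ltY lt2.
by move: (congr1 pi e); rewrite !piK => /(congr1 val)/=; lia.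
Qed.

(** By the counts of [top_counts], words as long as the degree of the top
    polynomial lead to the identity in the orthogonal case, and to an
    involution with [m/2] inversions in the symplectic case. The latter
    pairs neighbours, starting from the left. *)
Lemma bottom_unique pi tau : orbit pi -> orbit tau ->
    (2 * #|inv pi| + 4 * #|top_pairs m dashes| + fixed_count (w0 m) =
     2 * #|inv (w0 m)| + fixed_count pi)%N ->
    (2 * #|inv tau| + 4 * #|top_pairs m dashes| + fixed_count (w0 m) =
     2 * #|inv (w0 m)| + fixed_count tau)%N ->
  pi = tau.
Proof.
have [c1 c2 c3 _] := top_counts m.
have ep := fixed_count_le pi; have et := fixed_count_le tau.
move=> hp ht; have [hd|nd] := boolP dashes.
  rewrite c1 c2 => e1 e2.
  have -> : pi = 1%g.
    apply: inv0_eq1; move: e1 ep c3; clear; move: #|inv pi| => a; lia.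
  apply/esym/inv0_eq1; move: e2 et c3; clear; move: #|inv tau| => a; lia.
rewrite (fixed_count_fpf nd hp) (fixed_count_fpf nd ht) (fixed_count_fpf nd orbit_w0) in c3 *.
rewrite c2 => e1 e2.
have {}e1 : (2 * #|inv pi| = m)%N.
  by move: e1 c3; clear; move: #|inv pi| => a; lia.
have {}e2 : (2 * #|inv tau| = m)%N.
  by move: e2 c3; clear; move: #|inv tau| => a; lia.
have hp1 := bottom_adjacent nd hp e1; have ht1 := bottom_adjacent nd ht e2.
have [kp [hdp|fp]] := hp; first by rewrite hdp in nd.
have [kt [hdt|ft]] := ht; first by rewrite hdt in nd.
apply: ev_ext => x; elim/ltn_ind: x => x IH.
have [lt|le] := ltnP x m; last by rewrite !ev_out.
have := fp x lt; have := ft x lt => nt np.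
have [l1|l1|//] := ltngtP (ev pi x) x.
  by have := IH _ l1; rewrite kp => e; rewrite [in RHS]e kt.
have [l2|l2|//] := ltngtP (ev tau x) x.
  by have := IH _ l2; rewrite kt => e; rewrite -[in LHS]e kp.
by rewrite hp1 // ht1.
Qed.

Lemma ddiff_word_homog u f d : f \is d.-homog ->
  ddiff_word u f = 0 \/ (size u <= d)%N /\ ddiff_word u f \is (d - size u).-homog.
Proof.
move=> hf; elim: u => [|i u [IH|[le hu]]] /=.
- by right; rewrite subn0.
- by left; rewrite IH ddiff0.
case e: (d - size u)%N hu => [|c] hu; first by left; exact: ddiff_homog0.
by right; split; [lia | rewrite (_ : d - (size u).+1 = c)%N; [exact: ddiff_homog | lia]].
Qed.

Lemma ddiff_word_const u f d : f \is d.-homog -> (ddiff_word u f)@_0 != 0 -> size u = d.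
Proof.
move=> hf nz; have [z|[le hu]] := ddiff_word_homog u hf.
  by rewrite z mcoeff0 eqxx in nz.
have [|lt] := eqVneq (d - size u)%N 0%N; first by lia.
by rewrite (dhomog_nemf_coeff hu) ?eqxx // /= mdeg0 eq_sym in nz.
Qed.

(** A word whose length is the degree of the top polynomial can reach only
    one element, whose polynomial is the same along all paths. *)
Lemma top_coefficients :
  exists c : rat, forall v, schubert_form v top = 0 \/ schubert_form v top = c.
Proof.
have const_step v : schubert_form v top != 0 -> exists pi, [/\ orbit pi,
    attached pi (ddiff_word (reduced_word v) top) &
    (2 * #|inv pi| + 4 * #|top_pairs m dashes| + fixed_count (w0 m) =
     2 * #|inv (w0 m)| + fixed_count pi)%N].
  move=> nz; have sz := ddiff_word_const (top_homog m dashes) nz.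
  have [z|[pi [ho hf rk]]] := ddiff_word_attached (reduced_word v).
    by rewrite /schubert_form z mcoeff0 eqxx in nz.
  by exists pi; split=> //; rewrite -sz.
have [/existsP[v0 nz0]|/existsPn all0] := boolP [exists v, schubert_form v top != 0].
  exists (schubert_form v0 top) => v.
  have [->|nz] := eqVneq (schubert_form v top) 0; [by left | right].
  have [pi [hp hfp rp]] := const_step v nz.
  have [tau [ht hft rt]] := const_step v0 nz0.
  have e := bottom_unique hp ht rp rt; rewrite -e in hft.
  by rewrite /schubert_form (attached_unique parity hp hfp hft).
by exists 0 => v; left; apply/eqP; have := all0 v; rewrite negbK.
Qed.

Lemma meval1_schubert_ge0 w : 0 <= (schubert w).@[fun=> 1].
Proof.
rewrite mevalE; apply: sumr_ge0 => e _; apply: mulr_ge0.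
  by have /mpolyOverP/(_ e)/natrP[k ->] := schubert_nat w.
by apply: prodr_ge0 => i _; rewrite expr1n.
Qed.

Lemma ddiff_word_int u f : f \is a mpolyOver m ints -> ddiff_word u f \is a mpolyOver m ints.
Proof. by move=> hf; elim: u => //= i u; exact: ddiff_int. Qed.

(** The common value of the nonzero coefficients is not negative, since the
    top polynomial is positive at [(1, ..., 1)] and Schubert polynomials are
    nonnegative there. After division by the power of two the coefficients
    are still integers, being constant terms of divided differences of an
    integral polynomial. *)
Lemma top_expansion : exists a : 'S_m -> nat,
  top = 2 ^+ diag_count m dashes *: \sum_w (a w)%:R *: schubert w.
Proof.
have [g gint top_g] := top_divisible m dashes.
set h := diag_count m dashes in top_g *.
have h_gt0 : 0 < 2 ^+ h :> rat by rewrite exprn_gt0.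
have formE v : schubert_form v top = 2 ^+ h * schubert_form v g.
  by rewrite /schubert_form top_g ddiff_wordZ mcoeffZ.
have [c hc] := top_coefficients.
have top_exp := schubert_expansion (top_below_staircase m dashes).
have c_ge0 : 0 <= c \/ forall v, schubert_form v top = 0.
  have [|lt] := lerP 0 c; [by left | right=> v].
  have := top_eval1 m dashes; rewrite top_exp raddf_sum /= => pos; exfalso.
  move: pos; rewrite ltNge => /negP; apply; apply: sumr_le0 => w _.
  rewrite mevalZ; apply: mulr_le0_ge0 (meval1_schubert_ge0 w).
  by case: (hc w) => ->; rewrite // ltW.
have form_nat v : schubert_form v g \is a Num.nat.
  rewrite natrEint; apply/andP; split.
    by have /mpolyOverP := ddiff_word_int (reduced_word v) gint; apply.
  rewrite -(pmulr_rge0 _ h_gt0) -formE.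
  case: c_ge0 => [c0|->//]; by case: (hc v) => ->.
exists (fun v => Num.truncn (schubert_form v g)).
rewrite {1}top_exp scaler_sumr; apply: eq_bigr => v _.
by rewrite scalerA formE truncnK.
Qed.

End Expansion.

(** * Labelled paths *)

Section SchubertPositive.
Variable m : nat.
Local Notation P := {mpoly rat[m]}.
Implicit Types (f g : P).

Definition schubert_positive f :=
  exists c : 'S_m -> nat, f = \sum_w (c w)%:R *: schubert w.

Lemma schubert_positive_ddiff i f : schubert_positive f -> schubert_positive (ddiff i f).
Proof.
case=> c ->; exists (fun w => if descent (simple i * w)%g i then c (simple i * w)%g else 0%N).
rewrite ddiff_sum [RHS](reindex_inj (mulgI (simple i))) /=; apply: eq_bigr => w _.
rewrite mulgA simpleK mul1g ddiffZ ddiff_schubert.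
by case: ifP => _; rewrite ?scaler0 ?scale0r.
Qed.

Lemma schubert_positive_word u f : schubert_positive f -> schubert_positive (ddiff_word u f).
Proof. by move=> hf; elim: u => //= i u; exact: schubert_positive_ddiff. Qed.

Lemma schubert_positive_scale (n : nat) f :
  schubert_positive f -> schubert_positive (n%:R *: f).
Proof.
case=> c ->; exists (fun w => n * c w)%N; rewrite scaler_sumr.
by apply: eq_bigr => w _; rewrite scalerA natrM.
Qed.

Lemma schubert_positive_nat f : schubert_positive f -> f \is a mpolyOver m (Num.nat : {pred rat}).
Proof.
case=> c ->; have : \sum_w (c w)%:R *: schubert w \is a mpolyOver m nats.
  apply: rpred_sum => w _; apply: mpolyOverZ (schubert_nat w).
  exact: rpred_nat.
by [].
Qed.

End SchubertPositive.

Section LabelledPathValues.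
Variables (m : nat) (dashes : bool).
Hypothesis parity : dashes || ~~ odd m.
Local Notation P := {mpoly rat[m]}.
Local Notation top := (top_poly m dashes).
Local Notation orbit := (@orbit_index m dashes).
Local Notation attached := (@attached m dashes P (@ddiff m) top).
Variable act : 'I_m.-1 -> 'S_m -> 'S_m.
Variable edge : 'I_m.-1 -> 'S_m -> P -> P.

(** What the orthogonal and the symplectic action have in common: they move
    from [w0] down by [down], and the edge is dashed when [i] and [i+1] are
    exchanged. *)
Definition downward_edges := forall i pi, orbit pi -> act i pi != pi ->
  [/\ (ev pi i.+1 < ev pi i)%N, dashes || (ev pi i != i.+1), act i pi = down i pi &
      forall f, edge i pi f = 2^-1 ^+ (ev pi i == i.+1) *: ddiff i f].

Hypothesis act_down : downward_edges.

(** The number [k] of dashed edges depends only on the end of the path,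
    because each of them creates two fixed points. *)
Lemma path_attached u : is_path act u ->
  orbit (path_end act u) /\ exists k,
  [/\ path_poly act edge top u = 2^-1 ^+ k *: ddiff_word u top,
      attached (path_end act u) (ddiff_word u top) &
      (fixed_count (path_end act u) = 2 * k + fixed_count (w0 m))%N].
Proof.
elim: u => [_|i u IH] /=.
  split; first exact: orbit_w0.
  by exists 0%N; split; rewrite ?expr0 ?scale1r //; exact: attached_top.
case/andP=> /IH[ho [k [eP hf fk]]] ne.
have [des ok eA eE] := act_down ho ne.
have [o _ _ fd] := down_spec ho des ok.
rewrite -!/(path_end act u) eA; split=> //.
exists (k + (ev (path_end act u) i == i.+1))%N; split.
- by rewrite eE eP ddiffZ scalerA -exprD addnC.
- exact: attached_down.
by rewrite fd fk; lia.
Qed.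

Lemma path_poly_unique pi u u' : labelled_path act u pi -> labelled_path act u' pi ->
  path_poly act edge top u = path_poly act edge top u'.
Proof.
case/andP=> /path_attached[ho [k [-> hf fk]]] /eqP e.
case/andP=> /path_attached[_ [k' [-> hf' fk']]] /eqP e'.
rewrite e in ho hf fk; rewrite e' in hf' fk'.
have -> : k = k' by lia.
by rewrite (attached_unique parity ho hf hf').
Qed.

(** The power of two in the top polynomial absorbs the factors 1/2 of the
    path, and divided differences preserve nonnegative combinations. *)
Lemma path_poly_positive pi u : labelled_path act u pi ->
  schubert_positive (path_poly act edge top u).
Proof.
case/andP=> /path_attached[ho [k [-> hf fk]]] _.
have [a ->] := top_expansion parity.
(* The path creates [2 * k] fixed points, and there is room for [2 *
   diag_count m true] of them; without dashed edges there are none. *)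
have le : (k <= diag_count m dashes)%N.
  have [_ _ c3 c4] := top_counts m.
  have [hd|nd] := boolP dashes; first by have := fixed_count_le (path_end act u); lia.
  by move: fk; rewrite (fixed_count_fpf nd ho); lia.
rewrite ddiff_wordZ scalerA -(subnK le) exprD mulrCA -exprMn mulVf ?pnatr_eq0 //.
rewrite expr1n mulr1 -natrX; apply/schubert_positive_scale/schubert_positive_word.
by exists a.
Qed.

End LabelledPathValues.

Lemma len_left_descent m (i : 'I_m.-1) (pi : 'S_m) : pi \in invol m ->
  (ev pi i.+1 < ev pi i)%N -> (len pi < len (simple i *o pi))%N = false.
Proof.
move=> /involV piV; rewrite -ev_lo -ev_hi => des.
rewrite -(len_invg (simple i *o pi)) invMg tpermV piV !lenE.
by rewrite (card_inv_descent des) ltnNge leqnSn.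
Qed.

Lemma conj_fixed_descent m dashes (i : 'I_m.-1) (pi : 'S_m) : orbit_index dashes pi ->
  (ev pi i.+1 < ev pi i)%N ->
  (simple i *o pi *o simple i != pi) = (ev pi i != i.+1).
Proof.
move=> [h1 _] des; rewrite mulgA -/(conj i pi); congr (~~ _).
apply/eqP/eqP=> [e|e1].
  have := ev_conj i pi i; have := ev_conj i pi i.+1; rewrite e !sw_near.
  by move: des; keep_arith; sw_split; lia.
have e2 : ev pi i.+1 = i by rewrite -e1 h1.
by rewrite /conj (swap_commute e1 e2) simple_mulgK.
Qed.

Lemma actO_down m : downward_edges true (@actO m) (@edgeO m).
Proof.
move=> i pi ho; rewrite /actO /edgeO; have hi := orbit_invol ho.
have [asc|des|e] := ltngtP (ev pi i) (ev pi i.+1); last by have := ev_inj ho e; lia.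
  by rewrite (len_simple_ascent hi) ?ltnSn ?eqxx // ev_lo ev_hi.
rewrite (len_left_descent hi des) (conj_fixed_descent ho des) => _; split=> //.
  rewrite /down; case: eqP => [e|_] /=; last by rewrite /conj mulgA.
  by rewrite (swap_commute e) // -e; case: ho.
by move=> f; case: eqP => _ /=; rewrite ?expr1 ?expr0 ?scale1r.
Qed.

Lemma actSp_down m : downward_edges false (@actSp m) (@edgeSp m).
Proof.
move=> i pi ho; rewrite /actSp /edgeSp; have hi := orbit_invol ho.
have [asc|des|e] := ltngtP (ev pi i) (ev pi i.+1); last by have := ev_inj ho e; lia.
  by rewrite (len_simple_ascent hi) ?ltnSn ?eqxx // ev_lo ev_hi.
rewrite (len_left_descent hi des) /= -[X in if X then _ else _]negbK.
rewrite (conj_fixed_descent ho des).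
case: ifP => [_|/negbFE ne _]; first by rewrite eqxx.
split=> //; first by rewrite /down (negPf ne) /conj mulgA.
by move=> f; rewrite (negPf ne) expr0 scale1r.
Qed.

Theorem theorem1p1 :
  ((forall (n : nat), (0 < n)%N -> forall (pi : 'S_n), pi \in invol n ->
      forall w w' : seq 'I_n.-1, labelled_pathO w pi -> labelled_pathO w' pi ->
        upsilonO_path w = upsilonO_path w') /\
   (forall (n : nat), (0 < n)%N -> forall (pi : 'S_(2 * n)), pi \in fpf_invol (2 * n) ->
      forall w w' : seq 'I_(2 * n).-1, labelled_pathSp w pi -> labelled_pathSp w' pi ->
        upsilonSp_path w = upsilonSp_path w')) /\
  ((forall (n : nat), (0 < n)%N -> forall (pi : 'S_n) (pi_inv : pi \in invol n),
      (exists c : 'S_n -> nat,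
         upsilonO pi_inv = \sum_(w : 'S_n) (c w)%:R *: schubert w) /\
      upsilonO pi_inv \is a mpolyOver n (Num.nat : {pred rat})) /\
   (forall (n : nat), (0 < n)%N ->
      forall (pi : 'S_(2 * n)) (pi_fpf : pi \in fpf_invol (2 * n)),
      (exists c : 'S_(2 * n) -> nat,
         upsilonSp pi_fpf = \sum_(w : 'S_(2 * n)) (c w)%:R *: schubert w) /\
      upsilonSp pi_fpf \is a mpolyOver (2 * n) (Num.nat : {pred rat}))).
Proof.
have even n : false || ~~ odd (2 * n) by rewrite oddM.
split; split.
- move=> n _ pi _ w w' hw hw'; rewrite /upsilonO_path upsilonO_topE.
  apply: (@path_poly_unique n true erefl (@actO n) (@edgeO n) (@actO_down n) pi w w' hw hw').
- move=> n _ pi _ w w' hw hw'; rewrite /upsilonSp_path upsilonSp_topE.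
  apply: (@path_poly_unique _ false (even n) (@actSp _) (@edgeSp _) (@actSp_down _) pi w w' hw hw').
- move=> n _ pi pi_inv.
  have pos : schubert_positive (upsilonO pi_inv).
    rewrite /upsilonO /upsilonO_path upsilonO_topE.
    exact: (path_poly_positive (dashes := true) erefl (@actO_down n) (xchooseP (pathO_exists pi_inv))).
  by split; [exact: pos | exact: schubert_positive_nat].
move=> n _ pi pi_fpf.
have pos : schubert_positive (upsilonSp pi_fpf).
  rewrite /upsilonSp /upsilonSp_path upsilonSp_topE.
  exact: (path_poly_positive (dashes := false) (even n) (@actSp_down _) (xchooseP (pathSp_exists pi_fpf))).
by split; [exact: pos | exact: schubert_positive_nat].
Qed.
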